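(* The maximum crossing number of the Cartesian product $C_3 \times C_3$ is $78$; that is, every good drawing of $C_3\times C_3$ in the plane has at most $78$ crossings, and some good drawing has exactly $78$ crossings.
   Context: $C_n$ denotes the cycle on $n$ vertices, and $G\times H$ denotes the Cartesian product of graphs $G$ and $H$: its vertex set is $V(G)\times V(H)$, and $(g,h)$ is adjacent to $(g',h')$ iff either $g=g'$ and $hh'\in E(H)$, or $h=h'$ and $gg'\in E(G)$. A drawing of a graph maps vertices to distinct points of the plane and each edge $uv$ to a continuous arc between the points of $u$ and $v$ whose interior contains no vertex points; interiors of arcs may intersect only in finitely many single points, called crossings (a crossing of two edges is counted once per intersection point). A drawing is good if no edge crosses itself, adjacent (incident) edges do not cross, and any two edges cross at most once. The maximum crossing number $\max\text{-}cr(G)$ is the maximum number of crossings over all good drawings of $G$.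
   Formalization: Good drawings are additionally required to have only proper (transversal) crossings: two edges may not merely touch at a common interior point; if touching points were allowed and counted as crossings, 79 could be attained. *)

(* Defs.v *)
From HB Require Import structures.
From mathcomp Require Import all_boot all_order all_algebra.
From mathcomp Require Import finmap.
From mathcomp Require Import all_classical all_reals all_analysis.
Set Implicit Arguments.
Unset Strict Implicit.
Unset Printing Implicit Defensive.
Import Order.TTheory GRing.Theory Num.Theory.
Import numFieldNormedType.Exports.
Local Open Scope classical_set_scope.
Local Open Scope ring_scope.

Record sgraph := SGraph {
  svertex :> finType;
  adj : rel svertex;
  adj_sym : symmetric adj;
  adj_irr : irreflexive adj }.

Definition edges (G : sgraph) : {set {set G}} :=
  [set e : {set G} | [exists x, exists y, adj x y && (e == [set x; y]%SET)]]%SET.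

Definition cycle_adj (n : nat) : rel 'I_n :=
  fun i j => (i != j) && ((j == ordS i) || (i == ordS j)).

Lemma cycle_adj_sym n : symmetric (@cycle_adj n).
Proof. by move=> i j; rewrite /cycle_adj eq_sym orbC. Qed.

Lemma cycle_adj_irr n : irreflexive (@cycle_adj n).
Proof. by move=> i; rewrite /cycle_adj eqxx. Qed.

(* This is the cycle on n vertices only for 3 <= n. *)
Definition cycle_graph (n : nat) : sgraph :=
  SGraph (@cycle_adj_sym n) (@cycle_adj_irr n).

Definition cart_adj (G H : sgraph) : rel (G * H)%type :=
  fun x y => ((x.1 == y.1) && adj x.2 y.2) || ((x.2 == y.2) && adj x.1 y.1).

Lemma cart_adj_sym G H : symmetric (@cart_adj G H).
Proof.
move=> x y; rewrite /cart_adj (eq_sym x.1) (eq_sym x.2).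
by rewrite (adj_sym x.1) (adj_sym x.2).
Qed.

Lemma cart_adj_irr G H : irreflexive (@cart_adj G H).
Proof. by move=> x; rewrite /cart_adj !adj_irr !andbF. Qed.

Definition cart_prod (G H : sgraph) : sgraph :=
  SGraph (@cart_adj_sym G H) (@cart_adj_irr G H).

Notation plane R := (R * R)%type (only parsing).

Definition inner (R : realType) (a : R -> plane R) : set (plane R) :=
  a @` [set t | 0 < t < 1].

Definition homeomorphism_on (S T : topologicalType) (U : set S) (V : set T)
    (h : S -> T) : Prop :=
  exists k : T -> S,
    [/\ {within U, continuous h}, {within V, continuous k},
        forall x, U x -> V (h x) /\ k (h x) = x &
        forall y, V y -> U (k y) /\ h (k y) = y].

(* A and B cross at p, as opposed to merely touching there: in a suitable
   chart around p, the sets A and B are the two coordinate axes. *)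
Definition cross_at (R : realType) (A B : set (plane R)) (p : plane R) : Prop :=
  [/\ A p, B p &
    exists (U V : set (plane R)) (h : plane R -> plane R),
      [/\ open U, open V, U p, homeomorphism_on U V h &
          forall q, U q -> (A q <-> (h q).2 = 0) /\ (B q <-> (h q).1 = 0)]].

(* The values of darc outside edges G are irrelevant.  The direction in which
   an edge is parametrized is arbitrary. *)
Record drawing (R : realType) (G : sgraph) := Drawing {
  dpoint : G -> plane R;
  darc : {set G} -> R -> plane R;
  dpoint_inj : injective dpoint;
  darc_cont : forall e, e \in edges G -> {within `[0, 1], continuous (darc e)};
  darc_ends : forall e, e \in edges G ->
    [set darc e 0; darc e 1] = dpoint @` [set` e];
  darc_vertex : forall e v, e \in edges G -> ~ inner (darc e) (dpoint v);
  darc_self_finite : forall e, e \in edges G ->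
    finite_set [set st : R * R |
      [/\ 0 < st.1, st.1 < st.2, st.2 < 1 & darc e st.1 = darc e st.2]];
  darc_finite : forall e f, e \in edges G -> f \in edges G -> e != f ->
    finite_set (inner (darc e) `&` inner (darc f)) }.

(* Common interior points of two edges must be genuine crossings: tangential
   contacts are excluded by good_cross. *)
Record good_drawing (R : realType) (G : sgraph) (D : drawing R G) : Prop :=
  GoodDrawing {
  good_self : forall e, e \in edges G -> {in `[0, 1] &, injective (darc D e)};
  good_incident : forall e f, e \in edges G -> f \in edges G -> e != f ->
    e :&: f != finset.set0 -> inner (darc D e) `&` inner (darc D f) = set0;
  good_once : forall e f, e \in edges G -> f \in edges G -> e != f ->
    is_subset1 (inner (darc D e) `&` inner (darc D f));
  good_cross : forall e f p, e \in edges G -> f \in edges G -> e != f ->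
    (inner (darc D e) `&` inner (darc D f)) p ->
    cross_at (inner (darc D e)) (inner (darc D f)) p }.

(* P ranges over the unordered pairs of distinct edges, so a point common to
   several edges is counted once for each pair.  Self-crossings, absent from
   good drawings, are not counted. *)
Definition crossings (R : realType) (G : sgraph) (D : drawing R G) : nat :=
  (\sum_(P : {set {set G}} | (P \subset edges G) && (#|P| == 2))
     #|` fset_set (\bigcap_(e in [set` P]) inner (darc D e)) |)%N.

Definition is_max_cr (R : realType) (G : sgraph) (m : nat) : Prop :=
  (forall D : drawing R G, good_drawing D -> (crossings D <= m)%N) /\
  (exists D : drawing R G, good_drawing D /\ crossings D = m).

(* Main.v *)
(* Call a pair of disjoint edges that do not cross a deficit.  C_3 x C_3 has 99
   pairs of disjoint edges, and two edges of a good drawing cross at most once,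
   and only if they are disjoint; so the claim is that a good drawing has at
   least 21 deficits and that 21 can be attained.

   Topology enters only through parity: two closed curves that meet only in
   proper crossings do so an even number of times.  Here the parity of the
   number of crossings of two arcs b and g is, by definition, the parity of the
   winding number of (s, t) |-> b s - g t around the boundary of the unit square,
   and the latter is the monodromy of the complex square root.  Applied to
   vertex-disjoint cycles this gives the parity of their number of deficits.
   Applied to closed curves made of parts of edges, switching at crossings, it
   forbids some crossing patterns of small subgraphs, for every possible order
   of the crossings along the edges: a 4-cycle cannot have both pairs of
   opposite edges crossing, and of the pairs formed by an edge at a vertex v and
   the edge opposite to v in the other triangle through v one is a deficit.

   The nine 4-cycles and the nine vertices thus give 18 distinct deficits, and
   the parity conditions for parallel triangles raise this to 19.  With 20
   deficits there would be one unit of excess among the edges of parallel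
   triangles and at most one at the vertices.  The parity conditions for a
   triangle and a 4-cycle locate the excess, and two further forbidden patterns
   (a 4-cycle with a triangle on one of its edges, and a triangle with a pendant
   path) then give a contradiction.

   In the drawing with 21 deficits every edge consists of two segments with
   small integer coordinates, so that it can be verified by evaluating signs of
   3 x 3 determinants. *)

Require Import Defs.
From Stdlib Require Import BinNat.
From mathcomp Require Import all_boot all_order all_algebra finmap.
From mathcomp Require Import all_classical all_reals all_analysis.
From mathcomp Require Import ring lra zify.
Set Implicit Arguments.
Unset Strict Implicit.
Unset Printing Implicit Defensive.
Import Order.TTheory GRing.Theory Num.Theory numFieldNormedType.Exports.
Local Open Scope classical_set_scope.
Local Open Scope ring_scope.

(** * Square roots in the plane *)

(** No separation theorem for closed curves is used. The index of two arcs is a sum of side terms,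
    each depending on one arc and one endpoint of the other; over a closed chain the endpoints
    cancel, and this gives the parity statement. The obstacle lies in the curves with switches: the
    two curves used against a pattern run along different parts of the same edges and turn at the
    same crossings, so they touch. Only one of them is modified. Its pieces are shortened by a small
    [d] at the crossings where it turns and are rejoined by short links inside the charts; the other
    curve is left as it is. Whether this separates the two depends only on the order of the
    crossings along the edges, hence can be decided by computation. A good drawing may have points
    on three edges. Such a point would spoil the linear order of the crossings along an edge and
    bring a third edge into a chart. Therefore every pattern that is refuted prescribes all
    crossings among its edges and contains no three pairwise crossing edges. *)

Ltac order_lra := repeat match goal with
  | H := _ |- _ => clearbody H
  | H : forall _, _ |- _ => clear H
  end; lra.

Section PlaneSqrt.
Variable R : realType.
Notation P := (R * R)%type.
Implicit Types (z w s : P) (x y a b t : R).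

(** The plane is read as the complex numbers, and this is the complex square; [mulc] and [divc]
    below are the complex product and quotient. *)
Definition sqr z : P := (z.1 ^+ 2 - z.2 ^+ 2, z.1 * z.2 *+ 2).

Definition dot z w : R := z.1 * w.1 + z.2 * w.2.

Lemma sqrN s : sqr (- s) = sqr s.
Proof. by rewrite /sqr /= !sqrrN mulrNN. Qed.

Lemma sum_sqr_eq0 x y : x ^+ 2 + y ^+ 2 = 0 -> x = 0 /\ y = 0.
Proof.
move/eqP; rewrite paddr_eq0 ?sqr_ge0 // !sqrf_eq0 => /andP[/eqP -> /eqP ->].
by [].
Qed.

(** Multiplicativity of the modulus: the squared norms of [s - w] and [s + w] multiply to the
    squared norm of [sqr s - sqr w]. *)
Lemma sqr_eq s w : sqr s = sqr w -> s = w \/ s = - w.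
Proof.
case: s w => [a b] [c d] [] /= e1 e2.
have /eqP : ((a - c) ^+ 2 + (b - d) ^+ 2) * ((a + c) ^+ 2 + (b + d) ^+ 2) = 0.
  transitivity ((a ^+ 2 - b ^+ 2 - (c ^+ 2 - d ^+ 2)) ^+ 2 +
                (a * b *+ 2 - c * d *+ 2) ^+ 2); first by ring.
  by rewrite e1 e2 !subrr expr0n /= addr0.
rewrite mulf_eq0 => /orP[] /eqP/sum_sqr_eq0 [h1 h2].
  by left; congr (_, _); apply/eqP; rewrite -subr_eq0 ?h1 ?h2.
by right; congr (_, _); apply/eqP; rewrite -addr_eq0 ?h1 ?h2.
Qed.

Lemma sqr_eq0 s : (sqr s == 0) = (s == 0).
Proof.
apply/eqP/eqP => [h|->]; last by rewrite /sqr /= mul0r expr0n subr0 mul0rn.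
have : sqr s = sqr 0 by rewrite h /sqr /= mul0r expr0n subr0 mul0rn.
by move=> /sqr_eq[]; rewrite ?oppr0.
Qed.

Definition nrm z : R := Num.sqrt (z.1 ^+ 2 + z.2 ^+ 2).

Lemma nrm_sqr z : nrm z ^+ 2 = z.1 ^+ 2 + z.2 ^+ 2.
Proof. by rewrite sqr_sqrtr // addr_ge0 // sqr_ge0. Qed.

Lemma nrm_ge0 z : 0 <= nrm z. Proof. exact: sqrtr_ge0. Qed.

Lemma nrm_ge1 z : `|z.1| <= nrm z.
Proof. by rewrite -sqrtr_sqr ler_wsqrtr // lerDl sqr_ge0. Qed.

(** Half-angle formulas: the squares of the two coordinates of a root are half of [nrm z + z.1] and
    half of [nrm z - z.1], and the sign of [z.2] decides their relative sign. *)
Lemma proot_ex z : exists s, sqr s = z.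
Proof.
have := nrm_ge1 z; have := nrm_sqr z; have := nrm_ge0 z.
case: z => x y /=; set m := nrm _ => m0 mE; rewrite ler_norml => /andP[m1 m2].
pose a := Num.sqrt ((m + x) / 2); pose b := Num.sqrt ((m - x) / 2).
have a2 : a ^+ 2 = (m + x) / 2 by rewrite sqr_sqrtr //; lra.
have b2 : b ^+ 2 = (m - x) / 2 by rewrite sqr_sqrtr //; lra.
have ab : a * b *+ 2 = `|y|.
  rewrite -sqrtr_sqr -[LHS]ger0_norm; last first.
    by rewrite mulrn_wge0 // mulr_ge0 // sqrtr_ge0.
  rewrite -sqrtr_sqr; congr Num.sqrt.
  have -> : (a * b *+ 2) ^+ 2 = 4 * (a ^+ 2 * b ^+ 2) by ring.
  rewrite a2 b2.
  have -> : 4 * ((m + x) / 2 * ((m - x) / 2)) = m ^+ 2 - x ^+ 2 by field.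
  by rewrite mE; ring.
have [y0|y0] := leP 0 y.
  exists (a, b); congr (_, _) => /=; last by rewrite ab ger0_norm.
  by rewrite a2 b2; field.
exists (a, - b); congr (_, _) => /=; first by rewrite sqrrN a2 b2; field.
by rewrite mulrN mulNrn ab ltr0_norm // opprK.
Qed.

(** A choice of roots without any continuity. It is only a reference that tells the two roots of a
    number apart. *)
Definition proot z : P := projT1 (cid (proot_ex z)).

Lemma prootK z : sqr (proot z) = z.
Proof. exact: projT2 (cid (proot_ex z)). Qed.

(* Which of the two square roots of [sqr s] the point [s] is. *)
Definition neg s : bool := s != proot (sqr s).

Lemma negN s : s != 0 -> neg (- s) = ~~ neg s.
Proof.
move=> s0; rewrite /neg sqrN.
have [|] := sqr_eq (prootK (sqr s)) => ->.
  by rewrite eqxx /= -subr_eq0 -opprD oppr_eq0 -mulr2n -scaler_nat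
    scaler_eq0 pnatr_eq0 (negbTE s0).
by rewrite eqxx /= -addr_eq0 -mulr2n -scaler_nat scaler_eq0 pnatr_eq0
  (negbTE s0).
Qed.

Lemma dot_eq s : dot s s = nrm s ^+ 2.
Proof. by rewrite nrm_sqr /dot !expr2. Qed.

Lemma nrm_gt0 s : s != 0 -> 0 < nrm s.
Proof.
move=> s0; rewrite lt_neqAle nrm_ge0 andbT eq_sym; apply: contra s0 => /eqP h.
have := nrm_sqr s; rewrite h expr0n /= => /esym/sum_sqr_eq0.
by case: s {h} => ? ? /= [-> ->].
Qed.

(* The principal square root, continuous on the right half plane. *)
Definition psqrt z : P :=
  let a := Num.sqrt ((nrm z + z.1) / 2) in (a, z.2 / (2 * a)).

(** The condition says that [z] is off the branch cut, which is the set of nonpositive reals. *)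
Lemma psqrt_re z : 0 < nrm z + z.1 -> 0 < (psqrt z).1.
Proof. by move=> h; rewrite sqrtr_gt0 divr_gt0. Qed.

Lemma psqrtK z : 0 < nrm z + z.1 -> sqr (psqrt z) = z.
Proof.
move=> h; have a0 := psqrt_re h.
have a2 : (psqrt z).1 ^+ 2 = (nrm z + z.1) / 2.
  by rewrite sqr_sqrtr // divr_ge0 // ltW.
have e2 : (psqrt z).2 = z.2 / (2 * (psqrt z).1) by [].
have mE := nrm_sqr z.
rewrite /sqr e2; case: z h a0 a2 mE {e2} => x y /=.
set m := nrm _; set a := Num.sqrt _ => h a0 a2 mE.
congr (_, _); last by field; rewrite gt_eqF.
have -> : (y / (2 * a)) ^+ 2 = y ^+ 2 / (4 * a ^+ 2).
  by field; rewrite gt_eqF.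
rewrite a2.
have -> : y ^+ 2 = (m + x) * (m - x) by rewrite -[y ^+ 2](addKr (x ^+ 2)) -mE; ring.
by field; rewrite gt_eqF.
Qed.

End PlaneSqrt.

(** * Continuity, and continuous square roots on a rectangle *)

Section Continuity.
Variable R : realType.
Notation P := (R * R)%type.

Lemma cont_pair (T : topologicalType) (f g : T -> R) :
  continuous f -> continuous g -> continuous (fun t => (f t, g t) : P).
Proof. move=> cf cg t.
by apply: (@cvg_pair _ _ _ (nbhs t) (nbhs (f t)) (nbhs (g t)) _ _ _ f g);
  [exact: cf|exact: cg]. Qed.

Lemma cont_fst (T : topologicalType) (f : T -> P) :
  continuous f -> continuous (fun t => (f t).1).
Proof. by move=> cf t; apply: (@cvg_comp _ _ _ f fst _ _ _ (cf t)); exact: cvg_fst. Qed.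

Lemma cont_snd (T : topologicalType) (f : T -> P) :
  continuous f -> continuous (fun t => (f t).2).
Proof. by move=> cf t; apply: (@cvg_comp _ _ _ f snd _ _ _ (cf t)); exact: cvg_snd. Qed.

Lemma contD (T : topologicalType) (V : normedModType R) (f g : T -> V) :
  continuous f -> continuous g -> continuous (fun t => f t + g t).
Proof. by move=> cf cg t; apply: cvgD; [exact: cf|exact: cg]. Qed.

Lemma contN (T : topologicalType) (V : normedModType R) (f : T -> V) :
  continuous f -> continuous (fun t => - f t).
Proof. by move=> cf t; apply: cvgN; exact: cf. Qed.

Lemma contB (T : topologicalType) (V : normedModType R) (f g : T -> V) :
  continuous f -> continuous g -> continuous (fun t => f t - g t).
Proof. by move=> cf cg t; apply: cvgB; [exact: cf|exact: cg]. Qed.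

Lemma contM (T : topologicalType) (f g : T -> R) :
  continuous f -> continuous g -> continuous (fun t => f t * g t).
Proof. by move=> cf cg t; apply: cvgM; [exact: cf|exact: cg]. Qed.

Lemma contX (T : topologicalType) (f : T -> R) n :
  continuous f -> continuous (fun t => f t ^+ n).
Proof.
move=> cf; elim: n => [|n IH]; first by move=> t; exact: cvg_cst.
rewrite (_ : (fun t => _) = (fun t => f t * f t ^+ n)); first exact: contM.
by apply/funext => t; rewrite exprS.
Qed.

Lemma contV (T : topologicalType) (f : T -> R) :
  continuous f -> (forall t, f t != 0) -> continuous (fun t => (f t)^-1).
Proof. by move=> cf f0 t; apply: cvgV => //; exact: cf. Qed.

Lemma cont_sqrt (T : topologicalType) (f : T -> R) :
  continuous f -> continuous (fun t => Num.sqrt (f t)).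
Proof.
by move=> cf t; apply: (@cvg_comp _ _ _ f Num.sqrt _ _ _ (cf t)); exact: sqrt_continuous.
Qed.

Lemma cont_cst (T U : topologicalType) (u : U) : continuous (fun _ : T => u).
Proof. by move=> t; apply: cvg_cst. Qed.

Lemma cont_id (T : topologicalType) : continuous (fun t : T => t).
Proof. by move=> t; apply: cvg_id. Qed.

Lemma cont_comp (T U V : topologicalType) (f : T -> U) (g : U -> V) :
  continuous f -> continuous g -> continuous (fun t => g (f t)).
Proof. by move=> cf cg t; apply: (@cvg_comp _ _ _ f g _ _ _ (cf t)); exact: cg. Qed.

Lemma cont_max (T : topologicalType) (f g : T -> R) :
  continuous f -> continuous g -> continuous (fun t => Num.max (f t) (g t)).
Proof.
move=> cf cg.
rewrite (_ : (fun t => _) = (fun t => (f t + g t + `|f t - g t|) / 2)).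
  apply: contM; last exact: cont_cst.
  apply: contD; first exact: contD.
  move=> t; apply: cvg_norm; exact: (contB cf cg).
by apply/funext => t; rewrite maxr_absE.
Qed.

Lemma cont_min (T : topologicalType) (f g : T -> R) :
  continuous f -> continuous g -> continuous (fun t => Num.min (f t) (g t)).
Proof.
move=> cf cg.
rewrite (_ : (fun t => _) = (fun t => (f t + g t - `|f t - g t|) / 2)).
  apply: contM; last exact: cont_cst.
  apply: contB; first exact: contD.
  move=> t; apply: cvg_norm; exact: (contB cf cg).
by apply/funext => t; rewrite minr_absE.
Qed.

Definition clamp (a b x : R) := Num.max a (Num.min b x).

Lemma cont_clamp a b : continuous (clamp a b).
Proof.
apply: cont_max; first exact: cont_cst.
by apply: cont_min; [exact: cont_cst|exact: cont_id].
Qed.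

Lemma clamp_itv a b x : a <= b -> a <= clamp a b x <= b.
Proof. by move=> ab; rewrite /clamp le_max lexx ge_max ab ge_min lexx. Qed.

Lemma clamp_id a b x : a <= x <= b -> clamp a b x = x.
Proof. by move=> /andP[ax xb]; rewrite /clamp (min_idPr xb) (max_idPr ax). Qed.

Lemma cont_nrm (T : topologicalType) (f : T -> P) :
  continuous f -> continuous (fun t => nrm (f t)).
Proof.
move=> cf; apply: cont_sqrt; apply: contD; apply: contX.
  exact: cont_fst.
exact: cont_snd.
Qed.

Lemma cont_dot (T : topologicalType) (f g : T -> P) :
  continuous f -> continuous g -> continuous (fun t => dot (f t) (g t)).
Proof.
by move=> cf cg; apply: contD; apply: contM;
  [apply: cont_fst|apply: cont_fst|apply: cont_snd|apply: cont_snd].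
Qed.

Lemma cont_psqrt (T : topologicalType) (f : T -> P) :
  continuous f -> (forall t, 0 < nrm (f t) + (f t).1) ->
  continuous (fun t => psqrt (f t)).
Proof.
move=> cf f0.
have ca : continuous (fun t => Num.sqrt ((nrm (f t) + (f t).1) / 2)).
  apply: cont_sqrt; apply: contM; last exact: cont_cst.
  by apply: contD; [apply: cont_nrm|apply: cont_fst].
apply: cont_pair => //; apply: contM; first exact: cont_snd.
apply: contV; first by apply: contM => //; apply: cont_cst.
by move=> t; rewrite mulf_neq0 // gt_eqF // (psqrt_re (f0 t)).
Qed.

Definition mulc (z w : P) : P :=
  (z.1 * w.1 - z.2 * w.2, z.1 * w.2 + z.2 * w.1).

Definition divc (z w : P) : P :=
  (dot z w / nrm w ^+ 2, (z.2 * w.1 - z.1 * w.2) / nrm w ^+ 2).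

Lemma mulc_div (z w : P) : w != 0 -> mulc w (divc z w) = z.
Proof.
move=> /nrm_gt0 w0; have := nrm_sqr w; rewrite /mulc /divc /dot.
case: z => a b; case: w w0 => c d /=; set m := nrm _ => m0 mE.
have cd0 : c ^+ 2 + d ^+ 2 != 0 by rewrite -mE gt_eqF // exprn_gt0.
by rewrite mE; congr (_, _); field.
Qed.

Lemma sqr_mulc (z w : P) : sqr (mulc z w) = mulc (sqr z) (sqr w).
Proof. by rewrite /sqr /mulc /=; congr (_, _); ring. Qed.

Lemma cont_mulc (T : topologicalType) (f g : T -> P) :
  continuous f -> continuous g -> continuous (fun t => mulc (f t) (g t)).
Proof.
move=> cf cg; have [f1 f2] := (cont_fst cf, cont_snd cf).
have [g1 g2] := (cont_fst cg, cont_snd cg).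
by apply: cont_pair; [apply: contB|apply: contD]; apply: contM.
Qed.

Lemma cont_divc (T : topologicalType) (f g : T -> P) :
  continuous f -> continuous g -> (forall t, g t != 0) ->
  continuous (fun t => divc (f t) (g t)).
Proof.
move=> cf cg g0; have [f1 f2] := (cont_fst cf, cont_snd cf).
have [g1 g2] := (cont_fst cg, cont_snd cg).
have cn : continuous (fun t => (nrm (g t) ^+ 2)^-1).
  apply: contV; first by apply: contX; apply: cont_nrm.
  by move=> t; rewrite gt_eqF // exprn_gt0 // nrm_gt0.
apply: cont_pair; apply: contM => //; first exact: cont_dot.
by apply: contB; apply: contM.
Qed.

(** A positive dot product puts the quotient of the two values into the right half plane, where the
    principal root is continuous. Compactness of the rectangle makes the bound uniform; the second
    point may lie outside the rectangle. *)
Lemma unif_dot (F : P -> P) (a b c d : R) : continuous F ->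
  (forall x y, a <= x <= b -> c <= y <= d -> F (x, y) != 0) ->
  exists2 e : R, 0 < e & forall x y x' y', a <= x <= b -> c <= y <= d ->
    `|x' - x| < e -> `|y' - y| < e -> 0 < dot (F (x, y)) (F (x', y')).
Proof.
move=> cF F0.
have cK : compact (`[a, b] `*` `[c, d] : set P).
  by apply: compact_setX; apply: segment_compact.
pose Q (e : R) (z : P) := forall z' : P, `|z'.1 - z.1| < e ->
  `|z'.2 - z.2| < e -> 0 < dot (F z) (F z').
have : \forall e \near 0^'+, (`[a, b] `*` `[c, d] : set P) `<=` Q e.
  move/compact_near_coveringP: cK; apply => -[x y] [] /=.
  rewrite !in_itv /= => hx hy.
  have z0 := F0 _ _ hx hy.
  have : \forall zz \near ((x, y), (x, y)) : P * P,
      0 < dot (F zz.1) (F zz.2).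
    have cd' : continuous (fun zz : P * P => dot (F zz.1) (F zz.2)).
      apply: cont_dot; apply: (cont_comp _ cF) => zz.
        exact: cvg_fst.
      exact: cvg_snd.
    have := cd' ((x, y), (x, y)); move/cvgr_gt; apply => /=.
    by rewrite dot_eq exprn_gt0 // nrm_gt0.
  move=> /nbhs_ballP[e /= e0 he].
  have e20 : 0 < e / 2 by rewrite divr_gt0.
  exists (ball ((x, y) : P) (e / 2), [set t | 0 < t < e / 2]) => /=.
    split; first exact: nbhsx_ballx.
    near=> t; apply/andP; split; near: t; first exact: nbhs_right_gt.
    exact: nbhs_right_lt.
  case=> z t [] /= [bz1 bz2] /andP[t0 te] z' h1 h2.
  apply: (he (z, z')); split => /=.
    by split=> /=; [move: bz1|move: bz2]; rewrite /ball /= => h; lra.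
  split; rewrite /ball /= in bz1 bz2 *.
    rewrite (_ : x - z'.1 = (x - z.1) - (z'.1 - z.1)); last by ring.
    by rewrite (le_lt_trans (ler_normB _ _)) //; lra.
  rewrite (_ : y - z'.2 = (y - z.2) - (z'.2 - z.2)); last by ring.
  by rewrite (le_lt_trans (ler_normB _ _)) //; lra.
move=> H.
have [e [e0 he]] : exists e, 0 < e /\ (`[a, b] `*` `[c, d] : set P) `<=` Q e.
  near (0 : R)^'+ => e; exists e; split; first by near: e; exact: nbhs_right_gt.
  by near: e.
exists e => // x y x' y' hx hy h1 h2.
by apply: (he (x, y)) => //=; rewrite !in_itv.
Unshelve. all: by end_near.
Qed.

(** The rectangle is scaled from its corner [(a, c)] by the factors [k / n]. From one stage to the
    next the root is multiplied by the principal root of the quotient of the values of [F], which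
    lies in the right half plane by [unif_dot]. Stage 0 is constant and stage [n] is [F] on the
    rectangle. *)
Lemma lift2 (F : P -> P) (a b c d : R) : a <= b -> c <= d -> continuous F ->
  (forall x y, a <= x <= b -> c <= y <= d -> F (x, y) != 0) ->
  exists2 S : P -> P, continuous S &
    forall x y, a <= x <= b -> c <= y <= d -> sqr (S (x, y)) = F (x, y).
Proof.
move=> ab cd cF F0; have [e e0 he] := unif_dot cF F0.
pose L := (b - a) + (d - c); pose n := (Num.truncn (L / e)).+1.
have n0 : (0 : R) < n%:R by rewrite ltr0n.
have Ln : L / n%:R < e.
  rewrite ltr_pdivrMr // mulrC -ltr_pdivrMr //.
  exact: truncnS_gt.
(* Clamping first makes [p k] continuous on the whole plane with values in the rectangle. *)
pose p (k : nat) (z : P) : P :=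
  (a + k%:R / n%:R * (clamp a b z.1 - a), c + k%:R / n%:R * (clamp c d z.2 - c)).
have cp k : continuous (p k).
  apply: cont_pair; apply: contD; try exact: cont_cst;
    apply: contM; try exact: cont_cst; apply: contB; try exact: cont_cst.
    by apply: (cont_comp _ (@cont_clamp _ _)); apply: cont_fst; apply: cont_id.
  by apply: (cont_comp _ (@cont_clamp _ _)); apply: cont_snd; apply: cont_id.
have pB k z : (k <= n)%N -> a <= (p k z).1 <= b /\ c <= (p k z).2 <= d.
  move=> kn; have q0 : 0 <= k%:R / n%:R :> R by rewrite divr_ge0.
  have q1 : k%:R / n%:R <= 1 :> R by rewrite ler_pdivrMr // mul1r ler_nat.
  have /andP[u1 u2] := clamp_itv z.1 ab; have /andP[v1 v2] := clamp_itv z.2 cd.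
  by rewrite /p /=; split; nra.
have Fp k z : (k <= n)%N -> F (p k z) != 0.
  by move=> kn; have [h1 h2] := pB k z kn; rewrite [p k z]surjective_pairing F0.
have dp k z : (k < n)%N -> 0 < dot (F (p k z)) (F (p k.+1 z)).
  move=> kn; have [h1 h2] := pB k z (ltnW kn).
  have /andP[u1 u2] := clamp_itv z.1 ab; have /andP[v1 v2] := clamp_itv z.2 cd.
  rewrite [p k z]surjective_pairing [p k.+1 z]surjective_pairing.
  have nV : 0 < (n%:R : R)^-1 by rewrite invr_gt0.
  apply: he => //; rewrite /p /= -natr1 ltr_norml;
    apply/andP; split; move: Ln; rewrite /L; nra.
have lk k : (k <= n)%N -> exists2 S : P -> P, continuous S &
    forall z, sqr (S z) = F (p k z).
  elim: k => [_|k IH kn].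
    exists (fun=> proot (F (a, c))); first exact: cont_cst.
    by move=> z; rewrite prootK /p !mul0r !addr0.
  have [S cS hS] := IH (ltnW kn).
  have w0 z : 0 < (divc (F (p k.+1 z)) (F (p k z))).1.
    rewrite /divc /= divr_gt0 ?exprn_gt0 ?nrm_gt0 ?Fp ?(ltnW kn) //.
    by rewrite /dot mulrC [_.2 * _]mulrC; exact: dp.
  have w1 z : 0 < nrm (divc (F (p k.+1 z)) (F (p k z))) +
                  (divc (F (p k.+1 z)) (F (p k z))).1.
    by rewrite ltr_wpDl // nrm_ge0.
  exists (fun z => mulc (S z) (psqrt (divc (F (p k.+1 z)) (F (p k z))))).
    apply: cont_mulc => //; apply: cont_psqrt => //; apply: cont_divc.
    - exact: (cont_comp _ cF).
    - exact: (cont_comp _ cF).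
    - by move=> z; rewrite Fp // ltnW.
  by move=> z; rewrite sqr_mulc psqrtK // hS mulc_div // Fp // ltnW.
have [S cS hS] := lk n (leqnn n); exists S => // x y hx hy.
rewrite hS /p divff ?gt_eqF // !mul1r /= !clamp_id //.
by congr F; congr (_, _); ring.
Qed.

Lemma lift1 (g : R -> P) (a b : R) : a <= b -> continuous g ->
  (forall x, a <= x <= b -> g x != 0) ->
  exists2 s : R -> P, continuous s & forall x, a <= x <= b -> sqr (s x) = g x.
Proof.
move=> ab cg g0.
have cF : continuous (fun z : P => g z.1).
  by apply: (cont_comp _ cg); apply: cont_fst; apply: cont_id.
have [|S cS hS] := lift2 ab (lexx 0) cF; first by move=> x y hx _; exact: g0.
exists (fun x => S (x, 0)).
  by apply: (cont_comp _ cS); apply: cont_pair; [exact: cont_id|exact: cont_cst].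
by move=> x hx; rewrite hS // lexx.
Qed.

End Continuity.

(** * The parity of the winding number *)

Section Index.
Variable R : realType.
Notation P := (R * R)%type.
Implicit Types (a b c d t : R).

(** The two ends come in either order, because charts and trails also run through intervals
    backwards. *)
Definition btw a b t := (a <= t <= b) || (b <= t <= a).

Lemma btwC a b t : btw a b t = btw b a t.
Proof. by rewrite /btw orbC. Qed.

Lemma btwL a b : btw a b a.
Proof. by rewrite /btw !lexx /= andbT le_total. Qed.

Lemma btwR a b : btw a b b.
Proof. by rewrite btwC btwL. Qed.

Lemma btw_itv a b c d t : a <= c <= b -> a <= d <= b -> btw c d t -> a <= t <= b.
Proof. by move=> hc hd /orP[] h; lra. Qed.

(* The monodromy of the complex square root along [g] from [a] to [b],
   measured against the fixed choice of roots [proot]. *)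
Definition sgab (g : R -> P) a b : bool :=
  `[< exists s : R -> P, [/\ continuous s,
        forall t, btw a b t -> sqr (s t) = g t & neg (s a) != neg (s b)] >].

Lemma cont_within (f : R -> R) a b : continuous f -> {within `[a, b], continuous f}.
Proof. by move=> cf; apply: continuous_subspaceT => x; exact: cf. Qed.

(** At each parameter the two lifts are equal or opposite, so their dot product is plus or minus a
    positive square norm. It has no zero and keeps its sign on the interval. *)
Lemma lift_uniq_le (g s w : R -> P) a b : a <= b -> continuous s -> continuous w ->
  (forall t, a <= t <= b -> g t != 0) ->
  (forall t, a <= t <= b -> sqr (s t) = g t) ->
  (forall t, a <= t <= b -> sqr (w t) = g t) ->
  s a = w a -> s b = w b.
Proof.
move=> ab cs cw g0 sg wg swa.
have sb : sqr (s b) = sqr (w b) by rewrite sg ?wg ?ab ?lexx.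
have [//|e] := sqr_eq sb.
have nz t : a <= t <= b -> dot (s t) (w t) != 0.
  move=> ht; have wt : w t != 0 by rewrite -sqr_eq0 wg ?g0.
  have st : sqr (s t) = sqr (w t) by rewrite sg ?wg.
  have n0 : nrm (w t) ^+ 2 != 0 by rewrite gt_eqF // exprn_gt0 // nrm_gt0.
  have [->|->] := sqr_eq st; rewrite ?dot_eq //.
  by rewrite /dot /= !mulNr -opprD oppr_eq0 -/(dot _ _) dot_eq.
have wa : 0 < dot (s a) (w a).
  rewrite swa dot_eq exprn_gt0 // nrm_gt0 // -sqr_eq0 wg ?g0 //; lra.
have wb : dot (s b) (w b) < 0.
  rewrite e /dot /= !mulNr -opprD oppr_lt0 -/(dot _ _) dot_eq.
  by rewrite exprn_gt0 // nrm_gt0 // -sqr_eq0 wg ?g0 //; lra.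
have [||x] := @IVT _ (fun t => dot (s t) (w t)) a b 0 ab.
- by apply: cont_within; apply: cont_dot.
- by rewrite ge_min le_max (ltW wa) (ltW wb) orbT.
rewrite in_itv /= => hx h0; by have := nz x hx; rewrite h0 eqxx.
Qed.

Lemma lift_uniq (g s w : R -> P) a b : continuous s -> continuous w ->
  (forall t, btw a b t -> g t != 0) ->
  (forall t, btw a b t -> sqr (s t) = g t) ->
  (forall t, btw a b t -> sqr (w t) = g t) ->
  neg (s a) (+) neg (s b) = neg (w a) (+) neg (w b).
Proof.
wlog ab : a b / a <= b => [H|].
  have [/H//|/ltW ba] := leP a b; move=> cs cw h1 h2 h3.
  rewrite addbC [RHS]addbC; apply: (H b a) => // t ht; rewrite btwC in ht.
  - exact: h1.
  - exact: h2.
  - exact: h3.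
move=> cs cw h1 h2 h3.
have bt t : a <= t <= b -> btw a b t by rewrite /btw => ->.
have h1' t : a <= t <= b -> g t != 0 by move/bt; exact: h1.
have h2' t : a <= t <= b -> sqr (s t) = g t by move/bt; exact: h2.
have h3' t : a <= t <= b -> sqr (w t) = g t by move/bt; exact: h3.
have : sqr (s a) = sqr (w a) by rewrite h2' ?h3' ?lexx ?ab.
move/sqr_eq => [e|e].
  by rewrite e (lift_uniq_le ab cs cw h1' h2' h3' e).
have h3'' t : a <= t <= b -> sqr (- w t) = g t by move=> ht; rewrite sqrN h3'.
have eb := lift_uniq_le ab cs (contN cw) h1' h2' h3'' e.
have nz t : btw a b t -> w t != 0 by move=> ht; rewrite -sqr_eq0 h3 ?h1.
by rewrite e eb !negN ?nz ?btwL ?btwR // addNb addbN negbK.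
Qed.

Lemma sgabP (g s : R -> P) a b : continuous s ->
  (forall t, btw a b t -> g t != 0) ->
  (forall t, btw a b t -> sqr (s t) = g t) ->
  sgab g a b = neg (s a) (+) neg (s b).
Proof.
move=> cs g0 sg; rewrite /sgab; case E : (neg (s a) (+) neg (s b)).
  apply/asboolT; exists s; split => //.
  by move: E; case: (neg _); case: (neg _).
apply/asboolF => -[w [cw wg nw]].
move: E; rewrite (lift_uniq cs cw g0 sg wg).
by move: nw; case: (neg _); case: (neg _).
Qed.

Lemma sgabC g a b : sgab g a b = sgab g b a.
Proof.
by apply/asbool_equiv_eq; split=> -[s [cs h n]]; exists s;
  split => // [t|]; rewrite 1?btwC 1?eq_sym //; exact: h.
Qed.

Lemma eq_sgab (g g' : R -> P) a b :
  (forall t, btw a b t -> g t = g' t) -> sgab g a b = sgab g' a b.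
Proof.
by move=> e; apply/asbool_equiv_eq; split=> -[s [cs h n]]; exists s;
  split => // t ht; rewrite h // e.
Qed.

Lemma sgabD (g : R -> P) A B a b c : continuous g ->
  (forall t, A <= t <= B -> g t != 0) ->
  A <= a <= B -> A <= b <= B -> A <= c <= B ->
  sgab g a c = sgab g a b (+) sgab g b c.
Proof.
move=> cg g0 ha hb hc; have AB : A <= B by lra.
have [s cs hs] := lift1 AB cg g0.
rewrite !(sgabP (s := s)) ?addbA; first by rewrite addbK.
all: by move=> // t ht; rewrite ?g0 ?hs //; move: ht; apply: btw_itv.
Qed.

Lemma sgab_comp (g : R -> P) (f : R -> R) A B a b : continuous g -> continuous f ->
  (forall t, A <= t <= B -> g t != 0) ->
  (forall t, btw a b t -> A <= f t <= B) ->
  sgab (g \o f) a b = sgab g (f a) (f b).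
Proof.
move=> cg cf g0 hf; have ha := hf _ (btwL a b); have hb := hf _ (btwR a b).
have AB : A <= B by lra.
have [s cs hs] := lift1 AB cg g0.
rewrite (sgabP (s := s \o f)) ?(sgabP (s := s)) //.
- by move=> t ht; apply: g0; apply: btw_itv ht.
- by move=> t ht; apply: hs; apply: btw_itv ht.
- exact: cont_comp.
- by move=> t ht; apply: g0; apply: hf.
- by move=> t ht; apply: hs; apply: hf.
Qed.

(* The parity of the winding number around [0] of the restriction of [F] to
   the boundary of the rectangle [[a, b] x [c, d]]. *)
Definition idx (F : R -> R -> P) a b c d : bool :=
  (sgab (F a) c d (+) sgab (F b) c d) (+)
  (sgab (F^~ c) a b (+) sgab (F^~ d) a b).

Definition cont2 (F : R -> R -> P) := continuous (fun z : P => F z.1 z.2).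

Lemma cont2l F y : cont2 F -> continuous (F^~ y).
Proof.
move=> cF; apply: (cont_comp (f := fun x => (x, y) : P) _ cF).
by apply: cont_pair; [exact: cont_id|exact: cont_cst].
Qed.

Lemma cont2r F x : cont2 F -> continuous (F x).
Proof.
move=> cF; apply: (cont_comp (f := fun y => (x, y) : P) _ cF).
by apply: cont_pair; [exact: cont_cst|exact: cont_id].
Qed.

Lemma idxCl F a b c d : idx F a b c d = idx F b a c d.
Proof.
by rewrite /idx [sgab _ a b]sgabC [sgab (_^~ d) a b]sgabC [in RHS](addbC (sgab (F b) _ _)).
Qed.

Lemma idxCr F a b c d : idx F a b c d = idx F a b d c.
Proof.
by rewrite /idx [sgab _ c d]sgabC [sgab (F b) c d]sgabC [in RHS](addbC (sgab (F^~ d) _ _)).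
Qed.

Lemma eq_idx F G a b c d : (forall x y, btw a b x -> btw c d y -> F x y = G x y) ->
  idx F a b c d = idx G a b c d.
Proof.
move=> e; rewrite /idx; congr ((_ (+) _) (+) (_ (+) _)); apply: eq_sgab => t ht;
  by apply: e; rewrite ?btwL ?btwR.
Qed.

Lemma lift2b F a b c d : cont2 F ->
  (forall x y, btw a b x -> btw c d y -> F x y != 0) ->
  exists2 S : R -> R -> P, cont2 S &
    forall x y, btw a b x -> btw c d y -> sqr (S x y) = F x y.
Proof.
wlog ab : a b / a <= b => [H|].
  have [/H//|/ltW ba] := leP a b; move=> cF F0.
  have [|S cS hS] := H b a ba cF => [x y|]; first by rewrite btwC; exact: F0.
  by exists S => // x y; rewrite btwC; exact: hS.
wlog cd : c d / c <= d => [H|].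
  have [/H//|/ltW dc] := leP c d; move=> cF F0.
  have [|S cS hS] := H d c dc cF => [x y|].
    by rewrite [btw d c _]btwC; exact: F0.
  by exists S => // x y; rewrite [btw c d _]btwC; exact: hS.
move=> cF F0; have [|S cS hS] := lift2 ab cd cF.
  by move=> x y hx hy; apply: F0; rewrite /btw ?hx ?hy.
exists (fun x y => S (x, y)).
  rewrite /cont2 (_ : (fun _ => _) = S) //.
  by apply/funext => -[].
move=> x y hx hy; apply: hS.
  by case/orP: hx => //; lra.
by case/orP: hy => //; lra.
Qed.

(** A continuous root on the whole rectangle computes all four sides at once, and each corner is
    then counted twice. *)
Lemma sgab_square F a b c d : cont2 F ->
  (forall x y, btw a b x -> btw c d y -> F x y != 0) ->
  idx F a b c d = false.
Proof.
move=> cF F0; have [S cS hS] := lift2b cF F0.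
have h1 x : btw a b x -> sgab (F x) c d = neg (S x c) (+) neg (S x d).
  move=> hx; apply: sgabP => [|t ht|t ht]; first exact: cont2r.
    exact: F0.
  exact: hS.
have h2 y : btw c d y -> sgab (F^~ y) a b = neg (S a y) (+) neg (S b y).
  move=> hy; apply: (sgabP (s := S^~ y)) => [|t ht|t ht]; first exact: cont2l.
    exact: F0.
  exact: hS.
rewrite /idx !h1 ?h2 ?btwL ?btwR //.
by case: (neg _); case: (neg _); case: (neg _); case: (neg _).
Qed.

(** The side at [x] occurs in both parts and cancels as a boolean, even when [F] vanishes somewhere
    on it. *)
Lemma idx_splitl F a b x c d : cont2 F ->  a <= x <= b ->
  (forall t, a <= t <= b -> F t c != 0 /\ F t d != 0) ->
  idx F a b c d = idx F a x c d (+) idx F x b c d.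
Proof.
move=> cF hx F0; rewrite /idx.
rewrite (sgabD (A := a) (B := b) (b := x) (g := F^~ c)) //; try lra.
- rewrite (sgabD (A := a) (B := b) (b := x) (g := F^~ d)) //; try lra.
  + by move: (sgab (F a) c d) (sgab (F b) c d) (sgab (F x) c d)
      (sgab (F^~ c) a x) (sgab (F^~ c) x b) (sgab (F^~ d) a x)
      (sgab (F^~ d) x b) => [] [] [] [] [] [] [].
  + exact: cont2l.
  + by move=> t /F0[].
- exact: cont2l.
- by move=> t /F0[].
Qed.

Lemma idx_splitr F a b y c d : cont2 F -> c <= y <= d ->
  (forall t, c <= t <= d -> F a t != 0 /\ F b t != 0) ->
  idx F a b c d = idx F a b c y (+) idx F a b y d.
Proof.
move=> cF hx F0; rewrite /idx.
rewrite (sgabD (A := c) (B := d) (b := y) (g := F a)) //; try lra.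
- rewrite (sgabD (A := c) (B := d) (b := y) (g := F b)) //; try lra.
  + by move: (sgab (F a) c y) (sgab (F a) y d) (sgab (F b) c y)
      (sgab (F b) y d) (sgab (F^~ c) a b) (sgab (F^~ d) a b)
      (sgab (F^~ y) a b) => [] [] [] [] [] [] [].
  + exact: cont2r.
  + by move=> t /F0[].
- exact: cont2r.
- by move=> t /F0[].
Qed.

(* Both sides are the boundary of a box, whose other four faces do not meet 0. *)
Lemma idx_homotopy (H : R -> R -> R -> P) a b c d :
  continuous (fun z : P * R => H z.2 z.1.1 z.1.2) ->
  (forall t x y, 0 <= t <= 1 -> btw a b x -> btw c d y ->
    [|| x == a, x == b, y == c | y == d] -> H t x y != 0) ->
  idx (H 0) a b c d = idx (H 1) a b c d.
Proof.
move=> cH H0.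
have cA (f : P -> P * R) : continuous f ->
    continuous (fun z : P => H (f z).2 (f z).1.1 (f z).1.2).
  by move=> cf; exact: (cont_comp (g := fun z : P * R => H z.2 z.1.1 z.1.2) cf).
have cpr (f : P -> P) (g : P -> R) : continuous f -> continuous g ->
    continuous (fun z : P => (f z, g z) : P * R).
  move=> cf cg t.
  by apply: (@cvg_pair _ _ _ (nbhs t) (nbhs (f t)) (nbhs (g t)) _ _ _ f g);
    [exact: cf|exact: cg].
have c1 : continuous (fun z : P => z.1) by apply: cont_fst; exact: cont_id.
have c2 : continuous (fun z : P => z.2) by apply: cont_snd; exact: cont_id.
have fx x : x = a \/ x = b -> cont2 (fun t y => H t x y).
  move=> _; apply: (cA (fun z => ((x, z.2), z.1))); apply: cpr => //.
  by apply: cont_pair => //; exact: cont_cst.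
have fy y : y = c \/ y = d -> cont2 (fun t x => H t x y).
  move=> _; apply: (cA (fun z => ((z.2, y), z.1))); apply: cpr => //.
  by apply: cont_pair => //; exact: cont_cst.
have b01 t : btw 0 1 t -> 0 <= t <= 1 by case/orP => //; lra.
have e1 : idx (fun t y => H t a y) 0 1 c d = false.
  apply: sgab_square => [|t y /b01 ht hy]; first by apply: fx; left.
  by apply: H0; rewrite ?btwL ?eqxx.
have e2 : idx (fun t y => H t b y) 0 1 c d = false.
  apply: sgab_square => [|t y /b01 ht hy]; first by apply: fx; right.
  by apply: H0; rewrite ?btwR ?eqxx ?orbT.
have e3 : idx (fun t x => H t x c) 0 1 a b = false.
  apply: sgab_square => [|t x /b01 ht hx]; first by apply: fy; left.
  by apply: H0; rewrite ?btwL ?eqxx ?orbT.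
have e4 : idx (fun t x => H t x d) 0 1 a b = false.
  apply: sgab_square => [|t x /b01 ht hx]; first by apply: fy; right.
  by apply: H0; rewrite ?btwR ?eqxx ?orbT.
move: e1 e2 e3 e4; rewrite /idx; cbv beta.
set s1 := sgab (H 0 a) c d; set s2 := sgab (H 1 a) c d.
set s3 := sgab (H 0 b) c d; set s4 := sgab (H 1 b) c d.
set s5 := sgab (fun x => H 0 x c) a b; set s6 := sgab (fun x => H 1 x c) a b.
set s7 := sgab (fun x => H 0 x d) a b; set s8 := sgab (fun x => H 1 x d) a b.
move: (sgab (fun t => H t a c) 0 1) (sgab (fun t => H t a d) 0 1)
  (sgab (fun t => H t b c) 0 1) (sgab (fun t => H t b d) 0 1) => t1 t2 t3 t4.
have solve u v w : u (+) v (+) w = false -> u = v (+) w by case: u; case: v; case: w.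
move=> /solve-> /solve-> /solve-> /solve->.
by move: s2 s4 s6 s8 t1 t2 t3 t4 => [] [] [] [] [] [] [] [].
Qed.

End Index.

(** * The index of the identity and of a chart *)

Section OddIndex.
Variable R : realType.
Notation P := (R * R)%type.

Lemma nrm_re_gt0 (x y : R) : 0 < x \/ y != 0 -> 0 < nrm (x, y) + x.
Proof.
have n0 := nrm_ge0 (x, y); have := nrm_sqr (x, y) => /= nE.
case=> [x0|y0]; first by rewrite ltr_wpDl.
have y2 : 0 < y ^+ 2 by rewrite exprn_even_gt0.
by rewrite ltNge; apply/negP => h; nra.
Qed.

(** The principal root serves on the bottom, right and top sides. The left side meets its cut, so
    there the root [l], which is i times the principal root of [- z], is used. The two roots agree
    at the upper left corner and are opposite at the lower left one, whence the odd value. *)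
Lemma idx_id (r : R) : 0 < r -> idx (fun x y => (x, y) : P) (- r) r (- r) r.
Proof.
move=> r0.
pose l (z : P) : P := (- (psqrt (- z)).2, (psqrt (- z)).1).
have sl (z : P) : 0 < nrm (- z) + (- z).1 -> sqr (l z) = z.
  move=> /psqrtK; rewrite /sqr /l /=; case: z => x y [] /= e1 e2.
  by congr (_, _); lra.
have fst0 : continuous (fun t : R => t) by exact: cont_id.
have hT u t : u != 0 -> 0 < nrm ((t, u) : P) + t by move=> u0; apply: nrm_re_gt0; right.
have hR u t : 0 < u -> 0 < nrm ((u, t) : P) + u by move=> u0; apply: nrm_re_gt0; left.
have nz1 u t : u != 0 -> ((t, u) : P) != 0.
  by apply: contra => /eqP[_ ->].
have nz2 u t : u != 0 -> ((u, t) : P) != 0.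
  by apply: contra => /eqP[-> _].
have rn0 : r != 0 by rewrite gt_eqF.
have rN0 : - r != 0 by rewrite oppr_eq0.
have bT u : u != 0 -> sgab (fun x => (x, u) : P) (- r) r =
    neg (psqrt (- r, u)) (+) neg (psqrt (r, u)).
  move=> u0; apply: (sgabP (s := fun x => psqrt (x, u))) => [|t _|t _].
  - apply: cont_psqrt => [|t]; last exact: hT.
    by apply: cont_pair => //; exact: cont_cst.
  - exact: nz1.
  - by rewrite psqrtK //; exact: hT.
have bR : sgab (fun y => (r, y) : P) (- r) r =
    neg (psqrt (r, - r)) (+) neg (psqrt (r, r)).
  apply: (sgabP (s := fun y => psqrt (r, y))) => [|t _|t _].
  - apply: cont_psqrt => [|t]; last exact: hR.
    by apply: cont_pair => //; exact: cont_cst.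
  - exact: nz2.
  - by rewrite psqrtK //; exact: hR.
have hL t : 0 < nrm (- ((- r, t) : P)) + (- ((- r, t) : P)).1.
  have -> : - ((- r, t) : P) = (r, - t) by congr (_, _); rewrite /= opprK.
  exact: hR.
have bL : sgab (fun y => (- r, y) : P) (- r) r =
    neg (l (- r, - r)) (+) neg (l (- r, r)).
  apply: (sgabP (s := fun y => l (- r, y))) => [|t _|t _].
  - have cp : continuous (fun y => psqrt (- ((- r, y) : P))).
      apply: cont_psqrt => [|t]; last exact: hL.
      by apply: contN; apply: cont_pair => //; exact: cont_cst.
    by apply: cont_pair; [apply: contN; exact: cont_snd|exact: cont_fst].
  - exact: nz2.
  - by rewrite sl //; exact: hL.
have lE u : u != 0 -> l (- r, u) = psqrt (- r, u) \/ l (- r, u) = - psqrt (- r, u).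
  move=> u0; apply: sqr_eq; rewrite sl; last exact: hL.
  by rewrite psqrtK //; exact: hT.
have p1 u : u != 0 -> 0 < (psqrt ((- r, u) : P)).1.
  by move=> u0; apply: psqrt_re; exact: hT.
have l1 u : (l (- r, u)).1 = u / (2 * (psqrt (- ((- r, u) : P))).1).
  by rewrite /l /= mulNr opprK.
have l0 u : 0 < (psqrt (- ((- r, u) : P))).1 by apply: psqrt_re; exact: hL.
have eT : l (- r, r) = psqrt (- r, r).
  have [//|e] := lE _ rn0; have := p1 _ rn0; have := l1 r; rewrite e /=.
  have : 0 < r / (2 * (psqrt (- ((- r, r) : P))).1) by rewrite divr_gt0 // mulr_gt0.
  by move=> /[swap] <-; rewrite oppr_gt0 => /ltW; rewrite leNgt => /negP h /h.
have eB : l (- r, - r) = - psqrt (- r, - r).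
  have [e|//] := lE _ rN0; have := p1 _ rN0; have := l1 (- r); rewrite e /=.
  have : 0 < r / (2 * (psqrt (- ((- r, - r) : P))).1) by rewrite divr_gt0 // mulr_gt0.
  by rewrite mulNr => /[swap] ->; rewrite oppr_gt0 => /ltW; rewrite leNgt => /negP.
rewrite /idx bL bR (bT _ rN0) (bT _ rn0) eT eB negN; last first.
  by apply: contraTneq (p1 _ rN0) => ->; rewrite ltxx.
by do !case: (neg _).
Qed.

Lemma lift_eq (g s w : R -> P) a b : continuous s -> continuous w ->
  (forall t, btw a b t -> g t != 0) ->
  (forall t, btw a b t -> sqr (s t) = g t) ->
  (forall t, btw a b t -> sqr (w t) = g t) ->
  s a = w a -> s b = w b.
Proof.
move=> cs cw g0 sg wg e; have := lift_uniq cs cw g0 sg wg; rewrite e.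
have : sqr (s b) = sqr (w b) by rewrite sg ?wg // btwR.
move=> /sqr_eq[//|->]; rewrite negN; first by case: (neg _); case: (neg _).
by rewrite -sqr_eq0 wg ?g0 // btwR.
Qed.

(** Equality spreads from the corner along one side of the rectangle and from there across it. *)
Lemma lift2_eq (F S W : R -> R -> P) a b c d x y : cont2 S -> cont2 W ->
  (forall x y, btw a b x -> btw c d y -> F x y != 0) ->
  (forall x y, btw a b x -> btw c d y -> sqr (S x y) = F x y) ->
  (forall x y, btw a b x -> btw c d y -> sqr (W x y) = F x y) ->
  S a c = W a c -> btw a b x -> btw c d y -> S x y = W x y.
Proof.
move=> cS cW F0 SF WF e hx hy.
have sub (u v w t : R) : btw u v w -> btw u w t -> btw u v t.
  by rewrite /btw => /orP h1 /orP h2; apply/orP; lra.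
have e' : S x c = W x c.
  apply: (@lift_eq (F^~ c) (S^~ c) (W^~ c) a x) => //; try exact: cont2l.
  - by move=> t /(sub _ _ _ _ hx) ht; apply: F0 => //; exact: btwL.
  - by move=> t /(sub _ _ _ _ hx) ht; apply: SF => //; exact: btwL.
  - by move=> t /(sub _ _ _ _ hx) ht; apply: WF => //; exact: btwL.
apply: (@lift_eq (F x) (S x) (W x) c y) => //; try exact: cont2r.
- by move=> t /(sub _ _ _ _ hy) ht; apply: F0.
- by move=> t /(sub _ _ _ _ hy) ht; apply: SF.
- by move=> t /(sub _ _ _ _ hy) ht; apply: WF.
Qed.

Lemma lift2c (F : R -> R -> P) a b c d (v : P) : cont2 F ->
  (forall x y, btw a b x -> btw c d y -> F x y != 0) -> sqr v = F a c ->
  exists S : R -> R -> P, [/\ cont2 S,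
    forall x y, btw a b x -> btw c d y -> sqr (S x y) = F x y & S a c = v].
Proof.
move=> cF F0 vE; have [S cS hS] := lift2b cF F0.
have : sqr (S a c) = sqr v by rewrite hS ?vE ?btwL.
move=> /sqr_eq[e|e]; first by exists S.
exists (fun x y => - S x y); split; last by rewrite e opprK.
  exact: contN.
by move=> x y hx hy; rewrite sqrN hS.
Qed.

Lemma cont_within_comp (T U V : topologicalType) (A : set U) (S : U -> V)
    (f : T -> U) : {within A, continuous S} -> continuous f -> (forall t, A (f t)) ->
  continuous (S \o f).
Proof.
move=> /subspace_continuousP cS cf Af t.
apply: (@cvg_comp _ _ _ f S (nbhs t) (within A (nbhs (f t)))
  (nbhs (S (f t)))); last exact: cS.
move=> N; rewrite /within /= => hN.
have h : nbhs t (f @^-1` [set y | A y -> N y]) := cf t _ hN.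
change (nbhs t (f @^-1` N)); apply: filterS h => x h; exact: (h (Af x)).
Qed.

Lemma within_eq (T U : topologicalType) (A : set T) (f g : T -> U) :
  continuous g -> (forall x, A x -> f x = g x) -> {within A, continuous f}.
Proof.
move=> cg e; apply/subspace_continuousP => x Ax; rewrite /from_subspace e //.
move=> N hN; have h : nbhs x (g @^-1` N) := cg x N hN.
change (nbhs x [set y | A y -> N (f y)]).
by apply: filterS h => y hy Ay /=; rewrite e.
Qed.

End OddIndex.

Section Chart.
Variable R : realType.
Notation P := (R * R)%type.

Lemma closed_le (f g : P -> R) : continuous f -> continuous g ->
  closed [set z : P | f z <= g z].
Proof.
move=> cf cg; rewrite (_ : [set z | _] = (fun z => g z - f z) @^-1` [set x | 0 <= x]).
  by apply: closed_comp; [move=> z _; exact: (contB cg cf)|exact: closed_ge].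
by apply/seteqP; split => z /=; rewrite subr_ge0.
Qed.

Lemma addb_odd (a b c d : bool) : a (+) b (+) (~~ c (+) d) (+) (a (+) c (+) (b (+) d)).
Proof. by move: a b c d; do 4 case. Qed.

Lemma addb_even (a b c d : bool) : a (+) b (+) (c (+) d) (+) (a (+) c (+) (b (+) d)) = false.
Proof. by move: a b c d; do 4 case. Qed.

(* A continuous root of [K - K 0 0] on the annulus between the box and a small
   box around the origin would pull back by [H] to a root of [z] on the boundary
   of a square around [0]; the annulus is the union of four boxes. *)
Lemma idx_chart (K : R -> R -> P) (H : P -> P) x0 x1 y0 y1 r :
  cont2 K -> continuous H -> x0 < 0 < x1 -> y0 < 0 < y1 -> 0 < r ->
  (forall x y, x0 <= x <= x1 -> y0 <= y <= y1 -> K x y = K 0 0 -> x = 0 /\ y = 0) ->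
  (forall x y, - r <= x <= r -> - r <= y <= r ->
    [/\ x0 <= (H (K 0 0 + (x, y))).1 <= x1, y0 <= (H (K 0 0 + (x, y))).2 <= y1 &
        K (H (K 0 0 + (x, y))).1 (H (K 0 0 + (x, y))).2 = K 0 0 + (x, y)]) ->
  idx (fun x y => K x y - K 0 0) x0 x1 y0 y1.
Proof.
move=> cK cH /andP[x00 x10] /andP[y00 y10] r0 Kinj KH.
set p := K 0 0; pose G x y := K x y - p.
have cG : cont2 G by apply: contB => //; exact: cont_cst.
(* The half-width [e] of the small box is such that [K] maps its interior to points whose distance
   from [p] is below [r] in both coordinates. Hence [H] sends the boundary of the square of
   half-width [r] around [p] into the annulus. *)
have [e [e0 ex0 ex1 ey0 [ey1 eK]]] : exists e, [/\ 0 < e, e <= - x0, e <= x1,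
    e <= - y0 & e <= y1 /\ forall x y, - e < x < e -> - e < y < e ->
      `|(K x y - p).1| < r /\ `|(K x y - p).2| < r].
  have : \forall z \near (0, 0) : P, `|(K z.1 z.2 - p).1| < r /\
      `|(K z.1 z.2 - p).2| < r.
    have := cK (0, 0); move/cvgrPdist_lt => /(_ r r0); apply: filterS => z /=.
    rewrite -/p distrC prod_normE /= gt_max => /andP[h1 h2]; split.
      exact: h1.
    exact: h2.
  move=> /nbhs_ballP[e /= e0 he].
  exists (Num.min e (Num.min (Num.min (- x0) x1) (Num.min (- y0) y1))).
  split; rewrite ?lt_min ?ge_min ?lexx ?orbT ?e0 ?oppr_gt0 ?x00 ?x10 ?y00 ?y10 //.
  split; first by rewrite ?ge_min ?lexx ?orbT.
  move=> x y /andP[hx1 hx2] /andP[hy1 hy2]; apply: (he (x, y)).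
  move: hx1 hx2 hy1 hy2; set m := Num.min _ _ => hx1 hx2 hy1 hy2.
  have me : m <= e by rewrite /m ge_min lexx.
  by split; rewrite /ball /= sub0r normrN ltr_norml; apply/andP; split; order_lra.
have G0 x y : x0 <= x <= x1 -> y0 <= y <= y1 ->
    [|| x <= - e, y <= - e, e <= y | e <= x] -> G x y != 0.
  move=> hx hy h; apply/negP => /eqP/subr0_eq /(Kinj _ _ hx hy)[xe ye].
  by move: h; rewrite xe ye => /or4P[]; order_lra.
case E : (idx G x0 x1 y0 y1) => //; exfalso.
have ble (a b t : R) : a <= b -> btw a b t -> a <= t <= b.
  by move=> ab /orP[//|]; order_lra.
have xL : x0 <= - e by order_lra.
have yB : y0 <= - e by order_lra.
have x01 : x0 <= x1 by order_lra.
have y01 : y0 <= y1 by order_lra.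
have GL x y : btw x0 (- e) x -> btw y0 y1 y -> G x y != 0.
  move=> /(ble _ _ _ xL) hx /(ble _ _ _ y01) hy; apply: G0 => //; first by order_lra.
  by apply/or4P/Or41; order_lra.
have GB x y : btw x0 x1 x -> btw y0 (- e) y -> G x y != 0.
  move=> /(ble _ _ _ x01) hx /(ble _ _ _ yB) hy; apply: G0 => //; first by order_lra.
  by apply/or4P/Or42; order_lra.
have GT x y : btw x0 x1 x -> btw y1 e y -> G x y != 0.
  move=> /(ble _ _ _ x01) hx; rewrite btwC => /(ble _ _ _ ey1) hy.
  by apply: G0 => //; [order_lra|apply/or4P/Or43; order_lra].
have GR x y : btw x1 e x -> btw y1 y0 y -> G x y != 0.
  rewrite btwC => /(ble _ _ _ ex1) hx; rewrite btwC => /(ble _ _ _ y01) hy.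
  by apply: G0 => //; [order_lra|apply/or4P/Or44; order_lra].
(* Roots on the left, bottom, top and right boxes. Going around the corners of the large box, three
   of the four agreements hold by the choice of signs; the fourth, [eRB], is what an even index
   provides. *)
have [SL [cSL hSL _]] := lift2c cG GL (prootK _).
have [SB [cSB hSB eSB]] : exists S, [/\ cont2 S,
    forall x y, btw x0 x1 x -> btw y0 (- e) y -> sqr (S x y) = G x y &
    S x0 y0 = SL x0 y0].
  by apply: lift2c => //; rewrite hSL ?btwL.
have [ST [cST hST eST]] : exists S, [/\ cont2 S,
    forall x y, btw x0 x1 x -> btw y1 e y -> sqr (S x y) = G x y &
    S x0 y1 = SL x0 y1].
  by apply: lift2c => //; rewrite hSL ?btwL ?btwR.
have [SR [cSR hSR eSR]] : exists S, [/\ cont2 S,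
    forall x y, btw x1 e x -> btw y1 y0 y -> sqr (S x y) = G x y &
    S x1 y1 = ST x1 y1].
  by apply: lift2c => //; rewrite hST ?btwL ?btwR.
have eRB : SR x1 y0 = SB x1 y0.
  have hh : sqr (SR x1 y0) = sqr (SB x1 y0) by rewrite hSR ?hSB ?btwL ?btwR.
  have [//|eN] := sqr_eq hh.
  have n0 : SB x1 y0 != 0 by rewrite -sqr_eq0 hSB ?GB ?btwL ?btwR.
  have sL : sgab (G x0) y0 y1 = neg (SL x0 y0) (+) neg (SL x0 y1).
    apply: (sgabP (s := SL x0)) => [|t ht|t ht]; first exact: cont2r.
      by rewrite GL ?btwL.
    by rewrite hSL ?btwL.
  have sR : sgab (G x1) y0 y1 = neg (SR x1 y0) (+) neg (SR x1 y1).
    apply: (sgabP (s := SR x1)) => [|t ht|t ht]; first exact: cont2r.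
      by rewrite GR ?btwL // btwC.
    by rewrite hSR ?btwL // btwC.
  have sB : sgab (G^~ y0) x0 x1 = neg (SB x0 y0) (+) neg (SB x1 y0).
    apply: (sgabP (s := SB^~ y0)) => [|t ht|t ht]; first exact: cont2l.
      by rewrite GB ?btwL.
    by rewrite hSB ?btwL.
  have sT : sgab (G^~ y1) x0 x1 = neg (ST x0 y1) (+) neg (ST x1 y1).
    apply: (sgabP (s := ST^~ y1)) => [|t ht|t ht]; first exact: cont2l.
      by rewrite GT ?btwL.
    by rewrite hST ?btwL.
  by exfalso; move: E; rewrite /idx sL sR sB sT eN negN // eSB eST eSR addb_odd.
clear E.
have eLB x y : btw x0 (- e) x -> btw y0 (- e) y -> SL x y = SB x y.
  move=> hx hy; apply: (lift2_eq (F := G) cSL cSB) (hx) (hy) => //.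
  - move=> x' y' hx' /(ble _ _ _ yB) hy'; apply: GL => //.
    by rewrite /btw; apply/orP; order_lra.
  - move=> x' y' hx' /(ble _ _ _ yB) hy'; apply: hSL => //.
    by rewrite /btw; apply/orP; order_lra.
  - move=> x' y' /(ble _ _ _ xL) hx' hy'; apply: hSB => //.
    by rewrite /btw; apply/orP; order_lra.
have eLT x y : btw x0 (- e) x -> btw y1 e y -> SL x y = ST x y.
  move=> hx hy; apply: (lift2_eq (F := G) cSL cST) (hx) (hy) => //.
  - move=> x' y' hx'; rewrite btwC => /(ble _ _ _ ey1) hy'; apply: GL => //.
    by rewrite /btw; apply/orP; order_lra.
  - move=> x' y' hx'; rewrite btwC => /(ble _ _ _ ey1) hy'; apply: hSL => //.
    by rewrite /btw; apply/orP; order_lra.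
  - move=> x' y' /(ble _ _ _ xL) hx' hy'; apply: hST => //.
    by rewrite /btw; apply/orP; order_lra.
have eRT x y : btw x1 e x -> btw y1 e y -> SR x y = ST x y.
  move=> hx hy; apply: (lift2_eq (F := G) cSR cST) (hx) (hy) => //.
  - move=> x' y' hx'; rewrite btwC => /(ble _ _ _ ey1) hy'; apply: GR => //.
    by rewrite /btw; apply/orP; order_lra.
  - move=> x' y' hx'; rewrite btwC => /(ble _ _ _ ey1) hy'; apply: hSR => //.
    by rewrite /btw; apply/orP; order_lra.
  - move=> x' y'; rewrite btwC => /(ble _ _ _ ex1) hx' hy'; apply: hST => //.
    by rewrite /btw; apply/orP; order_lra.
have eRB' x y : btw x1 e x -> btw y0 (- e) y -> SR x y = SB x y.
  move=> hx hy; apply: (lift2_eq (F := G) cSR cSB) (hx) (hy) => //.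
  - move=> x' y' hx' /(ble _ _ _ yB) hy'; apply: GR => //.
    by rewrite /btw; apply/orP; order_lra.
  - move=> x' y' hx' /(ble _ _ _ yB) hy'; apply: hSR => //.
    by rewrite /btw; apply/orP; order_lra.
  - move=> x' y'; rewrite btwC => /(ble _ _ _ ex1) hx' hy'; apply: hSB => //.
    by rewrite /btw; apply/orP; order_lra.
(* The four roots agree on the overlaps of the closed boxes, so they glue to one continuous root on
   the annulus. *)
pose S (z : P) := if z.1 <= - e then SL z.1 z.2 else
  if z.2 <= - e then SB z.1 z.2 else if e <= z.2 then ST z.1 z.2 else SR z.1 z.2.
pose Bx := [set z : P | (x0 <= z.1 /\ z.1 <= x1) /\ (y0 <= z.2 /\ z.2 <= y1)].
pose AL := Bx `&` [set z : P | z.1 <= - e].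
pose AB := Bx `&` [set z : P | z.2 <= - e].
pose AT := Bx `&` [set z : P | e <= z.2].
pose AR := Bx `&` [set z : P | e <= z.1].
have c1 : continuous (fun z : P => z.1) by apply: cont_fst; exact: cont_id.
have c2 : continuous (fun z : P => z.2) by apply: cont_snd; exact: cont_id.
have cc (x : R) : continuous (fun _ : P => x) by exact: cont_cst.
have clB : closed Bx.
  by apply: closedI; apply: closedI; exact: closed_le.
have SLE z : AL z -> S z = SL z.1 z.2.
  by move=> [_ /= h]; rewrite /S h.
have SBE z : AB z -> S z = SB z.1 z.2.
  move=> [[[h1 h2] [h3 h4]] /= h]; rewrite /S h; case: ifP => // hl.
  by apply: eLB; rewrite /btw ?h1 ?hl ?h3 ?h.
have STE z : AT z -> S z = ST z.1 z.2.
  move=> [[[h1 h2] [h3 h4]] /= h]; rewrite /S h; case: ifP => // hl.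
    by apply: eLT; rewrite /btw ?h1 ?hl ?h4 ?h ?orbT.
  by case: ifP => // hb; exfalso; order_lra.
have SRE z : AR z -> S z = SR z.1 z.2.
  move=> [[[h1 h2] [h3 h4]] /= h]; rewrite /S; case: ifP => [hl|_]; first by exfalso; order_lra.
  case: ifP => hb; first by rewrite eRB' // /btw ?h ?h2 ?h3 ?hb ?orbT.
  by case: ifP => // ht; rewrite eRT // /btw ?h ?h2 ?h4 ?ht ?orbT.
have cS : {within ((AL `|` AB) `|` AT) `|` AR, continuous S}.
  have clL : closed AL by apply: closedI => //; exact: closed_le.
  have clBB : closed AB by apply: closedI => //; exact: closed_le.
  have clT : closed AT by apply: closedI => //; exact: closed_le.
  have clR : closed AR by apply: closedI => //; exact: closed_le.
  apply: withinU_continuous => //; first by apply: closedU => //; apply: closedU.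
    apply: withinU_continuous => //; first by apply: closedU.
      apply: withinU_continuous => //.
        exact: (within_eq cSL SLE).
      exact: (within_eq cSB SBE).
    exact: (within_eq cST STE).
  exact: (within_eq cSR SRE).
pose A := ((AL `|` AB) `|` AT) `|` AR.
have SA z : A z -> sqr (S z) = G z.1 z.2.
  move=> [[[h|h]|h]|h]; have [[[h1 h2] [h3 h4]] /= h5] := h.
  - by rewrite SLE // hSL // /btw ?h1 ?h5 ?h3 ?h4.
  - by rewrite SBE // hSB // /btw ?h1 ?h5 ?h3 ?h2.
  - by rewrite STE // hST // /btw ?h1 ?h5 ?h2 ?h4 ?orbT.
  - by rewrite SRE // hSR // /btw ?h2 ?h5 ?h3 ?h4 ?orbT.
clearbody S; clear eRB eSB eST eSR SLE SBE STE SRE eLB eLT eRT eRB' hSL hSB hST hSR cSL cSB cST cSR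
  GL GB GT GR G0 SL SB ST SR.
pose q x y := H (p + (x, y)).
have qA x y : - r <= x <= r -> - r <= y <= r ->
    [|| x == - r, x == r, y == - r | y == r] -> A (q x y).
  move=> hx hy hb; have [] := KH x y hx hy; rewrite -/p -/(q x y).
  move=> /andP[h1 h2] /andP[h3 h4] h5.
  have Bq : Bx (q x y) by [].
  have [hl|hl] := leP (q x y).1 (- e); first by left; left; left.
  have [hl2|hl2] := leP (q x y).2 (- e); first by left; left; right.
  have [hl3|hl3] := leP e (q x y).2; first by left; right.
  have [hl4|hl4] := leP e (q x y).1; first by right.
  have [] := eK (q x y).1 (q x y).2; rewrite ?hl ?hl2 ?hl3 ?hl4 //.
  rewrite h5 addrC addKr /= !ltr_norml => /andP[u1 u2] /andP[u3 u4].
  by case/or4P: hb => /eqP hb; clear -hb u1 u2 u3 u4; order_lra.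
have cq : continuous (fun z : P => q z.1 z.2).
  apply: (cont_comp (f := fun z : P => p + (z.1, z.2) : P) _ cH).
  apply: contD; first exact: cont_cst.
  exact: cont_pair.
have rr : - r <= r by order_lra.
have rL : - r <= - r <= r by order_lra.
have rR : - r <= r <= r by order_lra.
have cl t : - r <= clamp (- r) r t <= r by exact: clamp_itv.
have clE t : btw (- r) r t -> clamp (- r) r t = t.
  by move=> /(ble _ _ _ rr) ht; rewrite clamp_id.
have ccl := @cont_clamp R (- r) r.
have Gq x y : - r <= x <= r -> - r <= y <= r -> G (q x y).1 (q x y).2 = (x, y).
  by move=> hx hy; have [_ _ h] := KH x y hx hy; rewrite /G h addrC addKr.
have sH y : y = - r \/ y = r -> sgab (fun x => (x, y) : P) (- r) r =
    neg (S (q (- r) y)) (+) neg (S (q r y)).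
  move=> hy; have hy' : - r <= y <= r by case: hy => ->.
  have qAy t : A (q (clamp (- r) r t) y).
    by apply: qA => //; case: hy => ->; rewrite eqxx ?orbT.
  rewrite (sgabP (s := S \o (fun t => q (clamp (- r) r t) y))) /=.
  - by rewrite !clE ?btwL ?btwR.
  - apply: (cont_within_comp cS) => //.
    apply: (cont_comp (f := fun t => (clamp (- r) r t, y) : P) _ cq).
    by apply: cont_pair => //; exact: cont_cst.
  - move=> t _; apply/negP => /eqP[_ y0']; case: hy; order_lra.
  - by move=> t ht; rewrite SA // Gq // clE.
have sV x : x = - r \/ x = r -> sgab (fun y => (x, y) : P) (- r) r =
    neg (S (q x (- r))) (+) neg (S (q x r)).
  move=> hx; have hx' : - r <= x <= r by case: hx => ->.
  have qAx t : A (q x (clamp (- r) r t)).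
    by apply: qA => //; case: hx => ->; rewrite eqxx ?orbT.
  rewrite (sgabP (s := S \o (fun t => q x (clamp (- r) r t)))) /=.
  - by rewrite !clE ?btwL ?btwR.
  - apply: (cont_within_comp cS) => //.
    apply: (cont_comp (f := fun t => (x, clamp (- r) r t) : P) _ cq).
    by apply: cont_pair => //; exact: cont_cst.
  - move=> t _; apply/negP => /eqP[x0' _]; case: hx; order_lra.
  - by move=> t ht; rewrite SA // Gq // clE.
have := idx_id r0; rewrite /idx (sH (- r)) ?(sH r) ?(sV (- r)) ?(sV r); auto.
by rewrite addb_even.
Qed.

End Chart.

(** * Crossings of arcs *)

Section CrossingIndex.
Variable R : realType.
Notation P := (R * R)%type.

Lemma within_open_cvg (T S : topologicalType) (U : set T) (h : T -> S) x :
  open U -> U x -> {within U, continuous h} -> {for x, continuous h}.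
Proof.
move=> oU Ux /subspace_continuousP ch N hN.
have h1 : nbhs x [set y | U y -> N (h y)] := ch x Ux N hN.
have h2 : nbhs x U by apply: open_nbhs_nbhs.
change (nbhs x (h @^-1` N)).
by apply: filterS (filterI h1 h2) => y [hy Uy]; exact: hy.
Qed.

Lemma nbhs_box (N : set P) (p : P) : nbhs p N ->
  exists2 r : R, 0 < r & forall z : P, `|z.1 - p.1| <= r -> `|z.2 - p.2| <= r -> N z.
Proof.
move=> /nbhs_ballP[e /= e0 he]; exists (e / 2); first by rewrite divr_gt0.
move=> z h1 h2; apply: he; split; rewrite /ball /= distrC; order_lra.
Qed.

(** The point [p] lies on both axes, hence is the origin of the chart. The inverse chart becomes a
    continuous map [K] of the whole plane by clamping both coordinates to a square inside the
    chart's image. *)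
Lemma cross_chart (A B : set P) p : cross_at A B p ->
  exists r (K : R -> R -> P) (U : set P) (h : P -> P),
  [/\ 0 < r, cont2 K, open U, U p & {within U, continuous h}] /\
  [/\ h p = 0,
      forall x y, - r <= x <= r -> - r <= y <= r -> U (K x y) /\ h (K x y) = (x, y),
      forall z, U z -> - r <= (h z).1 <= r -> - r <= (h z).2 <= r ->
        K (h z).1 (h z).2 = z &
      forall z, U z -> (A z <-> (h z).2 = 0) /\ (B z <-> (h z).1 = 0)].
Proof.
move=> [Ap Bp [U [V [h [oU oV Up [k [ch ck hU hV]] hAB]]]]].
have hp : h p = 0.
  have [[h1 _] [h2 _]] := hAB p Up.
  by rewrite [h p]surjective_pairing h1 // h2.
have [Vhp kp] := hU p Up.
have [r r0 hr] := nbhs_box (open_nbhs_nbhs (conj oV Vhp)).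
have boxV x y : - r <= x <= r -> - r <= y <= r -> V (x, y).
  move=> hx hy; apply: hr; rewrite hp /= subr0 ler_norml //.
have rr : - r <= r by order_lra.
exists r, (fun x y => k (clamp (- r) r x, clamp (- r) r y)), U, h.
split; split => //.
- apply: (cont_within_comp (A := V) (S := k)
    (f := fun z : P => (clamp (- r) r z.1, clamp (- r) r z.2) : P)) => //.
    by apply: cont_pair; apply: (cont_comp _ (@cont_clamp _ _ _));
      [apply: cont_fst|apply: cont_snd]; exact: cont_id.
  by move=> z; apply: boxV; exact: clamp_itv.
- move=> x y hx hy; rewrite !clamp_id //.
  by have [? ?] := hV _ (boxV x y hx hy).
- move=> z Uz h1 h2; rewrite !clamp_id // -surjective_pairing.
  by have [] := hU z Uz.
Qed.

(** If both end values had the same sign, the one of smaller absolute value would be attained on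
    both sides of [c], against injectivity. *)
Lemma inj_sign (f : R -> R) a b c : continuous f -> a < c < b -> f c = 0 ->
  (forall x y, a <= x <= b -> a <= y <= b -> f x = f y -> x = y) ->
  f a < 0 < f b \/ f b < 0 < f a.
Proof.
move=> cf /andP[ac cb] fc fi.
have pos (g : R -> R) : continuous g -> g c = 0 ->
    (forall x y, a <= x <= b -> a <= y <= b -> g x = g y -> x = y) ->
    0 < g a -> 0 < g b -> False.
  move=> cg gc gi ga gb; pose m := Num.min (g a) (g b).
  have m0 : 0 < m by rewrite lt_min ga gb.
  have ma : m <= g a by rewrite ge_min lexx.
  have mb : m <= g b by rewrite ge_min lexx orbT.
  have [|x] := @IVT _ g a c m (ltW ac) (cont_within cg).
    by rewrite gc ge_min le_max ma (ltW m0) orbT.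
  rewrite in_itv /= => hx gx.
  have [|y] := @IVT _ g c b m (ltW cb) (cont_within cg).
    by rewrite gc ge_min le_max mb (ltW m0) !orbT.
  rewrite in_itv /= => hy gy.
  have xy : x = y by apply: gi; rewrite ?gx ?gy //; order_lra.
  have xc : x = c by order_lra.
  by move: m0; rewrite -gx xc gc ltxx.
have fa : f a != 0.
  apply/eqP => h; have ac' : a = c by apply: fi; rewrite ?fc //; order_lra.
  by order_lra.
have fb : f b != 0.
  apply/eqP => h; have bc' : b = c by apply: fi; rewrite ?fc //; order_lra.
  by order_lra.
case: (ltgtP (f a) 0) fa => // ha _; case: (ltgtP (f b) 0) fb => // hb _.
- exfalso; apply: (pos (fun x => - f x)).
  + exact: contN.
  + by rewrite fc oppr0.
  + by move=> x y hx hy /oppr_inj; apply: fi.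
  + by rewrite oppr_gt0.
  + by rewrite oppr_gt0.
- by left.
- by right.
- by exfalso; exact: (pos f).
Qed.

Definition Ix (b g : R -> P) : bool := idx (fun s t => b s - g t) 0 1 0 1.

Lemma cont2B (b g : R -> P) : continuous b -> continuous g ->
  cont2 (fun s t => b s - g t).
Proof.
move=> cb cg; apply: (@contB _ _ _ (fun z : P => b z.1) (fun z : P => g z.2)).
  by apply: (cont_comp _ cb); apply: cont_fst; exact: cont_id.
by apply: (cont_comp _ cg); apply: cont_snd; exact: cont_id.
Qed.

Lemma Ix_disjoint (b g : R -> P) : continuous b -> continuous g ->
  (forall s t, 0 <= s <= 1 -> 0 <= t <= 1 -> b s != g t) -> Ix b g = false.
Proof.
move=> cb cg ne; apply: sgab_square; first exact: cont2B.
by move=> x y /orP hx /orP hy; rewrite subr_eq0; apply: ne; order_lra.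
Qed.

(** Excision: the four strips that are cut off contain no zero and have index 0. *)
Lemma idx_zoom (F : R -> R -> P) a b c d a' b' c' d' : cont2 F ->
  a <= a' <= b' -> b' <= b -> c <= c' <= d' -> d' <= d ->
  (forall x y, a <= x <= b -> c <= y <= d -> F x y = 0 ->
     a' < x < b' /\ c' < y < d') ->
  idx F a b c d = idx F a' b' c' d'.
Proof.
move=> cF ha hb hc hd F0.
have nz x y : a <= x <= b -> c <= y <= d ->
    [|| x <= a', b' <= x, y <= c' | d' <= y] -> F x y != 0.
  move=> hx hy h; apply/negP => /eqP /(F0 _ _ hx hy)[h1 h2].
  by move: h => /or4P[]; order_lra.
rewrite (@idx_splitl _ F a b a') //; last first.
  by move=> t ht; split; apply: nz; order_lra.
  by order_lra.
rewrite (@sgab_square _ F a a' c d) //; last first.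
  by move=> x y /orP hx /orP hy; apply: nz; order_lra.
rewrite /= (@idx_splitl _ F a' b b') //; last first.
  by move=> t ht; split; apply: nz; order_lra.
  by order_lra.
rewrite (@sgab_square _ F b' b c d) //; last first.
  by move=> x y /orP hx /orP hy; apply: nz; order_lra.
rewrite addbF (@idx_splitr _ F a' b' c') //; last first.
  by move=> t ht; split; apply: nz; order_lra.
  by order_lra.
rewrite (@sgab_square _ F a' b' c c') //; last first.
  by move=> x y /orP hx /orP hy; apply: nz; order_lra.
rewrite /= (@idx_splitr _ F a' b' d') //; last first.
  by move=> t ht; split; apply: nz; order_lra.
  by order_lra.
rewrite (@sgab_square _ F a' b' d' d) ?addbF //.
by move=> x y /orP hx /orP hy; apply: nz; order_lra.
Qed.

(** The maps [f] and [g] may go back and forth. Only their end values count, because [G] has no zero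
    on the lines along which they move. *)
Lemma idx_reparam (G : R -> R -> P) (f g : R -> R) r a b c d :
  cont2 G -> continuous f -> continuous g ->
  (forall x, btw a b x -> - r <= f x <= r) ->
  (forall y, btw c d y -> - r <= g y <= r) ->
  (forall x y, - r <= x <= r -> - r <= y <= r ->
     [|| x == f a, x == f b, y == g c | y == g d] -> G x y != 0) ->
  idx (fun x y => G (f x) (g y)) a b c d = idx G (f a) (f b) (g c) (g d).
Proof.
move=> cG cf cg hf hg G0.
have [fa fb] := (hf _ (btwL a b), hf _ (btwR a b)).
have [gc gd] := (hg _ (btwL c d), hg _ (btwR c d)).
rewrite /idx; congr ((_ (+) _) (+) (_ (+) _)).
- apply: (sgab_comp (A := - r) (B := r) (g := G (f a))) => //; first exact: cont2r.
  by move=> t ht; apply: G0; rewrite ?eqxx.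
- apply: (sgab_comp (A := - r) (B := r) (g := G (f b))) => //; first exact: cont2r.
  by move=> t ht; apply: G0; rewrite ?eqxx ?orbT.
- apply: (sgab_comp (A := - r) (B := r) (g := G^~ (g c))) => //; first exact: cont2l.
  by move=> t ht; apply: G0; rewrite ?eqxx ?orbT.
- apply: (sgab_comp (A := - r) (B := r) (g := G^~ (g d))) => //; first exact: cont2l.
  by move=> t ht; apply: G0; rewrite ?eqxx ?orbT.
Qed.

Lemma near_arc (f : R -> P) u (N : set P) : continuous f -> nbhs (f u) N ->
  0 < u < 1 -> exists2 dl, 0 < dl & forall x, u - dl <= x <= u + dl ->
    0 < x < 1 /\ N (f x).
Proof.
move=> cf nN hu; have nf : nbhs u (f @^-1` N) by apply: cf.
have [dl dl0 hd] : exists2 dl : R, 0 < dl & forall x, `|u - x| < dl -> N (f x).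
  by move/nbhs_ballP: nf => [dl /= dl0 hd]; exists dl => // x hx; apply: hd.
pose m := Num.min (dl / 2) (Num.min (u / 2) ((1 - u) / 2)).
have m0 : 0 < m by rewrite !lt_min !divr_gt0 //; order_lra.
have m1 : m <= dl / 2 by rewrite /m ge_min lexx.
have m2 : m <= u / 2 by rewrite /m !ge_min lexx orbT.
have m3 : m <= (1 - u) / 2 by rewrite /m !ge_min lexx !orbT.
exists m => // x hx; split; first by order_lra.
by apply: hd; rewrite ltr_norml; order_lra.
Qed.

Lemma nbhs_chart (U : set P) (h : P -> P) p r : open U -> U p ->
  {within U, continuous h} -> h p = 0 -> 0 < r ->
  nbhs p [set q | [/\ U q, - r <= (h q).1 <= r & - r <= (h q).2 <= r]].
Proof.
move=> oU Up ch hp r0; pose W := [set z : P | - r <= z.1 <= r /\ - r <= z.2 <= r].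
have h2 : nbhs p U by apply: open_nbhs_nbhs.
have h1 : nbhs (h p) W.
  rewrite hp; apply/nbhs_ballP; exists r => //= z [] /=.
  rewrite /ball /= !sub0r !normrN !ltr_norml => /andP[? ?] /andP[? ?].
  by split; order_lra.
have {}h1 : nbhs p (h @^-1` W) by exact: (within_open_cvg oU Up ch h1).
by apply: filterS (filterI h1 h2) => q [[? ?] ?].
Qed.

End CrossingIndex.

Section Cross.
Variable R : realType.
Notation P := (R * R)%type.

Lemma idx_chart_sym (K : R -> R -> P) (H : P -> P) a b c d r :
  cont2 K -> continuous H -> a < 0 < b \/ b < 0 < a -> c < 0 < d \/ d < 0 < c ->
  0 < r ->
  (forall x y, btw a b x -> btw c d y -> K x y = K 0 0 -> x = 0 /\ y = 0) ->
  (forall x y, - r <= x <= r -> - r <= y <= r ->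
    [/\ btw a b (H (K 0 0 + (x, y))).1, btw c d (H (K 0 0 + (x, y))).2 &
        K (H (K 0 0 + (x, y))).1 (H (K 0 0 + (x, y))).2 = K 0 0 + (x, y)]) ->
  idx (fun x y => K x y - K 0 0) a b c d.
Proof.
have ble (u v t : R) : u < 0 < v -> btw u v t -> u <= t <= v.
  by move=> uv /orP[//|]; order_lra.
have leb (u v t : R) : u <= t <= v -> btw u v t by rewrite /btw => ->.
move=> cK cH hab.
wlog ab : a b {hab} / a < 0 < b => [W|].
  case: hab => ab hcd r0 h1 h2; first exact: W.
  rewrite idxCl; apply: W => // [x y|x y hx hy]; first by rewrite btwC; exact: h1.
  by have [] := h2 x y hx hy; rewrite btwC.
move=> hcd; wlog cd : c d {hcd} / c < 0 < d => [W|].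
  case: hcd => cd r0 h1 h2; first exact: W.
  rewrite idxCr; apply: W => // [x y hx|x y hx hy].
    by rewrite btwC; exact: h1.
  by have [? ] := h2 x y hx hy; rewrite btwC.
move=> r0 h1 h2; apply: (idx_chart cK cH ab cd r0).
  by move=> x y /leb hx /leb hy; exact: h1.
by move=> x y hx hy; have [/(ble _ _ _ ab) ? /(ble _ _ _ cd) ?] := h2 x y hx hy.
Qed.

(* [K (x, 0) - K (0, y)] is deformed into [K (x, - y) - K (0, 0)]. *)
Lemma idx_axes (K : R -> R -> P) (H : P -> P) r a b c d r' :
  cont2 K -> continuous H -> - r <= a <= r -> - r <= b <= r ->
  - r <= c <= r -> - r <= d <= r ->
  a < 0 < b \/ b < 0 < a -> c < 0 < d \/ d < 0 < c -> 0 < r' ->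
  (forall x y x' y', - r <= x <= r -> - r <= y <= r ->
     - r <= x' <= r -> - r <= y' <= r -> K x y = K x' y' -> x = x' /\ y = y') ->
  (forall x y, - r' <= x <= r' -> - r' <= y <= r' ->
    [/\ btw a b (H (K 0 0 + (x, y))).1, btw (- c) (- d) (H (K 0 0 + (x, y))).2 &
        K (H (K 0 0 + (x, y))).1 (H (K 0 0 + (x, y))).2 = K 0 0 + (x, y)]) ->
  idx (fun x y => K x 0 - K 0 y) a b c d.
Proof.
move=> cK cH ha hb hc hd ab cd r'0 Kinj KH.
have r0 : 0 < r by order_lra.
have cG : cont2 (fun x y => K x 0 - K 0 (- y)).
  apply: (cont2B (b := fun x => K x 0) (g := fun y => K 0 (- y))).
    exact: cont2l.
  apply: (cont_comp (f := fun y : R => - y)); last exact: cont2r.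
  by apply: contN; exact: cont_id.
have Hn (x y : R) : - r <= x <= r -> - r <= y <= r -> x != 0 \/ y != 0 ->
    K x 0 - K 0 (- y) != 0.
  move=> hx hy h; apply/negP => /eqP/subr0_eq eK.
  have [x0 y0] : x = 0 /\ 0 = - y by apply: Kinj eK; order_lra.
  by case: h => /eqP; order_lra.
have -> : idx (fun x y => K x 0 - K 0 y) a b c d =
    idx (fun x y => K x 0 - K 0 (- y)) a b (- c) (- d).
  transitivity (idx (fun x y => K x 0 - K 0 (- - y)) a b c d).
    by apply: eq_idx => x y _ _; rewrite opprK.
  apply: (idx_reparam (G := fun x y => K x 0 - K 0 (- y)) (f := fun x => x)
    (g := fun y => - y) (r := r) cG (@cont_id _) (contN (@cont_id _))).
  - by move=> x /orP; order_lra.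
  - by move=> y /orP; order_lra.
  - move=> x y hx hy h; apply: Hn => //.
    by case/or4P: h => /eqP e; [left|left|right|right]; apply/eqP; order_lra.
(* A zero requires [x = 0] and [t * y = - ((1 - t) * y)], that is [y = 0]. So the only zero is the
   origin at every time, and none reaches the boundary. *)
pose Ht (t x y : R) := K x (t * y) - K 0 (- ((1 - t) * y)).
have -> : idx (fun x y => K x 0 - K 0 (- y)) a b (- c) (- d) =
    idx (Ht 0) a b (- c) (- d).
  by apply: eq_idx => x y _ _; rewrite /Ht mul0r subr0 mul1r.
rewrite (@idx_homotopy _ Ht).
- rewrite (_ : Ht 1 = fun x y => K x y - K 0 0).
    apply: (idx_chart_sym cK cH ab _ r'0) => //; first by order_lra.
    by move=> x y /orP hx /orP hy eK; apply: Kinj eK; order_lra.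
  by apply/funext => x; apply/funext => y; rewrite /Ht mul1r subrr mul0r oppr0.
- have c11 : continuous (fun z : P * R => z.1.1).
    move=> z; apply: (@cvg_comp _ _ _ fst fst (nbhs z) (nbhs z.1) (nbhs z.1.1));
      exact: cvg_fst.
  have c12 : continuous (fun z : P * R => z.1.2).
    move=> z; apply: (@cvg_comp _ _ _ fst snd (nbhs z) (nbhs z.1) (nbhs z.1.2)).
      exact: cvg_fst.
    exact: cvg_snd.
  have c2 : continuous (fun z : P * R => z.2) by move=> z; exact: cvg_snd.
  apply: contB.
    apply: (cont_comp (f := fun z : P * R => (z.1.1, z.2 * z.1.2) : P) _ cK).
    by apply: cont_pair => //; exact: contM.
  apply: (cont_comp (f := fun z : P * R => (0, - ((1 - z.2) * z.1.2)) : P) _ cK).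
  apply: cont_pair; first exact: cont_cst.
  by apply: contN; apply: contM => //; apply: contB => //; exact: cont_cst.
- move=> t x y ht /orP hx /orP hy h; apply/negP => /eqP /subr0_eq eK.
  have [x0 y0] : x = 0 /\ t * y = - ((1 - t) * y) by apply: Kinj eK; nra.
  have {}y0 : y = 0 by order_lra.
  by move: h; rewrite x0 y0 => /or4P[] /eqP; order_lra.
Qed.

Lemma btw_nbhs (a b : R) : a < 0 < b \/ b < 0 < a ->
  exists2 m, 0 < m & forall t, `|t| < m -> btw a b t.
Proof.
move=> h; have [[a0 b0]|[a0 b0]] : a < 0 /\ 0 < b \/ b < 0 /\ 0 < a by order_lra.
  exists (Num.min (- a) b); first by rewrite lt_min oppr_gt0 a0.
  move=> t; rewrite lt_min !ltr_norml => /andP[/andP[? ?] /andP[? ?]].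
  by apply/orP; order_lra.
exists (Num.min (- b) a); first by rewrite lt_min oppr_gt0 a0.
move=> t; rewrite lt_min !ltr_norml => /andP[/andP[? ?] /andP[? ?]].
by apply/orP; order_lra.
Qed.

Definition inj01 (b : R -> P) := forall s t, 0 <= s <= 1 -> 0 <= t <= 1 ->
  b s = b t -> s = t.

(** Near the crossing, the chart turns the two arcs into paths on the two coordinate axes, and each
    of them changes sign by [inj_sign]. Excision and reparametrization reduce the index to the one
    of [idx_axes]. *)
Lemma Ix_cross (A B : set P) (b g : R -> P) s0 t0 :
  continuous b -> continuous g -> inj01 b -> inj01 g ->
  (forall s, 0 < s < 1 -> A (b s)) -> (forall t, 0 < t < 1 -> B (g t)) ->
  0 < s0 < 1 -> 0 < t0 < 1 ->
  (forall s t, 0 <= s <= 1 -> 0 <= t <= 1 -> b s = g t -> s = s0 /\ t = t0) ->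
  b s0 = g t0 -> cross_at A B (b s0) -> Ix b g.
Proof.
move=> cb cg ib ig bA gB hs0 ht0 uniq e.
move=> /cross_chart[r [K [U [h [[r0 cK oU Up ch] [hp KU Kh hAB]]]]]].
set p := b s0 in e Up hp.
have chx x : U x -> {for x, continuous h}.
  by move=> Ux; exact: (within_open_cvg oU Ux ch).
have near (f : R -> P) u : continuous f -> f u = p -> 0 < u < 1 ->
    exists2 dl, 0 < dl & forall x, u - dl <= x <= u + dl ->
      [/\ 0 < x < 1, U (f x), - r <= (h (f x)).1 <= r & - r <= (h (f x)).2 <= r].
  move=> cf fu hu; have := nbhs_chart oU Up ch hp r0; rewrite -fu.
  move=> /(near_arc cf)/(_ hu)[dl dl0 hd]; exists dl => // x hx.
  by have [? []] := hd x hx.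
have [ds ds0 hds] := near b s0 cb erefl hs0.
have [dt dt0 hdt] := near g t0 cg (esym e) ht0.
pose cs := clamp (s0 - ds) (s0 + ds); pose ct := clamp (t0 - dt) (t0 + dt).
have hcs s : s0 - ds <= cs s <= s0 + ds by apply: clamp_itv; order_lra.
have hct t : t0 - dt <= ct t <= t0 + dt by apply: clamp_itv; order_lra.
pose x s := (h (b (cs s))).1; pose y t := (h (g (ct t))).2.
have cx : continuous x.
  apply: cont_fst; apply: (cont_within_comp (f := fun s => b (cs s)) ch).
    by apply: (cont_comp (f := cs) _ cb); exact: cont_clamp.
  by move=> s; have [] := hds _ (hcs s).
have cy : continuous y.
  apply: cont_snd; apply: (cont_within_comp (f := fun t => g (ct t)) ch).
    by apply: (cont_comp (f := ct) _ cg); exact: cont_clamp.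
  by move=> s; have [] := hdt _ (hct s).
have xr s : - r <= x s <= r by have [] := hds _ (hcs s).
have yr t : - r <= y t <= r by have [] := hdt _ (hct t).
have bE s : s0 - ds <= s <= s0 + ds -> b s = K (x s) 0.
  move=> hs; have [s01 Us h1 h2] := hds _ hs; rewrite /x /cs clamp_id //.
  have [[/(_ (bA _ s01)) e2 _] _] := hAB _ Us.
  by rewrite -e2 Kh.
have gE t : t0 - dt <= t <= t0 + dt -> g t = K 0 (y t).
  move=> ht; have [t01 Ut h1 h2] := hdt _ ht; rewrite /y /ct clamp_id //.
  have [_ [/(_ (gB _ t01)) e2 _]] := hAB _ Ut.
  by rewrite -e2 Kh.
have x0 : x s0 = 0 by rewrite /x /cs clamp_id ?hp //; order_lra.
have y0 : y t0 = 0 by rewrite /y /ct clamp_id -?e ?hp //; order_lra.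
have Kinj u v u' v' : - r <= u <= r -> - r <= v <= r ->
     - r <= u' <= r -> - r <= v' <= r -> K u v = K u' v' -> u = u' /\ v = v'.
  move=> hu hv hu' hv' eK; have [_ e1] := KU u v hu hv.
  by have [_] := KU u' v' hu' hv'; rewrite -eK e1 => -[].
have sx : x (s0 - ds) < 0 < x (s0 + ds) \/ x (s0 + ds) < 0 < x (s0 - ds).
  apply: (inj_sign (c := s0) cx) => // [|s t hs ht es]; first by order_lra.
  have [s01 _ _ _] := hds _ hs; have [t01 _ _ _] := hds _ ht.
  by apply: ib; rewrite ?bE ?es //; order_lra.
have sy : y (t0 - dt) < 0 < y (t0 + dt) \/ y (t0 + dt) < 0 < y (t0 - dt).
  apply: (inj_sign (c := t0) cy) => // [|s t hs ht es]; first by order_lra.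
  have [s01 _ _ _] := hdt _ hs; have [t01 _ _ _] := hdt _ ht.
  by apply: ig; rewrite ?gE ?es //; order_lra.
have sm : 0 < s0 - ds by have [] := hds (s0 - ds); order_lra.
have sp : s0 + ds < 1 by have [] := hds (s0 + ds); order_lra.
have tm : 0 < t0 - dt by have [] := hdt (t0 - dt); order_lra.
have tp : t0 + dt < 1 by have [] := hdt (t0 + dt); order_lra.
rewrite /Ix (@idx_zoom _ _ 0 1 0 1 (s0 - ds) (s0 + ds) (t0 - dt) (t0 + dt)) //;
  [|exact: cont2B|order_lra|order_lra|order_lra|order_lra|]; last first.
  by move=> s t hs ht /subr0_eq /(uniq _ _ hs ht)[-> ->]; order_lra.
rewrite (@eq_idx _ _ (fun s t => K (x s) 0 - K 0 (y t))); last first.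
  move=> s t /orP hs /orP ht; rewrite bE ?gE //; order_lra.
have cG : cont2 (fun u v => K u 0 - K 0 v).
  by apply: cont2B; [exact: cont2l|exact: cont2r].
rewrite (@idx_reparam _ (fun u v => K u 0 - K 0 v) x y r) //; last first.
  move=> u v hu hv hb; apply/negP => /eqP /subr0_eq eK.
  have [u0 v0] : u = 0 /\ 0 = v by apply: Kinj eK; order_lra.
  by move: hb; rewrite u0 -v0 => /or4P[] /eqP; order_lra.
have [rho rho0 hrho] : exists2 rho, 0 < rho & forall z : P,
    `|z.1 - p.1| <= rho -> `|z.2 - p.2| <= rho ->
    [/\ U z, btw (x (s0 - ds)) (x (s0 + ds)) (h z).1 &
        btw (- y (t0 - dt)) (- y (t0 + dt)) (h z).2].
  apply: nbhs_box.
  have h2 : nbhs p U by apply: open_nbhs_nbhs.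
  have h1 : nbhs (h p) [set z : P | btw (x (s0 - ds)) (x (s0 + ds)) z.1 /\
      btw (- y (t0 - dt)) (- y (t0 + dt)) z.2].
    have [m1 m10 hm1] := btw_nbhs sx.
    have [m2 m20 hm2] : exists2 m, 0 < m &
        forall t, `|t| < m -> btw (- y (t0 - dt)) (- y (t0 + dt)) t.
      by apply: btw_nbhs; order_lra.
    rewrite hp; apply/nbhs_ballP; exists (Num.min m1 m2) => /=.
      by rewrite lt_min m10 m20.
    move=> z []; rewrite /ball /= !sub0r !normrN !lt_min.
    move=> /andP[u1 _] /andP[_ u2].
    by split; [exact: hm1|exact: hm2].
  have {}h1 : nbhs p (h @^-1` [set z : P |
      btw (x (s0 - ds)) (x (s0 + ds)) z.1 /\
      btw (- y (t0 - dt)) (- y (t0 + dt)) z.2]).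
    exact: (chx p Up _ h1).
  by apply: filterS (filterI h1 h2) => q [[? ?] ?].
(* A retraction onto a square around [p] inside the chart domain; it makes [h \o Q] continuous on
   the whole plane. *)
pose Q (z : P) : P := (clamp (p.1 - rho) (p.1 + rho) z.1,
                       clamp (p.2 - rho) (p.2 + rho) z.2).
have hQ z : [/\ U (Q z), btw (x (s0 - ds)) (x (s0 + ds)) (h (Q z)).1 &
        btw (- y (t0 - dt)) (- y (t0 + dt)) (h (Q z)).2].
  have q1 : p.1 - rho <= clamp (p.1 - rho) (p.1 + rho) z.1 <= p.1 + rho.
    by apply: clamp_itv; order_lra.
  have q2 : p.2 - rho <= clamp (p.2 - rho) (p.2 + rho) z.2 <= p.2 + rho.
    by apply: clamp_itv; order_lra.
  by apply: hrho; rewrite /Q /= ler_norml; order_lra.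
have K0 : K 0 0 = p.
  have h0 : s0 - ds <= s0 <= s0 + ds by order_lra.
  by rewrite /p (bE _ h0) x0.
apply: (idx_axes (H := h \o Q) (r := r) (r' := rho)) => //.
  apply: (cont_within_comp ch); last by move=> z; have [] := hQ z.
  by apply: cont_pair; apply: (cont_comp _ (@cont_clamp _ _ _));
    [apply: cont_fst|apply: cont_snd]; exact: cont_id.
move=> u v hu hv; rewrite K0 /=.
have -> : Q (p + (u, v)) = p + (u, v).
  by rewrite /Q /= !clamp_id //; order_lra.
have [Uz b1 b2] : [/\ U (p + (u, v)), btw (x (s0 - ds)) (x (s0 + ds)) (h (p + (u, v))).1 &
        btw (- y (t0 - dt)) (- y (t0 + dt)) (h (p + (u, v))).2].
  by apply: hrho; rewrite /= addrC addKr ler_norml; order_lra.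
split => //; apply: Kh => //.
  by apply: btw_itv b1; exact: xr.
by apply: btw_itv b2; rewrite lerN2 lerNl andbC; exact: yr.
Qed.

End Cross.

(** * Closed curves in a drawing *)

Section Chains.
Variable R : realType.
Notation P := (R * R)%type.

(* A family of paths is a mod 2 cycle when every point is an even number of
   times an end of one of them. *)
Definition closed_chain (bs : seq (R -> P)) : Prop :=
  forall f : P -> bool, \big[addb/false]_(b <- bs) (f (b 0) (+) f (b 1)) = false.

(** The sides [s = 0] and [s = 1] of the square contribute a function [V g] of the points [b 0] and
    [b 1], the other two sides a function [W b] of the points [g 0] and [g 1]. Applying the
    definition of a closed chain to these functions makes both sums vanish. *)
Lemma chain_parity (bs gs : seq (R -> P)) : closed_chain bs -> closed_chain gs ->
  \big[addb/false]_(b <- bs) \big[addb/false]_(g <- gs) Ix b g = false.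
Proof.
move=> hb hg.
pose V (g : R -> P) (p : P) := sgab (fun t => p - g t) 0 1.
pose W (b : R -> P) (q : P) := sgab (fun s => b s - q) 0 1.
have E b g : Ix b g = (V g (b 0) (+) V g (b 1)) (+) (W b (g 0) (+) W b (g 1)).
  by [].
under eq_bigr => b _ do (under eq_bigr => g _ do rewrite E; rewrite big_split /=).
rewrite big_split /= exchange_big /=.
by rewrite big1 ?[X in _ (+) X]big1.
Qed.

(** The curve alternates between pieces [b i] and links [k i] that lead from the end of one piece to
    the beginning of the next. *)
Lemma closed_chain_cycle n (b k : nat -> R -> P) :
  (forall i, (i < n)%N -> k i 0 = b i 1 /\ k i 1 = b (i.+1 %% n)%N 0) ->
  closed_chain ([seq b i | i <- iota 0 n] ++ [seq k i | i <- iota 0 n]).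
Proof.
move=> h f; rewrite big_cat !big_map /=.
have e : index_iota 0 n = iota 0 n by rewrite /index_iota subn0.
rewrite -e !big_mkord -big_split /=.
have -> : \big[addb/false]_(i < n) ((f (b i 0) (+) f (b i 1)) (+)
    (f (k i 0) (+) f (k i 1))) =
    \big[addb/false]_(i < n) (f (b i 0) (+) f (b (ordS i) 0)).
  apply: eq_bigr => i _; have [-> ->] := h i (ltn_ord i).
  rewrite -[nat_of_ord (ordS i)]/(i.+1 %% n)%N.
  by move: (f (b i 0)) (f (b i 1)) (f (b (i.+1 %% n)%N 0)) => [] [] [].
rewrite big_split /=.
rewrite [X in _ (+) X](_ : _ = \big[addb/false]_(i < n) f (b i 0)) ?addbb //.
by rewrite [RHS](reindex_inj (@ordS_inj n)).
Qed.

Lemma open_ne (a : P) : open [set q : P | q != a].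
Proof.
rewrite (_ : [set q | _] = ~` [set a]).
  by apply: closed_openC; apply: accessible_closed_set1; exact: hausdorff_accessible.
by apply/seteqP; split => q /= /eqP.
Qed.

Lemma closed_chain_cycle0 n (b : nat -> R -> P) :
  (forall i, (i < n)%N -> b i 1 = b (i.+1 %% n)%N 0) ->
  closed_chain [seq b i | i <- iota 0 n].
Proof.
move=> h f; rewrite big_map.
have e : index_iota 0 n = iota 0 n by rewrite /index_iota subn0.
rewrite -e big_mkord big_split /=.
rewrite [X in _ (+) X](_ : _ = \big[addb/false]_(i < n) f (b i 0)) ?addbb //.
rewrite [RHS](reindex_inj (@ordS_inj n)) /=.
by apply: eq_bigr => i _; rewrite h.
Qed.

(* Inside the chart, the segment joining a point of one axis to a point of the
   other meets the axes at its ends only. *)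
Lemma corner (A B N : set P) (b g : R -> P) s0 t0 :
  continuous b -> continuous g -> inj01 b -> inj01 g ->
  (forall s, 0 < s < 1 -> A (b s)) -> (forall t, 0 < t < 1 -> B (g t)) ->
  0 < s0 < 1 -> 0 < t0 < 1 -> b s0 = g t0 -> cross_at A B (b s0) ->
  nbhs (b s0) N ->
  exists2 m : R, 0 < m & forall s1 t1, s1 != s0 -> t1 != t0 ->
    `|s1 - s0| <= m -> `|t1 - t0| <= m ->
    exists k : R -> P, [/\ continuous k, k 0 = b s1, k 1 = g t1,
      forall u, 0 <= u <= 1 -> N (k u) &
      (forall u s, 0 <= u <= 1 -> 0 <= s <= 1 -> k u = b s -> s = s1) /\
      (forall u t, 0 <= u <= 1 -> 0 <= t <= 1 -> k u = g t -> t = t1)].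
Proof.
move=> cb cg ib ig bA gB hs0 ht0 e /cross_chart[r [K [U [h []]]]].
move=> [r0 cK oU Up ch] [hp KU Kh hAB] nN.
have avoid (f : R -> P) w x : continuous f -> inj01 f -> 0 < w < 1 ->
    x = 0 \/ x = 1 -> nbhs (f w) [set q | q != f x].
  move=> cf jf hw hx; have fx : f w != f x.
    by apply/eqP => /jf; case: hx => -> h'; have := h' _ _; order_lra.
  apply: open_nbhs_nbhs; split => //; exact: open_ne.
have K0 : K 0 0 = b s0.
  by have := Kh _ Up; rewrite hp /= => -> //; order_lra.
(* The axes of the chart are known to contain only the open arcs, so the endpoints of the arcs are
   kept away separately. *)
pose N' := N `&` [set q | [/\ q != b 0, q != b 1, q != g 0 & q != g 1]].
have nN' : nbhs (b s0) N'.
  apply: filterI => //.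
  have h1 := avoid b s0 0 cb ib hs0 (or_introl erefl).
  have h2 := avoid b s0 1 cb ib hs0 (or_intror erefl).
  have h3 := avoid g t0 0 cg ig ht0 (or_introl erefl).
  have h4 := avoid g t0 1 cg ig ht0 (or_intror erefl).
  rewrite -e in h3 h4.
  by apply: filterS (filterI (filterI h1 h2) (filterI h3 h4)) => q [[? ?] [? ?]].
have nK : nbhs ((0, 0) : P) [set z : P | N' (K z.1 z.2)].
  have nk : nbhs (K 0 0) N' by rewrite K0.
  exact: (cK (0, 0) N' nk).
have [r1 r10 hr1] := nbhs_box nK.
pose rr := Num.min r r1; have rr0 : 0 < rr by rewrite lt_min r0 r10.
have rrr : rr <= r by rewrite ge_min lexx.
have rrr1 : rr <= r1 by rewrite ge_min lexx orbT.
have nC := nbhs_chart oU Up ch hp rr0.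
have [d1 d10 hd1] := near_arc cb nC hs0.
rewrite e in nC; have [d2 d20 hd2] := near_arc cg nC ht0.
exists (Num.min d1 d2); first by rewrite lt_min d10 d20.
move=> s1 t1 s1s t1t; rewrite !le_min !ler_norml => /andP[u1 _] /andP[_ u2].
have [s101 [Us xs ys]] : 0 < s1 < 1 /\ [/\ U (b s1), - rr <= (h (b s1)).1 <= rr &
    - rr <= (h (b s1)).2 <= rr] by apply: hd1; order_lra.
have [t101 [Ut xt yt]] : 0 < t1 < 1 /\ [/\ U (g t1), - rr <= (h (g t1)).1 <= rr &
    - rr <= (h (g t1)).2 <= rr] by apply: hd2; order_lra.
have [[/(_ (bA _ s101)) s2 _] _] := hAB _ Us.
have [_ [/(_ (gB _ t101)) t2 _]] := hAB _ Ut.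
set x1 := (h (b s1)).1 in xs *; set y1 := (h (g t1)).2 in yt *.
have bs1 : K x1 0 = b s1 by rewrite -s2 /x1 Kh //; clear -xs ys rrr; lra.
have gt1 : K 0 y1 = g t1 by rewrite -t2 /y1 Kh //; clear -xt yt rrr; lra.
have x10 : x1 != 0.
  apply/eqP => x0; move: bs1; rewrite x0 K0 => /ib h1.
  by move: s1s; rewrite h1 ?eqxx //; order_lra.
have y10 : y1 != 0.
  apply/eqP => y0; move: gt1; rewrite y0 K0 e => /ig h1.
  by move: t1t; rewrite h1 ?eqxx //; order_lra.
exists (fun u => K ((1 - u) * x1) (u * y1)).
have box u : 0 <= u <= 1 -> - rr <= (1 - u) * x1 <= rr /\ - rr <= u * y1 <= rr.
  by clear -xs yt rr0; move=> hu; split; nra.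
have hK u : 0 <= u <= 1 -> [/\ U (K ((1 - u) * x1) (u * y1)),
    h (K ((1 - u) * x1) (u * y1)) = ((1 - u) * x1, u * y1) &
    N' (K ((1 - u) * x1) (u * y1))].
  move=> /box[b1 b2]; have [? ?] : U (K ((1 - u) * x1) (u * y1)) /\
    h (K ((1 - u) * x1) (u * y1)) = ((1 - u) * x1, u * y1) by apply: KU; clear -b1 b2 rrr; lra.
  split => //; apply: (hr1 ((1 - u) * x1, u * y1)); rewrite /= subr0 ler_norml; clear -b1 b2
    rrr1; lra.
split.
- apply: (cont_comp (f := fun u : R => ((1 - u) * x1, u * y1) : P) _ cK).
  apply: cont_pair; apply: contM; try exact: cont_cst; last exact: cont_id.
  by apply: contB; [exact: cont_cst|exact: cont_id].
- by rewrite subr0 mul1r mul0r.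
- by rewrite subrr mul1r mul0r.
- by move=> u /hK[_ _ []].
- split=> u s hu hs es; have [UK hE [_ [q1 q2 q3 q4]]] := hK u hu.
    have s01 : 0 < s < 1.
      rewrite !lt_neqAle; case/andP: (hs) => -> ->; rewrite !andbT.
      apply/andP; split; first by apply: contra q1 => /eqP e0; rewrite es -e0.
      by apply: contra q2 => /eqP e1; rewrite es e1.
    have [[/(_ _) h2 _] _] := hAB _ UK; move: h2; rewrite hE es => /(_ (bA _ s01)).
    move/eqP; rewrite /= mulf_eq0 (negbTE y10) orbF => /eqP u0.
    by apply: ib => //; [order_lra|rewrite -es u0 subr0 mul1r mul0r bs1].
  have s01 : 0 < s < 1.
    rewrite !lt_neqAle; case/andP: (hs) => -> ->; rewrite !andbT.
    apply/andP; split; first by apply: contra q3 => /eqP e0; rewrite es -e0.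
    by apply: contra q4 => /eqP e1; rewrite es e1.
  have [_ [/(_ _) h2 _]] := hAB _ UK; move: h2; rewrite hE es => /(_ (gB _ s01)).
  move/eqP; rewrite /= mulf_eq0 (negbTE x10) orbF => /eqP u0.
  have {}u0 : u = 1 by clear -u0; order_lra.
  by apply: ig => //; [clear -t101; order_lra|rewrite -es u0 subrr mul1r mul0r gt1].
Qed.

End Chains.

(** * Combinatorial closed curves and the parity of their crossings *)

Section Checker.
Local Open Scope nat_scope.

(* Along edge [i], the stops are its source [0], its target [1], and its
   crossing [j.+2] with edge [j]; [o] lists the crossings of each edge in the
   order in which they occur.  A piece [(i, x, y)] is the part of edge [i] from
   stop [x] to stop [y]. *)
Definition piece := (nat * nat * nat)%type.

Definition stop_ok (o : seq (seq nat)) i x :=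
  if x is j.+2 then j \in nth [::] o i else true.

Definition rk (o : seq (seq nat)) i x :=
  match x with
  | 0 => 0
  | 1 => (size (nth [::] o i)).+1
  | j.+2 => (index j (nth [::] o i)).+1
  end.

Definition vert (es : seq (nat * nat)) i x :=
  if x is 0 then (nth (0, 0) es i).1 else (nth (0, 0) es i).2.

Definition piece_ok (es : seq (nat * nat)) o (p : piece) :=
  let: (i, x, y) := p in
  [&& i < size es, stop_ok o i x, stop_ok o i y & x != y].

Definition joint_ok (es : seq (nat * nat)) (p p' : piece) :=
  let: (i, x, y) := p in let: (i', x', y') := p' in
  if y is j.+2 then (i' == j) && (x' == i.+2)
  else (x' < 2) && (vert es i y == vert es i' x').

Definition dpiece : piece := (0, 0, 0).

Definition trail_ok es o (g : seq piece) :=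
  all (piece_ok es o) g &&
  all (fun k => joint_ok es (nth dpiece g k) (nth dpiece g (k.+1 %% size g)))
    (iota 0 (size g)).

Definition lo o (p : piece) := let: (i, x, y) := p in minn (rk o i x) (rk o i y).
Definition hi o (p : piece) := let: (i, x, y) := p in maxn (rk o i x) (rk o i y).

Definition within_cl o (p : piece) r := lo o p <= r <= hi o p.
Definition within_op o (p : piece) r := lo o p < r < hi o p.

Definition ends es (p : piece) : seq nat :=
  let: (i, x, y) := p in [seq vert es i z | z <- [:: x; y] & z < 2].

(** [p] will be shortened at its ends that are crossings, while [q] stays whole; hence the
    asymmetry. On one edge, the pieces may share a crossing as a common end, but no vertex. On two
    edges, they share no vertex, and a crossing inside [p] must not be an end of [q]; an end of [p]
    may be one. *)
Definition sep es o (p q : piece) :=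
  let: (i, _, _) := p in let: (j, _, _) := q in
  if i == j then
    [|| hi o p < lo o q, hi o q < lo o p,
        (hi o p == lo o q) && (0 < hi o p <= size (nth [::] o i)) |
        (hi o q == lo o p) && (0 < hi o q <= size (nth [::] o i))]
  else ~~ has (mem (ends es q)) (ends es p) &&
    (if j \in nth [::] o i then
      within_op o p (rk o i j.+2) && within_cl o q (rk o j i.+2) ==>
      within_op o q (rk o j i.+2) else true).

Definition meet o (p q : piece) :=
  let: (i, _, _) := p in let: (j, _, _) := q in
  [&& i != j, j \in nth [::] o i, within_op o p (rk o i j.+2) &
      within_op o q (rk o j i.+2)].

Definition parity o (g1 g2 : seq piece) :=
  foldr (fun p b => foldr (fun q c => meet o p q (+) c) false g2 (+) b) false g1.

Definition odd_pair es o (g1 g2 : seq piece) :=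
  [&& trail_ok es o g1, trail_ok es o g2,
      all (fun p => all (sep es o p) g2) g1 & parity o g1 g2].

Lemma parityE o g1 g2 : parity o g1 g2 =
  \big[addb/false]_(p <- g1) \big[addb/false]_(q <- g2) meet o p q.
Proof.
rewrite /parity; elim: g1 => [|p g1 IH] /=; first by rewrite big_nil.
rewrite big_cons IH; congr (_ (+) _).
by elim: g2 {IH} => [|q g2 IH] /=; rewrite ?big_nil ?big_cons ?IH.
Qed.

End Checker.

Lemma fin_small (R : realType) (T : eqType) (s : seq T) (Q : T -> R -> Prop) :
  (forall x d d', 0 < d' -> d' <= d -> Q x d -> Q x d') ->
  (forall x, x \in s -> exists2 d, 0 < d & Q x d) ->
  exists2 d, 0 < d & forall x, x \in s -> Q x d.
Proof.
move=> mono; elim: s => [|x s IH] h; first by exists 1.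
have [|d d0 hd] := IH; first by move=> y ys; apply: h; rewrite inE ys orbT.
have [e e0 he] := h x (mem_head _ _).
have m0 : 0 < Num.min d e by rewrite lt_min d0 e0.
exists (Num.min d e) => // y; rewrite inE => /predU1P[->|ys].
  by apply: mono he => //; rewrite ge_min lexx orbT.
by apply: mono (hd y ys) => //; rewrite ge_min lexx.
Qed.

Lemma nbhs_seq (X : topologicalType) (T : eqType) (s : seq T) (p : X)
    (Q : T -> set X) : (forall x, x \in s -> nbhs p (Q x)) ->
  nbhs p [set q | forall x, x \in s -> Q x q].
Proof.
elim: s => [|x s IH] h; first by apply: filterS filterT.
have h1 := h x (mem_head _ _).
have h2 : nbhs p [set q | forall x, x \in s -> Q x q].
  by apply: IH => y ys; apply: h; rewrite inE ys orbT.
apply: filterS (filterI h1 h2) => q [q1 q2] y.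
by rewrite inE => /predU1P[->|/q2].
Qed.

(** * Trails realized by curves in a drawing *)

Section Trails.
Variables (R : realType) (es : seq (nat * nat)) (o : seq (seq nat)).
Notation P := (R * R)%type.
Let n := size es.
Let oo i := nth [::] o i.

(** [al i] parametrizes edge [i], [In i] is its interior, [pt] places the vertices, and [tm i j] is
    the parameter on edge [i] of its crossing with edge [j]. *)
Variables (al : nat -> R -> P) (pt : nat -> P) (tm : nat -> nat -> R)
  (In : nat -> set P).

Hypotheses
  (al_cont : forall i, (i < n)%N -> continuous (al i))
  (al_inj : forall i, (i < n)%N -> inj01 (al i))
  (al0 : forall i, (i < n)%N -> al i 0 = pt (vert es i 0))
  (al1 : forall i, (i < n)%N -> al i 1 = pt (vert es i 1))
  (al_in : forall i s, (i < n)%N -> 0 < s < 1 -> In i (al i s))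
  (al_vtx : forall i j s x, (i < n)%N -> (j < n)%N -> 0 < s < 1 -> (x < 2)%N ->
     al i s != pt (vert es j x))
  (pt_inj : forall i j x y, (i < n)%N -> (j < n)%N -> (x < 2)%N -> (y < 2)%N ->
     pt (vert es i x) = pt (vert es j y) -> vert es i x = vert es j y)
  (o_sym : forall i j, (i < n)%N -> j \in oo i -> [/\ (j < n)%N, j != i & i \in oo j])
  (tm01 : forall i j, (i < n)%N -> j \in oo i -> 0 < tm i j < 1)
  (tm_eq : forall i j, (i < n)%N -> j \in oo i -> al i (tm i j) = al j (tm j i))
  (tm_cross : forall i j, (i < n)%N -> j \in oo i ->
     cross_at (In i) (In j) (al i (tm i j)))
  (tm_uniq : forall i j s t, (i < n)%N -> (j < n)%N -> i != j -> 0 < s < 1 ->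
     0 < t < 1 -> al i s = al j t -> [/\ j \in oo i, s = tm i j & t = tm j i])
  (no_triple : forall i j k, (i < n)%N -> j \in oo i -> k \in oo i -> k \in oo j ->
     False)
  (o_mono : forall i j k, (i < n)%N -> j \in oo i -> k \in oo i ->
     (index j (oo i) < index k (oo i))%N -> tm i j < tm i k).

Definition pos i x : R :=
  match x with 0%N => 0 | 1%N => 1 | j.+2 => tm i j end.

Lemma pos01 i x : (i < n)%N -> stop_ok o i x -> 0 <= pos i x <= 1.
Proof.
by move=> hi; case: x => [|[|j]] /=; rewrite ?lexx ?ler01 // => /(tm01 hi); lra.
Qed.

Lemma rk_lt i x z : (i < n)%N -> stop_ok o i x -> stop_ok o i z ->
  (rk o i x < rk o i z)%N -> pos i x < pos i z.
Proof.
move=> hi; case: x => [|[|j]] /=; case: z => [|[|k]] //=; rewrite ?ltnS ?ltnn //.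
- by move=> _ /(tm01 hi)/andP[].
- by move=> _ hk; rewrite ltnNge ltnW // index_mem.
- by move=> /(tm01 hi)/andP[].
- by move=> hj hk; apply: o_mono.
Qed.

Lemma rk_inj i x z : (i < n)%N -> stop_ok o i x -> stop_ok o i z ->
  rk o i x = rk o i z -> x = z.
Proof.
move=> hi; case: x => [|[|j]] /=; case: z => [|[|k]] //=.
- by move=> _ hk [e]; move: hk; rewrite -index_mem -e ltnn.
- by move=> hk _ [e]; move: hk; rewrite -index_mem e ltnn.
- by move=> hj hk [e]; rewrite -(nth_index 0%N hj) e nth_index.
Qed.

Lemma pos_lt i x z : (i < n)%N -> stop_ok o i x -> stop_ok o i z ->
  (rk o i x < rk o i z)%N = (pos i x < pos i z).
Proof.
move=> hi hx hz; case: (ltngtP (rk o i x) (rk o i z)) => h.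
- by rewrite (rk_lt hi hx hz h).
- by have h' := rk_lt hi hz hx h; rewrite ltNge ltW.
- by rewrite (rk_inj hi hx hz h) ltxx.
Qed.

Lemma pos_le i x z : (i < n)%N -> stop_ok o i x -> stop_ok o i z ->
  (rk o i x <= rk o i z)%N = (pos i x <= pos i z).
Proof. by move=> hi hx hz; rewrite leqNgt pos_lt // leNgt. Qed.

Definition dir (p : piece) : R :=
  let: (i, x, y) := p in if pos i x < pos i y then 1 else -1.

(* The piece, shortened by [d] at its ends which are crossings. *)
Definition beg d (p : piece) : R :=
  let: (i, x, y) := p in pos i x + (if x is _.+2 then d * dir p else 0).
Definition fin d (p : piece) : R :=
  let: (i, x, y) := p in pos i y - (if y is _.+2 then d * dir p else 0).

(** The factor 2 is there because a piece between consecutive stops may be shortened by [d] at both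
    ends. *)
Definition gap d i := forall x z, stop_ok o i x -> stop_ok o i z ->
  pos i x < pos i z -> pos i x + d *+ 2 < pos i z.

Lemma gap_ex : exists2 d, 0 < d & forall i, (i < n)%N -> gap d i.
Proof.
pose st i : seq nat := [:: 0; 1]%N ++ [seq j.+2 | j <- oo i].
have stP i x : stop_ok o i x -> x \in st i.
  case: x => [|[|j]] //= hj; rewrite !inE /=.
  by apply/map_f.
have [||d d0 hd] := @fin_small R _ (iota 0 n)
  (fun i d => forall xz, xz \in [seq (x, z) | x <- st i, z <- st i] ->
     pos i xz.1 < pos i xz.2 -> pos i xz.1 + d *+ 2 < pos i xz.2).
- by move=> i d d' d'0 dd h xz hxz hp; have := h xz hxz hp; lra.
- move=> i _; apply: (@fin_small R _ _ (fun xz d => pos i xz.1 < pos i xz.2 ->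
      pos i xz.1 + d *+ 2 < pos i xz.2)) => [xz d d' d'0 dd h hp|xz _].
    by have := h hp; lra.
  have [hp|hp] := ltP (pos i xz.1) (pos i xz.2); last first.
    by exists 1 => //; lra.
  by exists ((pos i xz.2 - pos i xz.1) / 3) => [|_]; lra.
exists d => // i hi x z hx hz hp.
apply: (hd i _ (x, z)) => //; first by rewrite mem_iota.
by apply: allpairs_f; exact: stP.
Qed.

Lemma shrink d i x y : (i < n)%N -> 0 < d -> gap d i -> stop_ok o i x ->
  stop_ok o i y -> x != y ->
  let p := (i, x, y) in
  [/\ beg d p != fin d p,
      forall s, btw (beg d p) (fin d p) s -> [/\ btw (pos i x) (pos i y) s,
        ((1 < x)%N -> s != pos i x) & ((1 < y)%N -> s != pos i y)] &
      forall z, stop_ok o i z -> pos i x < pos i z < pos i y \/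
          pos i y < pos i z < pos i x ->
        beg d p < pos i z < fin d p \/ fin d p < pos i z < beg d p].
Proof.
move=> hi d0 hg hx hy xy p.
have pxy : pos i x != pos i y.
  apply: contra xy => /eqP e; apply/eqP; apply: (rk_inj hi) => //.
  by apply/eqP; rewrite eqn_leq !pos_le // e lexx.
have g1 z : stop_ok o i z -> pos i x < pos i z -> pos i x + d *+ 2 < pos i z.
  by move=> hz; exact: hg.
have g2 z : stop_ok o i z -> pos i z < pos i x -> pos i z + d *+ 2 < pos i x.
  by move=> hz; exact: hg.
have g3 z : stop_ok o i z -> pos i y < pos i z -> pos i y + d *+ 2 < pos i z.
  by move=> hz; exact: hg.
have g4 z : stop_ok o i z -> pos i z < pos i y -> pos i z + d *+ 2 < pos i y.
  by move=> hz; exact: hg.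
have [h|h|h] := ltgtP (pos i x) (pos i y); last by rewrite h eqxx in pxy.
- have gxy := g1 _ hy h.
  have [c c01 [bE c1]] : exists2 c, 0 <= c <= d & beg d p = pos i x + c /\
      ((1 < x)%N -> 0 < c).
    rewrite /beg /p /dir h; case: (x) => [|[|j]]; [exists 0|exists 0|exists d];
      rewrite ?mulr1 ?lexx ?ltW //.
  have [e e01 [fE e1]] : exists2 e, 0 <= e <= d & fin d p = pos i y - e /\
      ((1 < y)%N -> 0 < e).
    rewrite /fin /p /dir h; case: (y) => [|[|j]]; [exists 0|exists 0|exists d];
      rewrite ?mulr1 ?lexx ?ltW //.
  rewrite bE fE; split.
  + by apply/eqP; lra.
  + move=> s /orP hs; split; first by apply/orP; lra.
      by move=> /c1 c0; apply/eqP; lra.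
    by move=> /e1 e0; apply/eqP; lra.
  + move=> z hz; have := g1 z hz; have := g4 z hz.
    case: (ltP (pos i x) (pos i z)) => h1; case: (ltP (pos i z) (pos i y)) => h2;
      move=> k2 k1 hh; left.
    * by have := k1 isT; have := k2 isT; lra.
    * by lra.
    * by lra.
    * by lra.
- have gxy := g2 _ hy h.
  have nh : (pos i x < pos i y) = false by rewrite ltNge ltW.
  have [c c01 [bE c1]] : exists2 c, 0 <= c <= d & beg d p = pos i x - c /\
      ((1 < x)%N -> 0 < c).
    rewrite /beg /p /dir nh; case: (x) => [|[|j]]; [exists 0|exists 0|exists d];
      rewrite ?mulrN1 ?subr0 ?addr0 ?lexx ?ltW //.
  have [e e01 [fE e1]] : exists2 e, 0 <= e <= d & fin d p = pos i y + e /\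
      ((1 < y)%N -> 0 < e).
    rewrite /fin /p /dir nh; case: (y) => [|[|j]]; [exists 0|exists 0|exists d];
      rewrite ?mulrN1 ?opprK ?subr0 ?addr0 ?lexx ?ltW //.
  rewrite bE fE; split.
  + by apply/eqP; lra.
  + move=> s /orP hs; split; first by apply/orP; lra.
      by move=> /c1 c0; apply/eqP; lra.
    by move=> /e1 e0; apply/eqP; lra.
  + move=> z hz; have := g2 z hz; have := g3 z hz.
    case: (ltP (pos i y) (pos i z)) => h1; case: (ltP (pos i z) (pos i x)) => h2;
      move=> k2 k1 hh; right.
    * by have := k1 isT; have := k2 isT; lra.
    * by lra.
    * by lra.
    * by lra.
Qed.

Definition seg (i : nat) (a b : R) (u : R) : P := al i (a + u * (b - a)).
Definition whole (p : piece) := let: (i, x, y) := p in seg i (pos i x) (pos i y).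
Definition sub d (p : piece) := let: (i, x, y) := p in seg i (beg d p) (fin d p).

Lemma seg_cont i a b : (i < n)%N -> continuous (seg i a b).
Proof.
move=> hi; rewrite /seg.
apply: (cont_comp (f := fun u : R => a + u * (b - a)) _ (al_cont hi)).
apply: contD; first exact: cont_cst.
by apply: contM; [exact: cont_id|exact: cont_cst].
Qed.

Lemma seg_btw (a b u : R) : 0 <= u <= 1 -> btw a b (a + u * (b - a)).
Proof.
move=> hu; apply/orP; have [ab|ba] := leP a b; [left|right]; nra.
Qed.

Lemma ends_rk (i x y : nat) s : (i < n)%N -> stop_ok o i x -> stop_ok o i y ->
  btw (pos i x) (pos i y) s ->
  (exists e, [/\ e = x \/ e = y, stop_ok o i e, rk o i e = hi o (i, x, y) &
     s <= pos i e]) /\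
  (exists e, [/\ e = x \/ e = y, stop_ok o i e, rk o i e = lo o (i, x, y) &
     pos i e <= s]).
Proof.
move=> hi hx hy; rewrite /= /minn /maxn pos_lt // => /orP hs.
case: ltP => h; split.
- by exists y; split; auto; lra.
- by exists x; split; auto; lra.
- by exists x; split; auto; lra.
- by exists y; split; auto; lra.
Qed.

(** By [sep], the pieces have at most one end in common, and it is a crossing. There the first piece
    has been shortened. *)
Lemma hits_same d i x y z w s : (i < n)%N -> 0 < d -> gap d i ->
  piece_ok es o (i, x, y) -> piece_ok es o (i, z, w) ->
  sep es o (i, x, y) (i, z, w) ->
  btw (beg d (i, x, y)) (fin d (i, x, y)) s -> btw (pos i z) (pos i w) s -> False.
Proof.
move=> hi d0 hg /and4P[_ hx hy xy] /and4P[_ hz hw zw] hsep hs hs'.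
have [_ /(_ s hs)[bs sx sy] _] := shrink hi d0 hg hx hy xy.
have [[e1 [e1E oe1 r1 l1]] [e2 [e2E oe2 r2 l2]]] := ends_rk hi hx hy bs.
have [[f1 [_ of1 q1 k1]] [f2 [_ of2 q2 k2]]] := ends_rk hi hz hw hs'.
have tie e : e = x \/ e = y -> (0 < rk o i e <= size (oo i))%N -> s = pos i e -> False.
  move=> eE re se; have e2' : (1 < e)%N.
    by case: (e) re => [|[|k]] //=; rewrite /oo ltnn.
  by case: eE => eE; move: se; rewrite -eE in sx sy * => se;
    [move: (sx e2')|move: (sy e2')]; rewrite se eqxx.
move: hsep; rewrite /sep eqxx -r1 -r2 -q1 -q2 => /or4P[].
- by move=> /(rk_lt hi oe1 of2); lra.
- by move=> /(rk_lt hi of1 oe2); lra.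
- case/andP=> /eqP rr hh; apply: (tie e1) => //.
  by have e := rk_inj hi oe1 of2 rr; rewrite -e in k2; lra.
- case/andP=> /eqP rr hh; rewrite rr in hh; apply: (tie e2) => //.
  by have e := rk_inj hi of1 oe2 rr; rewrite e in k1; lra.
Qed.

Lemma pos_inj i x y : (i < n)%N -> stop_ok o i x -> stop_ok o i y ->
  pos i x = pos i y -> x = y.
Proof.
move=> hi hx hy e; apply: (rk_inj hi) => //.
by apply/eqP; rewrite eqn_leq !pos_le // e lexx.
Qed.

Lemma end_cases i s : 0 <= s <= 1 ->
  0 < s < 1 \/ exists2 e : nat, (e < 2)%N & s = pos i e.
Proof.
move=> hs; have [s0|s0] := eqVneq s 0; first by right; exists 0%N.
have [s1|s1] := eqVneq s 1; first by right; exists 1%N.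
by left; rewrite !lt_neqAle [0 == s]eq_sym s0 s1; lra.
Qed.

Lemma al_pos i e : (i < n)%N -> (e < 2)%N -> al i (pos i e) = pt (vert es i e).
Proof. by move=> hi; case: e => [|[|]] // _ /=; rewrite ?al0 ?al1. Qed.

Lemma end_piece i x y e : (i < n)%N -> stop_ok o i x -> stop_ok o i y ->
  (e < 2)%N -> btw (pos i x) (pos i y) (pos i e) -> vert es i e \in ends es (i, x, y).
Proof.
move=> hi hx hy he hb.
have he' : stop_ok o i e by case: (e) he => [|[|]].
have [px py] := (pos01 hi hx, pos01 hi hy).
have [ex|ey] : pos i e = pos i x \/ pos i e = pos i y.
  case: e he he' hb => [|[|]] // _ _ /orP /=; lra.
- by rewrite /= -(pos_inj hi he' hx ex) he /= mem_head.
- by rewrite /= -(pos_inj hi he' hy ey) he; case: ifP; rewrite /= !inE eqxx ?orbT.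
Qed.

(** A common point is no vertex, by [al_vtx] and the disjoint ends in [sep], so it is the crossing
    of the two edges. It lies strictly inside the first piece because of the shortening, and then
    [sep] puts it strictly inside the second. *)
Lemma hits_diff d i j x y z w s t : (i < n)%N -> (j < n)%N -> i != j ->
  0 < d -> gap d i ->
  piece_ok es o (i, x, y) -> piece_ok es o (j, z, w) ->
  sep es o (i, x, y) (j, z, w) ->
  btw (beg d (i, x, y)) (fin d (i, x, y)) s -> btw (pos j z) (pos j w) t ->
  al i s = al j t ->
  [/\ meet o (i, x, y) (j, z, w), s = tm i j & t = tm j i].
Proof.
move=> hi hj ij d0 hg /and4P[_ hx hy xy] /and4P[_ hz hw zw].
rewrite /sep (negbTE ij) => /andP[/hasPn hV hsep] hs ht e.
have [_ /(_ s hs)[bs sx sy] _] := shrink hi d0 hg hx hy xy.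
have [px py] := (pos01 hi hx, pos01 hi hy).
have [pz pw] := (pos01 hj hz, pos01 hj hw).
have s01 := btw_itv px py bs; have t01 := btw_itv pz pw ht.
case: (end_cases i s01) => [hs1|[a ha sa]]; last first.
  have va := end_piece hi hx hy ha; rewrite -sa in va.
  case: (end_cases j t01) => [ht1|[b hb tb]].
    have := al_vtx hj hi ht1 ha; rewrite -e sa al_pos // eqxx //.
  have vb := end_piece hj hz hw hb; rewrite -tb in vb.
  have := hV _ (va bs); rewrite (_ : vert es i a = vert es j b).
    by rewrite /= -/(ends es (j, z, w)) (vb ht).
  by apply: pt_inj => //; rewrite -!al_pos // -sa -tb.
case: (end_cases j t01) => [ht1|[b hb tb]]; last first.
  by have := al_vtx hi hj hs1 hb; rewrite e tb al_pos // eqxx.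
have [oij sE tE] := tm_uniq hi hj ij hs1 ht1 e; split => //.
have oji : i \in oo j by have [] := o_sym hi oij.
have ho : stop_ok o i j.+2 by [].
have ho' : stop_ok o j i.+2 by [].
have sP : s = pos i j.+2 by [].
have tP : t = pos j i.+2 by [].
have wp : within_op o (i, x, y) (rk o i j.+2).
  have nx : s != pos i x.
    case: (x) sx => [|[|k]] /= h; last exact: h.
      by apply/eqP; lra.
    by apply/eqP; lra.
  have ny : s != pos i y.
    case: (y) sy => [|[|k]] /= h; last exact: h.
      by apply/eqP; lra.
    by apply/eqP; lra.
  have [[f1 [f1E of1 q1 k1]] [f2 [f2E of2 q2 k2]]] := ends_rk hi hx hy bs.
  rewrite /within_op -q1 -q2 !pos_lt // -sP !lt_neqAle k1 k2 !andbT eq_sym.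
  by case: f1E => ->; case: f2E => ->; rewrite ?nx ?ny.
have wq : within_cl o (j, z, w) (rk o j i.+2).
  have [[f1 [f1E of1 q1 k1]] [f2 [f2E of2 q2 k2]]] := ends_rk hj hz hw ht.
  by rewrite /within_cl -q1 -q2 !pos_le // -tP k1 k2.
move: hsep; rewrite -/(oo i) oij wp wq /= => wq'.
by rewrite /meet ij wp -/(oo i) oij.
Qed.

Lemma Ix_pieces d p q : 0 < d -> gap d p.1.1 -> piece_ok es o p ->
  piece_ok es o q -> sep es o p q -> Ix (sub d p) (whole q) = meet o p q.
Proof.
case: p => -[i x] y; case: q => -[j z] w d0 hg hp hq hsep.
have /and4P[hi hx hy xy] := hp; have /and4P[hj hz hw zw] := hq.
have cp := @seg_cont i (beg d (i, x, y)) (fin d (i, x, y)) hi.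
have cq := @seg_cont j (pos j z) (pos j w) hj.
have [ij|ij] := eqVneq i j.
  subst j; rewrite /meet eqxx /=; apply: Ix_disjoint => // s t hs ht.
  have bs := seg_btw (beg d (i, x, y)) (fin d (i, x, y)) hs.
  have bt := seg_btw (pos i z) (pos i w) ht.
  have [_ /(_ _ bs)[bs' _ _] _] := shrink hi d0 hg hx hy xy.
  have [px py] := (pos01 hi hx, pos01 hi hy).
  have [pz pw] := (pos01 hi hz, pos01 hi hw).
  apply/eqP => e; apply: (hits_same hi d0 hg hp hq hsep bs).
  by rewrite (al_inj hi (btw_itv px py bs') (btw_itv pz pw bt) e).
case M : (meet o (i, x, y) (j, z, w)); last first.
  apply: Ix_disjoint => // s t hs ht; apply/eqP => e.
  have [] := hits_diff hi hj ij d0 hg hp hq hsep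
    (seg_btw (beg d (i, x, y)) (fin d (i, x, y)) hs) (seg_btw (pos j z) (pos j w) ht) e.
  by rewrite M.
move/and4P: (M) => [_ oij wp wq]; rewrite -/(oo i) in oij.
have oji : i \in oo j by have [] := o_sym hi oij.
have [nb bI st] := shrink hi d0 hg hx hy xy.
have strict k u v a : (k < n)%N -> stop_ok o k u -> stop_ok o k v -> stop_ok o k a ->
    within_op o (k, u, v) (rk o k a) ->
    pos k u < pos k a < pos k v \/ pos k v < pos k a < pos k u.
  move=> hk hu hv ha; rewrite /within_op /= /minn /maxn.
  case: (ltnP (rk o k u) (rk o k v)) => _ /andP[h1 h2]; [left|right].
    by apply/andP; split; apply: rk_lt.
  by apply/andP; split; apply: rk_lt.
have ho : stop_ok o i j.+2 by [].
have ho' : stop_ok o j i.+2 by [].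
have hs0 := st _ ho (strict _ _ _ _ hi hx hy ho wp).
have ht0 := strict _ _ _ _ hj hz hw ho' wq.
have solve (a b c : R) : a < c < b \/ b < c < a ->
    exists2 u, 0 < u < 1 & a + u * (b - a) = c.
  move=> h; have ba : b - a != 0 by apply/eqP; lra.
  exists ((c - a) / (b - a)); last by rewrite mulfVK //; lra.
  case: h => h.
    by rewrite divr_gt0 ?ltr_pdivrMr; lra.
  by rewrite -mulrNN -invrN divr_gt0 ?ltr_pdivrMr; lra.
have [s1 hs1 sE] := solve _ _ _ hs0; have [t1 ht1 tE] := solve _ _ _ ht0.
have zwn : pos j z != pos j w.
  by apply: contra zw => /eqP/(pos_inj hj hz hw) ->.
have linj (a b u v : R) : a != b -> a + u * (b - a) = a + v * (b - a) -> u = v.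
  move=> ab /addrI/mulIf; apply; apply: contra ab.
  by rewrite subr_eq0 eq_sym.
have [px py] := (pos01 hi hx, pos01 hi hy).
have [pz pw] := (pos01 hj hz, pos01 hj hw).
have i01 u : 0 <= u <= 1 -> 0 <= beg d (i, x, y) + u * (fin d (i, x, y) - beg d (i, x, y)) <= 1.
  move=> hu; have bs := seg_btw (beg d (i, x, y)) (fin d (i, x, y)) hu.
  by have [bs' _ _] := bI _ bs; exact: btw_itv bs'.
have j01 u : 0 <= u <= 1 -> 0 <= pos j z + u * (pos j w - pos j z) <= 1.
  by move=> hu; exact: btw_itv (seg_btw _ _ hu).
have sub_gt (a b u : R) : 0 <= a <= 1 -> 0 <= b <= 1 -> a != b -> 0 < u < 1 ->
    0 < a + u * (b - a) < 1.
  move=> ha hb ab hu; have [h|h] : a < b \/ b < a by move/eqP: ab; lra.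
    by nra.
  by nra.
have b01 : 0 <= beg d (i, x, y) <= 1.
  by have := i01 0; rewrite mul0r addr0; apply; lra.
have f01 : 0 <= fin d (i, x, y) <= 1.
  by have := i01 1; rewrite mul1r addrC subrK; apply; lra.
apply: (@Ix_cross _ (In i) (In j) _ _ s1 t1) => //.
- move=> u v hu hv /(al_inj hi (i01 _ hu) (i01 _ hv)); exact: linj.
- move=> u v hu hv /(al_inj hj (j01 _ hu) (j01 _ hv)); exact: linj.
- by move=> u hu; apply: al_in => //; exact: sub_gt.
- by move=> u hu; apply: al_in => //; exact: sub_gt.
- move=> s t hs ht e.
  have [_ e1 e2] := hits_diff hi hj ij d0 hg hp hq hsep
    (seg_btw (beg d (i, x, y)) (fin d (i, x, y)) hs) (seg_btw (pos j z) (pos j w) ht) e.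
  split; first by apply: linj nb _; rewrite e1 sE.
  by apply: linj zwn _; rewrite e2 tE.
- by rewrite /sub /whole /seg sE tE /= tm_eq.
- by rewrite /sub /seg sE; exact: tm_cross.
Qed.


(** A third edge through the crossing would cross both edges, against [no_triple]. Being compact, it
    leaves a whole neighbourhood free. *)
Lemma avoid_arc i j a : (i < n)%N -> j \in oo i -> (a < n)%N -> a != i -> a != j ->
  nbhs (al i (tm i j)) [set q | forall s, 0 <= s <= 1 -> q <> al a s].
Proof.
move=> hi oij ha ai aj; have [hj _ oji] := o_sym hi oij.
rewrite (_ : [set q | _] = ~` (al a @` `[0, 1])); last first.
  apply/seteqP; split => q /= h.
    by case=> s; rewrite in_itv /= => hs e; apply: (h s hs).
  by move=> s hs e; apply: h; exists s => //=; rewrite in_itv.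
apply: open_nbhs_nbhs; split.
  apply: closed_openC; apply: compact_closed; first exact: norm_hausdorff.
  apply: continuous_compact; last exact: segment_compact.
  by apply: continuous_subspaceT => x; exact: al_cont.
case=> s /=; rewrite in_itv /= => hs e; have t01 := tm01 hi oij.
case: (end_cases a hs) => [hs1|[x hx sx]]; last first.
  by have := al_vtx hi ha t01 hx; rewrite -e sx al_pos // eqxx.
have [oai _ _] := tm_uniq ha hi ai hs1 t01 e.
have := tm_eq hi oij; rewrite -e => e'.
have [oaj _ _] := tm_uniq ha hj aj hs1 (tm01 hj oji) e'.
exact: (no_triple ha oai oaj oij).
Qed.

(** The links of the first trail. At a vertex nothing has been cut off and a constant path suffices;
    at a crossing the link comes from [corner], within a neighbourhood that meets no third edge. *)
Lemma joint p q : piece_ok es o p -> piece_ok es o q -> joint_ok es p q ->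
  exists2 d0, 0 < d0 & forall d, 0 < d -> d <= d0 -> exists k : R -> P,
  [/\ continuous k, k 0 = sub d p 1, k 1 = sub d q 0 &
    forall a u s, (a < n)%N -> 0 <= u <= 1 -> 0 <= s <= 1 -> k u = al a s ->
    [\/ a = p.1.1 /\ s = fin d p, a = q.1.1 /\ s = beg d q |
      exists e, [/\ (e < 2)%N, s = pos a e, (p.2 < 2)%N & vert es a e = vert es p.1.1 p.2]]].
Proof.
case: p => -[i x] y; case: q => -[i' x'] z /and4P[hi hx hy xy] /and4P[hi' hx' hz xz] hj.
have E d : sub d (i, x, y) 1 = al i (fin d (i, x, y)).
  by rewrite /sub /seg mul1r addrC subrK.
have E' d : sub d (i', x', z) 0 = al i' (beg d (i', x', z)).
  by rewrite /sub /seg mul0r addr0.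
have [y2|y2] := ltnP y 2.
  have [x2 vE] : (x' < 2)%N /\ vert es i y = vert es i' x'.
    by case: (y) y2 hj => [|[|]] // _ /andP[? /eqP].
  have fE d : fin d (i, x, y) = pos i y.
    by rewrite /fin; case: (y) y2 => [|[|]] // _; rewrite subr0.
  have bE d : beg d (i', x', z) = pos i' x'.
    by rewrite /beg; case: (x') x2 => [|[|]] // _; rewrite addr0.
  exists 1 => // d _ _; exists (fun=> pt (vert es i y)); split.
  - exact: cont_cst.
  - by rewrite E fE al_pos.
  - by rewrite E' bE al_pos // vE.
  move=> a u s ha hu hs e; case: (end_cases a hs) => [hs1|[w hw sw]].
    by have := al_vtx ha hi hs1 y2; rewrite -e eqxx.
  apply: Or33; exists w; split => //=; apply: pt_inj => //.
  by rewrite -al_pos // -sw e.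
case: y y2 hy xy hj E => [|[|j]] // _ hy xy /andP[/eqP i'E /eqP x'E] E; subst i' x'.
rewrite /= in hy; have {}hy : j \in oo i by [].
have hx'' : i \in oo j by [].
have ij : i != j by have [_ h _] := o_sym hi hy; rewrite eq_sym.
pose N := [set q : P | forall a, a \in [seq a <- iota 0 n | (a != i) && (a != j)] ->
   forall s, 0 <= s <= 1 -> q <> al a s].
have nN : nbhs (al i (tm i j)) N.
  apply: nbhs_seq => a; rewrite mem_filter mem_iota /= add0n.
  by move=> /andP[/andP[ai aj] ha]; exact: avoid_arc.
have [m m0 hm] := corner (al_cont hi) (al_cont hi') (al_inj hi) (al_inj hi')
  (fun s => al_in hi) (fun s => al_in hi') (tm01 hi hy) (tm01 hi' hx'')
  (tm_eq hi hy) (tm_cross hi hy) nN.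
exists m => // d d0 dm.
have dirP p : d * dir p = d \/ d * dir p = - d.
  by case: p => -[? ?] ?; rewrite /dir; case: ifP; [left|right]; rewrite ?mulr1 ?mulrN1.
have sd u : `|d * dir u| <= m.
  by case: (dirP u) => ->; rewrite ?normrN gtr0_norm.
have nd u : d * dir u != 0 by case: (dirP u) => ->; rewrite ?oppr_eq0 gt_eqF.
have [||||k [ck k0 k1 kN [ki kj]]] := hm (fin d (i, x, j.+2)) (beg d (j, i.+2, z)).
- by rewrite /fin -subr_eq0 addrC addKr oppr_eq0 nd.
- by rewrite /beg -subr_eq0 addrC addKr nd.
- by rewrite /fin addrC addKr normrN.
- by rewrite /beg addrC addKr.
exists k; split => //; rewrite ?E ?E' //.
move=> a u s ha hu hs e.
have [ai|ai] := eqVneq a i.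
  by apply: Or31; split => //; apply: ki hu hs _; rewrite e ai.
have [aj|aj] := eqVneq a j.
  by apply: Or32; split => //; apply: kj hu hs _; rewrite e aj.
case: (kN u hu a _ s hs) => //.
by rewrite mem_filter mem_iota ai aj.
Qed.

(** The first chain consists of shortened pieces and links, the second one of whole pieces. Links
    contribute nothing, pieces contribute [meet], so [chain_parity] contradicts the odd [parity]. *)
Theorem odd_pair_false g1 g2 : odd_pair es o g1 g2 -> False.
Proof.
case/and4P => /andP[ok1 /allP j1] /andP[ok2 /allP j2] /allP hsep podd.
pose N1 := size g1; pose N2 := size g2.
pose p1 k := nth dpiece g1 k; pose p2 k := nth dpiece g2 k.
have okp k : (k < N1)%N -> piece_ok es o (p1 k) by move=> hk; apply: (allP ok1); exact: mem_nth.
have okq k : (k < N2)%N -> piece_ok es o (p2 k) by move=> hk; apply: (allP ok2); exact: mem_nth.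
have next N k : (k < N)%N -> (k.+1 %% N < N)%N by move=> hk; rewrite ltn_mod (leq_ltn_trans _ hk).
have [dg dg0 hgap] := gap_ex.
have [|k hk|dk dk0 hdk] := @fin_small R _ (iota 0 N1) (fun k d => forall d', 0 < d' ->
    d' <= d -> exists kk : R -> P,
  [/\ continuous kk, kk 0 = sub d' (p1 k) 1, kk 1 = sub d' (p1 (k.+1 %% N1)%N) 0 &
    forall a u s, (a < n)%N -> 0 <= u <= 1 -> 0 <= s <= 1 -> kk u = al a s ->
    [\/ a = (p1 k).1.1 /\ s = fin d' (p1 k),
        a = (p1 (k.+1 %% N1)%N).1.1 /\ s = beg d' (p1 (k.+1 %% N1)%N) |
      exists e, [/\ (e < 2)%N, s = pos a e, ((p1 k).2 < 2)%N &
        vert es a e = vert es (p1 k).1.1 (p1 k).2]]]).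
- by move=> k d d' d'0 dd h e e0 ed; apply: h => //; exact: le_trans dd.
- have hk1 : (k < N1)%N by rewrite mem_iota in hk.
  apply: joint; [exact: okp|by apply: okp; exact: next|exact: j1].
pose d := Num.min dg dk; have d0 : 0 < d by rewrite lt_min dg0 dk0.
have gapd i : (i < n)%N -> gap d i.
  move=> hi x z hx hz hp; have := hgap i hi x z hx hz hp.
  have : d <= dg by rewrite ge_min lexx.
  by lra.
have dle : d <= dk by rewrite ge_min lexx orbT.
have ex k : exists kk : R -> P, (k < N1)%N ->
  [/\ continuous kk, kk 0 = sub d (p1 k) 1, kk 1 = sub d (p1 (k.+1 %% N1)%N) 0 &
    forall a u s, (a < n)%N -> 0 <= u <= 1 -> 0 <= s <= 1 -> kk u = al a s ->
    [\/ a = (p1 k).1.1 /\ s = fin d (p1 k),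
        a = (p1 (k.+1 %% N1)%N).1.1 /\ s = beg d (p1 (k.+1 %% N1)%N) |
      exists e, [/\ (e < 2)%N, s = pos a e, ((p1 k).2 < 2)%N &
        vert es a e = vert es (p1 k).1.1 (p1 k).2]]].
  have [hk|hk] := ltnP k N1; last by exists (fun=> 0).
  by have [|kk hkk] := hdk k _ d d0 dle; [rewrite mem_iota|exists kk].
have [kk hkk] := choice ex; clear ex hdk.
have C1 : closed_chain ([seq sub d (p1 k) | k <- iota 0 N1] ++
                        [seq kk k | k <- iota 0 N1]).
  apply: (closed_chain_cycle (b := fun k => sub d (p1 k)) (k := kk)) => k hk.
  by have [_ -> ->] := hkk k hk.
have C2 : closed_chain [seq whole (p2 k) | k <- iota 0 N2].
  apply: (closed_chain_cycle0 (b := fun k => whole (p2 k))) => k hk.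
  have := okq _ (next _ _ hk); have := okq _ hk.
  have : joint_ok es (p2 k) (p2 (k.+1 %% N2)%N) by apply: j2; rewrite mem_iota.
  case: (p2 k) => -[i x] y; case: (p2 (k.+1 %% N2)%N) => -[i' x'] z /= hj.
  move=> /and4P[hi hx hy xy] /and4P[hi' hx' hz xz].
  rewrite /seg mul1r mul0r addr0 addrC subrK.
  case: y hj hy xy => [|[|j]] /=.
  + by move=> /andP[x2 /eqP e] _ _; rewrite -[0]/(pos i 0) !al_pos //= -e.
  + by move=> /andP[x2 /eqP e] _ _; rewrite -[1]/(pos i 1) !al_pos //= -e.
  + by move=> /andP[/eqP -> /eqP ->] hy _; rewrite /= tm_eq.
have := chain_parity C1 C2; rewrite big_cat /= [X in _ (+) X]big1_seq ?addbF.
  rewrite big_map => e0.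
  have e1 : \big[addb/false]_(k <- iota 0 N1) \big[addb/false]_(g <-
      [seq whole (p2 k) | k <- iota 0 N2]) Ix (sub d (p1 k)) g = parity o g1 g2.
    rewrite parityE.
    rewrite -[in RHS](mkseq_nth dpiece g1) -[in RHS](mkseq_nth dpiece g2) /mkseq big_map.
    apply: eq_big_seq => k; rewrite mem_iota add0n => /= hk.
    rewrite !big_map; apply: eq_big_seq => l; rewrite mem_iota add0n => /= hl.
    have hsp : sep es o (p1 k) (p2 l).
      by apply: (allP (hsep _ _)); exact: mem_nth.
    apply: Ix_pieces => //; [|exact: okp|exact: okq].
    by apply: gapd; have := okp k hk; case: (p1 k) => -[i x] y /and4P[].
  by rewrite e1 podd in e0.
(* A link meets the edges only at the ends of the two shortened pieces that it joins, or at their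
   common vertex. In each case [sep] keeps the second trail away. *)
move=> b /andP[_ /mapP[k]]; rewrite mem_iota add0n => /= hk ->.
apply: big1_seq => g /andP[_ /mapP[l]]; rewrite mem_iota add0n => /= hl ->.
have [ck _ _ hh] := hkk k hk.
have oq := okq l hl; have op := okp k hk; have op' := okp _ (next _ _ hk).
have sp : sep es o (p1 k) (p2 l) by apply: (allP (hsep _ _)); exact: mem_nth.
have sp' : sep es o (p1 (k.+1 %% N1)%N) (p2 l).
  by apply: (allP (hsep _ _)); apply: mem_nth => //; exact: next.
case: (p2 l) oq sp sp' => -[j z] w oq sp sp'.
have /and4P[hj hz hw zw] := oq.
apply: Ix_disjoint => //; first exact: seg_cont.
move=> u t hu ht; apply/eqP => e.
have bt := seg_btw (pos j z) (pos j w) ht.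
have t01 := btw_itv (pos01 hj hz) (pos01 hj hw) bt.
case: (hh j u _ hj hu t01 e).
- case: (p1 k) op sp => -[i x] y op1 sp1 [/= ij tE]; subst i.
  have hg := gapd j hj.
  apply: (hits_same hj d0 hg op1 oq sp1 _ bt).
  by rewrite tE btwR.
- case: (p1 (k.+1 %% N1)%N) op' sp' => -[i x] y op1 sp1 [/= ij tE]; subst i.
  have hg := gapd j hj.
  apply: (hits_same hj d0 hg op1 oq sp1 _ bt).
  by rewrite tE btwL.
- case: (p1 k) op sp => -[i x] y op1 sp1 [e' [/= he' tE y2 vE]].
  have /and4P[hi hx hy xy] := op1.
  have ve := end_piece hj hz hw he'; rewrite -tE in ve.
  have [ij|ij] := eqVneq i j.
    subst i; have hg := gapd j hj.
    apply: (hits_same hj d0 hg op1 oq sp1 _ bt).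
    have fE : fin d (j, x, y) = pos j y.
      by rewrite /fin; case: (y) y2 => [|[|]] // _; rewrite subr0.
    rewrite tE; have -> : pos j e' = pos j y.
      have he : stop_ok o j e' by case: (e') he' => [|[|]].
      by apply: (al_inj hj); rewrite ?pos01 // !al_pos // vE.
    by rewrite -fE btwR.
  move: sp1; rewrite /sep (negbTE ij) => /andP[/hasPn h _].
  have yin : vert es i y \in ends es (i, x, y).
    by rewrite /= y2; case: ifP => _; rewrite /= !inE eqxx ?orbT.
  by have /negP := h _ yin; apply; rewrite -vE; exact: (ve bt).
Qed.

End Trails.

(** * The possible orders of the crossings along the edges *)

Section Orders.
Local Open Scope nat_scope.
Variables (es cs : seq (nat * nat)).

Definition partners i :=
  [seq j <- iota 0 (size es) | (j != i) && (((i, j) \in cs) || ((j, i) \in cs))].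

Fixpoint all_choices (T : Type) (l : seq (seq T)) : seq (seq T) :=
  if l is s :: l' then [seq x :: r | x <- s, r <- all_choices l'] else [:: [::]].

Definition orders := all_choices [seq permutations (partners i) | i <- iota 0 (size es)].

Definition no_triangle := all (fun i => all (fun j => all (fun k =>
  k \notin partners j) (partners i)) (partners i)) (iota 0 (size es)).

Lemma partnersP i j : j \in partners i ->
  [/\ j < size es, j != i & (i < size es -> i \in partners j)].
Proof.
rewrite mem_filter mem_iota add0n => /andP[/andP[ji h] hj]; split => // hi.
by rewrite mem_filter mem_iota add0n hi eq_sym ji orbC h.
Qed.

Lemma mem_all_choices (T : eqType) (l : seq (seq T)) (s : seq T) x0 :
  size s = size l -> (forall i, i < size l -> nth x0 s i \in nth [::] l i) ->
  s \in all_choices l.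
Proof.
elim: l s => [|a l IH] [|y s] //= [e] h.
by apply/allpairsP; exists (y, s); split => //=; [exact: (h 0)|apply: IH => // i;
  exact: (h i.+1)].
Qed.

Lemma mem_orders o : size o = size es ->
  (forall i, i < size es -> perm_eq (nth [::] o i) (partners i)) -> o \in orders.
Proof.
move=> so h; apply: (mem_all_choices (x0 := [::])); first by rewrite size_map size_iota.
move=> i; rewrite size_map size_iota => hi.
by rewrite (nth_map 0) ?size_iota // nth_iota // mem_permutations h.
Qed.

End Orders.

(** * Arcs and crossings in a good drawing *)

Section GoodDrawing.
Variables (R : realType) (G : sgraph) (D : drawing R G).
Notation P := (R * R)%type.
Hypothesis gD : good_drawing D.

Definition edge_of (x y : G) : {set G} := [set x; y]%SET.

Lemma edge_ofC x y : edge_of x y = edge_of y x.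
Proof. by rewrite /edge_of finset.setUC. Qed.

Lemma edge_of_edges x y : adj x y -> edge_of x y \in edges G.
Proof.
move=> xy; rewrite inE; apply/existsP; exists x; apply/existsP; exists y.
by rewrite xy /=.
Qed.

Definition crosses (e f : {set G}) : bool :=
  `[< (inner (darc D e) `&` inner (darc D f)) !=set0 >].

Lemma crossesC e f : crosses e f = crosses f e.
Proof. by rewrite /crosses setIC. Qed.

(** Clamping the parameter gives continuity on the whole line, and reversing it if necessary makes
    the arc run from [x] to [y]. *)
Lemma edge_arc x y : adj x y -> exists a : R -> P,
  [/\ continuous a, inj01 a, a 0 = dpoint D x, a 1 = dpoint D y &
      forall q, inner (darc D (edge_of x y)) q <-> exists2 s, 0 < s < 1 & a s = q].
Proof.
move=> xy; have eE := edge_of_edges xy; set e := edge_of x y in eE *.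
have xNy : x != y by apply: contraTneq xy => ->; rewrite adj_irr.
pose c (t : R) := clamp 0 1 t.
have c01 t : 0 <= c t <= 1 by apply: clamp_itv; rewrite ler01.
have cE t : 0 <= t <= 1 -> c t = t by exact: clamp_id.
have cont_arc (f : R -> R) : continuous f -> (forall t, 0 <= f t <= 1) ->
    continuous (fun t => darc D e (f t)).
  move=> cf f01.
  apply: (cont_within_comp (A := `[0, 1] : set R) (S := darc D e) (f := f)
    (@darc_cont _ _ D _ eE) cf).
  by move=> t /=; rewrite in_itv /=.
have cc : continuous c by exact: cont_clamp.
have inj := good_self gD eE.
have einj s t : 0 <= s <= 1 -> 0 <= t <= 1 -> darc D e s = darc D e t -> s = t.
  by move=> hs ht; apply: inj; rewrite in_itv /=.
have ends := @darc_ends _ _ D _ eE.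
have : [set darc D e 0; darc D e 1] = [set dpoint D x; dpoint D y].
  rewrite ends; apply/seteqP; split => q /=.
    by case=> z; rewrite !inE => /orP[/eqP ->|/eqP ->] <-; [left|right].
  by case=> ->; [exists x|exists y] => //; rewrite !inE eqxx ?orbT.
move=> /seteqP[s1 s2].
have pxy : dpoint D x != dpoint D y.
  by apply: contra xNy => /eqP/(@dpoint_inj _ _ D) ->.
have [h0|h0] := s1 _ (or_introl erefl); have [h1|h1] := s1 _ (or_intror erefl).
- by exfalso; have := einj 0 1; rewrite h0 h1 => h; have := h _ _ erefl; lra.
- exists (fun t => darc D e (c t)); split.
  + exact: cont_arc.
  + by move=> s t hs ht; rewrite !cE //; exact: einj.
  + by rewrite cE ?lexx ?ler01.
  + by rewrite cE ?lexx ?ler01.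
  + move=> q; split => [[t /= ht <-]|[t ht <-]].
      by exists t => //; rewrite cE //; lra.
    by exists (c t) => //=; rewrite cE //; lra.
- exists (fun t => darc D e (1 - c t)); split.
  + apply: (cont_arc (fun t => 1 - c t)).
      by apply: contB => //; exact: cont_cst.
    by move=> t; have := c01 t; lra.
  + move=> s t hs ht; rewrite !cE // => /einj h; have := h _ _; lra.
  + by rewrite cE ?lexx ?ler01 // subr0.
  + by rewrite cE ?lexx ?ler01 // subrr.
  + move=> q; split => [[t /= ht <-]|[t ht <-]].
      by exists (1 - t); rewrite ?cE ?subKr //; lra.
    by exists (1 - c t) => //=; rewrite cE //; lra.
- by exfalso; have := einj 0 1; rewrite h0 h1 => h; have := h _ _ erefl; lra.
Qed.

Definition arc_of (x y : G) : R -> P :=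
  if pselect (adj x y) is left h then sval (cid (edge_arc h)) else fun=> 0.

Lemma arc_ofP x y : adj x y ->
  [/\ continuous (arc_of x y), inj01 (arc_of x y), arc_of x y 0 = dpoint D x,
      arc_of x y 1 = dpoint D y &
      forall q, inner (darc D (edge_of x y)) q <->
        exists2 s, 0 < s < 1 & arc_of x y s = q].
Proof.
by move=> xy; rewrite /arc_of; case: pselect => // h; exact: (svalP (cid (edge_arc h))).
Qed.

Lemma arc_inner x y s : adj x y -> 0 < s < 1 ->
  inner (darc D (edge_of x y)) (arc_of x y s).
Proof. by move=> /arc_ofP[_ _ _ _ h] hs; apply/h; exists s. Qed.

Lemma arc_vertex x y s z : adj x y -> 0 < s < 1 -> arc_of x y s != dpoint D z.
Proof.
move=> xy hs; apply/eqP => e; apply: (@darc_vertex _ _ D _ z (edge_of_edges xy)).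
by rewrite -e; exact: arc_inner.
Qed.

Lemma end01 (s : R) : 0 <= s <= 1 -> [\/ s = 0, s = 1 | 0 < s < 1].
Proof.
move=> hs; have [->|s0] := eqVneq s 0; first by apply: Or31.
have [->|s1] := eqVneq s 1; first by apply: Or32.
by apply: Or33; rewrite !lt_neqAle [0 == s]eq_sym s0 s1; lra.
Qed.

Lemma Ix_arcs x y z w : adj x y -> adj z w -> x != z -> x != w -> y != z -> y != w ->
  Ix (arc_of x y) (arc_of z w) = crosses (edge_of x y) (edge_of z w).
Proof.
move=> xy zw xz xw yz yw.
have [ca ia a0 a1 ha] := arc_ofP xy; have [cb ib b0 b1 hb] := arc_ofP zw.
have ne : edge_of x y != edge_of z w.
  apply/eqP => /setP/(_ x); rewrite !inE eqxx (negbTE xz) (negbTE xw) //.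
have eE := edge_of_edges xy; have fE := edge_of_edges zw.
have dne u v : u != v -> dpoint D u != dpoint D v.
  by apply: contra => /eqP/(@dpoint_inj _ _ D) ->.
have meetin s t : 0 <= s <= 1 -> 0 <= t <= 1 -> arc_of x y s = arc_of z w t ->
    0 < s < 1 /\ 0 < t < 1.
  move=> hs ht e.
  have hv : 0 < s < 1 \/ exists2 v, v = x \/ v = y & arc_of x y s = dpoint D v.
    by case: (end01 hs) => [->|->|]; [right; exists x|right; exists y|left]; auto.
  have hw : 0 < t < 1 \/ exists2 v, v = z \/ v = w & arc_of z w t = dpoint D v.
    by case: (end01 ht) => [->|->|]; [right; exists z|right; exists w|left]; auto.
  case: hv hw => [hs'|[v vE sE]] [ht'|[u uE tE]] //; exfalso.
  - by have := arc_vertex u xy hs'; rewrite e tE eqxx.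
  - by have := arc_vertex v zw ht'; rewrite -e sE eqxx.
  - have := @dpoint_inj _ _ D v u; rewrite -sE -tE => /(_ e) vu.
    by move: xz xw yz yw; case: vE uE => <- [] <-; rewrite vu eqxx.
case E : (crosses _ _).
  move/asboolP: E => [q [iq jq]].
  have [s hs sE] := (ha q).1 iq; have [t ht tE] := (hb q).1 jq.
  apply: (Ix_cross (s0 := s) (t0 := t) ca cb ia ib
    (fun u => arc_inner xy) (fun u => arc_inner zw)) => //.
  - move=> u v hu hv e; have [hu' hv'] := meetin u v hu hv e.
    have qE : arc_of x y u = q.
      apply: (good_once gD eE fE ne) => //; split; first exact: arc_inner.
      by rewrite e; exact: arc_inner.
    split; first by apply: ia; rewrite ?qE ?sE //; lra.
    by apply: ib; rewrite -?e ?qE ?tE //; lra.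
  - by rewrite sE tE.
  - by rewrite sE; apply: (good_cross gD).
apply: Ix_disjoint => // s t hs ht; apply/eqP => e.
have [hs' ht'] := meetin s t hs ht e.
move/negP: E; apply; apply/asboolP; exists (arc_of x y s); split; first exact: arc_inner.
by rewrite e; exact: arc_inner.
Qed.

Definition cyclic (xs : seq G) (x0 : G) : Prop :=
  forall i, (i < size xs)%N -> adj (nth x0 xs i) (nth x0 xs (i.+1 %% size xs)).

Lemma cycles_parity (x0 : G) (xs ys : seq G) : cyclic xs x0 -> cyclic ys x0 ->
  ~~ has (mem ys) xs ->
  \big[addb/false]_(i <- iota 0 (size xs)) \big[addb/false]_(j <- iota 0 (size ys))
    crosses (edge_of (nth x0 xs i) (nth x0 xs (i.+1 %% size xs)))
            (edge_of (nth x0 ys j) (nth x0 ys (j.+1 %% size ys))) = false.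
Proof.
move=> cx cy /hasPn dis.
have next N k : (k < N)%N -> (k.+1 %% N < N)%N.
  by move=> hk; rewrite ltn_mod (leq_ltn_trans _ hk).
pose f (zs : seq G) k := arc_of (nth x0 zs k) (nth x0 zs (k.+1 %% size zs)).
have C zs : cyclic zs x0 -> closed_chain [seq f zs k | k <- iota 0 (size zs)].
  move=> cz; apply: closed_chain_cycle0 => k hk; rewrite /f.
  have [_ _ _ -> _] := arc_ofP (cz k hk).
  by have [_ _ -> _ _] := arc_ofP (cz _ (next _ _ hk)).
have := chain_parity (C _ cx) (C _ cy); rewrite big_map => e0.
rewrite -[RHS]e0; clear e0.
apply: eq_big_seq => i; rewrite mem_iota add0n => /= hi.
rewrite big_map; apply: eq_big_seq => j; rewrite mem_iota add0n => /= hj.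
have ne k l : (k < size xs)%N -> (l < size ys)%N -> nth x0 xs k != nth x0 ys l.
  move=> hk hl; apply/eqP => e; have := dis _ (mem_nth x0 hk).
  by rewrite e /= mem_nth.
by rewrite Ix_arcs ?ne ?next //; [exact: cx|exact: cy].
Qed.

Variables (es : seq (nat * nat)) (cs : seq (nat * nat)) (v : nat -> G).
Let n := size es.
Let a i := (nth (0, 0)%N es i).1.
Let b i := (nth (0, 0)%N es i).2.
Let ed i := edge_of (v (a i)) (v (b i)).

Hypotheses
  (es_adj : forall i, (i < n)%N -> adj (v (a i)) (v (b i)))
  (v_inj : forall i j x y, (i < n)%N -> (j < n)%N -> (x < 2)%N -> (y < 2)%N ->
     v (vert es i x) = v (vert es j y) -> vert es i x = vert es j y)
  (ed_inj : forall i j, (i < n)%N -> (j < n)%N -> i != j -> ed i != ed j)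
  (csP : forall i j, (i < n)%N -> (j < n)%N -> i != j ->
     crosses (ed i) (ed j) = (j \in partners es cs i))
  (cs_tri : no_triangle es cs).

(** Sorting the partners of every edge by the parameters of the crossings yields the order that
    actually occurs. The parameters are distinct: two crossings of one edge at the same point would
    make three pairwise crossing edges. *)
Lemma refute_orders : (forall o, o \in orders es cs -> exists2 g : seq piece * seq piece,
  odd_pair es o g.1 g.2 & True) -> False.
Proof.
pose al i := arc_of (v (a i)) (v (b i)).
have alP i : (i < n)%N -> _ := fun hi => arc_ofP (es_adj hi).
have tmE i j : exists s : R, (i < n)%N -> j \in partners es cs i ->
    0 < s < 1 /\ inner (darc D (ed j)) (al i s).
  have [hi|hi] := ltnP i n; last by exists 0.
  case hj : (j \in partners es cs i); last by exists 0.
  have [jn ji _] := partnersP hj.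
  have : crosses (ed i) (ed j) by rewrite csP // eq_sym.
  move=> /asboolP[q [q1 q2]]; have [_ _ _ _ h] := alP i hi.
  by have [s hs sE] := (h q).1 q1; exists s => _ _; split=> //; rewrite /al sE.
have [tm0 tm0P] := choice (fun ij : nat * nat => tmE ij.1 ij.2).
pose tm i j := tm0 (i, j).
have tmP i j : (i < n)%N -> j \in partners es cs i ->
    0 < tm i j < 1 /\ inner (darc D (ed j)) (al i (tm i j)).
  exact: (tm0P (i, j)).
have ain i s : (i < n)%N -> 0 < s < 1 -> inner (darc D (ed i)) (al i s).
  by move=> hi hs; exact: arc_inner (es_adj hi) hs.
have eE i : (i < n)%N -> ed i \in edges G by move=> hi; apply: edge_of_edges; exact: es_adj.
have once i j p q : (i < n)%N -> (j < n)%N -> i != j ->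
    inner (darc D (ed i)) p -> inner (darc D (ed j)) p ->
    inner (darc D (ed i)) q -> inner (darc D (ed j)) q -> p = q.
  by move=> hi hj ij *; apply: (good_once gD (eE _ hi) (eE _ hj) (ed_inj hi hj ij)).
have cr i j p : (i < n)%N -> (j < n)%N -> i != j ->
    inner (darc D (ed i)) p -> inner (darc D (ed j)) p -> j \in partners es cs i.
  by move=> hi hj ij h1 h2; rewrite -csP //; apply/asboolP; exists p.
have tri i j k : (i < n)%N -> j \in partners es cs i -> k \in partners es cs i ->
    k \in partners es cs j -> False.
  move=> hi hj hk hkj; move/allP: cs_tri => /(_ i); rewrite mem_iota => /(_ hi).
  by move=> /allP/(_ j hj)/allP/(_ k hk); rewrite hkj.
have tm_inj i j k : (i < n)%N -> j \in partners es cs i -> k \in partners es cs i ->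
    tm i j = tm i k -> j = k.
  move=> hi hj hk e; apply/eqP/negPn/negP => jk.
  have [jn ji _] := partnersP hj; have [kn ki _] := partnersP hk.
  have [h1 h2] := tmP i j hi hj; have [h3 h4] := tmP i k hi hk.
  by apply: (tri i j k) => //; apply: (cr _ _ _ jn kn jk h2); rewrite e.
pose o := [seq sort (fun j k => tm i j <= tm i k) (partners es cs i) | i <- iota 0 n].
have oE i : (i < n)%N -> nth [::] o i = sort (fun j k => tm i j <= tm i k) (partners es cs i).
  by move=> hi; rewrite (nth_map 0%N) ?size_iota // nth_iota.
have oO : o \in orders es cs.
  apply: mem_orders; first by rewrite size_map size_iota.
  by move=> i hi; rewrite oE // perm_sort.
have oM i j : (i < n)%N -> (j \in nth [::] o i) = (j \in partners es cs i).
  by move=> hi; rewrite oE // mem_sort.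
move=> /(_ o oO)[g hg _].
apply: (@odd_pair_false R es o al (fun k => dpoint D (v k)) tm
  (fun i => inner (darc D (ed i))) _ _ _ _ _ _ _ _ _ _ _ _ _ _ g.1 g.2 hg).
- by move=> i hi; have [] := alP i hi.
- by move=> i hi; have [] := alP i hi.
- by move=> i hi; have [] := alP i hi.
- by move=> i hi; have [] := alP i hi.
- exact: ain.
- by move=> i j s x hi hj hs hx; apply: arc_vertex => //; exact: es_adj.
- by move=> i j x y hi hj hx hy /(@dpoint_inj _ _ D); exact: v_inj.
- move=> i j hi; rewrite oM // => /partnersP[hj ji h]; split => //.
  by rewrite oM //; exact: h.
- by move=> i j hi; rewrite oM // => /(tmP _ _ hi)[].
- move=> i j hi; rewrite oM // => hij; have [hj ji h] := partnersP hij.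
  have [h1 h2] := tmP _ _ hi hij; have [h3 h4] := tmP _ _ hj (h hi).
  by apply: (once i j) => //; [rewrite eq_sym|exact: ain|exact: ain].
- move=> i j hi; rewrite oM // => hij; have [hj ji h] := partnersP hij.
  have [h1 h2] := tmP _ _ hi hij.
  apply: (good_cross gD) => //; [exact: eE|exact: eE| |].
    by apply: ed_inj => //; rewrite eq_sym.
  by split => //; exact: ain.
- move=> i j s t hi hj ij hs ht e.
  have h1 := ain i s hi hs; have h2 := ain j t hj ht; rewrite -e in h2.
  have hij := cr i j _ hi hj ij h1 h2; have [_ _ /(_ hi) hji] := partnersP hij.
  have [u1 u2] := tmP _ _ hi hij; have [w1 w2] := tmP _ _ hj hji.
  rewrite oM //; split => //.
    have [_ ii _ _ _] := alP i hi; apply: ii; [lra|lra|].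
    by apply: (once i j) => //; exact: ain.
  have [_ ij' _ _ _] := alP j hj; apply: ij'; [lra|lra|].
  by rewrite -/(al j t) -e; apply: (once i j) => //; exact: ain.
- move=> i j k hi; rewrite [j \in _]oM // => hj.
  by have [jn _ _] := partnersP hj; rewrite !oM //; exact: (tri i j k).
- move=> i j k hi; rewrite !oM // => hj hk; rewrite oE // => hlt.
  have st : sorted (fun j k => tm i j <= tm i k)
      (sort (fun j k => tm i j <= tm i k) (partners es cs i)).
    by apply: sort_sorted => x y; exact: le_total.
  have tr : transitive (fun j k => tm i j <= tm i k).
    by move=> x y z; exact: le_trans.
  have := sorted_ltn_index tr st; rewrite lt_neqAle => /(_ j k).
  rewrite !mem_sort => /(_ hj hk hlt) ->; rewrite andbT.
  apply/eqP => /(tm_inj i j k hi hj hk) jk; by rewrite jk ltnn in hlt.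
Qed.

End GoodDrawing.

(** * Forbidden crossing patterns *)

Section Patterns.
Local Open Scope nat_scope.
Variables (es cs : seq (nat * nat)).

Definition incident (e f : nat * nat) :=
  [|| e.1 == f.1, e.1 == f.2, e.2 == f.1 | e.2 == f.2].

Definition same_edge (e f : nat * nat) :=
  ((e.1 == f.1) && (e.2 == f.2)) || ((e.1 == f.2) && (e.2 == f.1)).

Let e_ i := nth (0, 0) es i.

Definition pattern_ok m :=
  all (fun e => (e.1 < m) && (e.2 < m)) es &&
  all (fun i => all (fun j => (j != i) ==> ~~ same_edge (e_ i) (e_ j) &&
        (incident (e_ i) (e_ j) ==> (j \notin partners es cs i)))
    (iota 0 (size es))) (iota 0 (size es)).

Definition refuted (gs : seq (seq piece * seq piece)) :=
  no_triangle es cs && all (fun o => has (fun g => odd_pair es o g.1 g.2) gs)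
    (orders es cs).

End Patterns.

Section Forbidden.
Variables (R : realType) (G : sgraph) (D : drawing R G).
Hypothesis gD : good_drawing D.

Definition cross2 (a b c d : G) : bool := crosses D (edge_of a b) (edge_of c d).

Lemma edge_of_eq (a b c d : G) : edge_of a b = edge_of c d ->
  (a == c) && (b == d) || (a == d) && (b == c).
Proof.
move=> /setP e; have := e a; have := e b; have := e c; have := e d.
rewrite !inE !eqxx /= !orbT.
rewrite (eq_sym c a) (eq_sym d a) (eq_sym c b) (eq_sym d b).
by case: (a == c); case: (a == d); case: (b == c); case: (b == d).
Qed.

Lemma cross2_incident a b c d : adj a b -> adj c d -> edge_of a b != edge_of c d ->
  [|| a == c, a == d, b == c | b == d] -> cross2 a b c d = false.
Proof.
move=> ab cd ne h; apply/asboolF => -[p].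
rewrite (good_incident gD (edge_of_edges ab) (edge_of_edges cd) ne) //.
by apply/set0Pn; case/or4P: h => /eqP h; [exists a|exists a|exists b|exists b];
  rewrite !inE ?h eqxx ?orbT.
Qed.

(* [es] lists the edges of the configuration, [cs] the pairs of its edges that
   cross, and [gs] contains for every order of the crossings along the edges two
   closed curves that cross an odd number of times. *)
Lemma no_pattern (x0 : G) (vs : seq G) es cs gs :
  uniq vs -> pattern_ok es cs (size vs) -> refuted es cs gs ->
  all (fun e => adj (nth x0 vs e.1) (nth x0 vs e.2)) es ->
  all (fun i => all (fun j => let e := nth (0, 0)%N es i in let f := nth (0, 0)%N es j in
    incident e f || (cross2 (nth x0 vs e.1) (nth x0 vs e.2) (nth x0 vs f.1)
      (nth x0 vs f.2) == (j \in partners es cs i))) (iota i.+1 (size es - i.+1)))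
    (iota 0 (size es)) -> False.
Proof.
move=> vs_uniq /andP[/allP h1 /allP h2] /andP[tri /allP ref] /allP hadj /allP hp.
pose v k := nth x0 vs k.
have in_es i : (i < size es)%N -> nth (0, 0)%N es i \in es by exact: mem_nth.
have lt1 i : (i < size es)%N -> ((nth (0, 0)%N es i).1 < size vs)%N.
  by move=> /in_es/h1/andP[].
have lt2 i : (i < size es)%N -> ((nth (0, 0)%N es i).2 < size vs)%N.
  by move=> /in_es/h1/andP[].
have pr i j : (i < size es)%N -> (j < size es)%N -> j != i ->
    ~~ same_edge (nth (0, 0)%N es i) (nth (0, 0)%N es j) &&
    (incident (nth (0, 0)%N es i) (nth (0, 0)%N es j) ==> (j \notin partners es cs i)).
  move=> hi hj ji; have hi' : i \in iota 0 (size es) by rewrite mem_iota.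
  by have /allP/(_ j) := h2 i hi'; rewrite mem_iota => /(_ hj)/implyP; apply.
have vE k l : (k < size vs)%N -> (l < size vs)%N -> (v k == v l) = (k == l).
  by move=> hk hl; rewrite /v nth_uniq.
have ne i j : (i < size es)%N -> (j < size es)%N -> i != j ->
    edge_of (v (nth (0, 0)%N es i).1) (v (nth (0, 0)%N es i).2) !=
    edge_of (v (nth (0, 0)%N es j).1) (v (nth (0, 0)%N es j).2).
  move=> hi hj ij; apply/eqP => /edge_of_eq; rewrite !vE ?lt1 ?lt2 // => h.
  by have := pr i j hi hj; rewrite eq_sym ij => /(_ isT)/andP[]; rewrite /same_edge h.
have ha i : (i < size es)%N -> adj (v (nth (0, 0)%N es i).1) (v (nth (0, 0)%N es i).2).
  by move=> /in_es/hadj.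
have part_sym i j : (i < size es)%N -> (j < size es)%N ->
    (j \in partners es cs i) = (i \in partners es cs j).
  move=> hi hj; apply/idP/idP => /partnersP[_ _ h]; exact: h.
have cP i j : (i < size es)%N -> (j < size es)%N -> i != j ->
    crosses D (edge_of (v (nth (0, 0)%N es i).1) (v (nth (0, 0)%N es i).2))
     (edge_of (v (nth (0, 0)%N es j).1) (v (nth (0, 0)%N es j).2)) =
    (j \in partners es cs i).
  wlog ij : i j / (i < j)%N => [W hi hj ij|hi hj nij].
    have [ltij|ltji|e] := ltngtP i j; first exact: W.
      by rewrite crossesC W // 1?eq_sym //; exact: part_sym.
    by rewrite e eqxx in ij.
  have hi' : i \in iota 0 (size es) by rewrite mem_iota.
  have /allP/(_ j) := hp i hi'.
  rewrite mem_iota ij subnKC // hj => /(_ isT) /= /orP[inc|/eqP //].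
  have := pr i j hi hj; rewrite eq_sym nij inc => /(_ isT)/andP[_ /=].
  move/negbTE => ->; apply: cross2_incident; [exact: ha|exact: ha|exact: ne|].
  by rewrite !vE ?lt1 ?lt2.
apply: (@refute_orders _ _ D gD es cs v) => //.
- move=> i j x y hi hj hx hy /eqP; rewrite vE; first by move/eqP.
    by case: x hx => [|[|]] // _; rewrite ?lt1 ?lt2.
  by case: y hy => [|[|]] // _; rewrite ?lt1 ?lt2.
- by move=> o /ref/hasP[g _ hg]; exists g.
Qed.

(** The crossing of [b c] and [d a] splits the cycle into two closed curves, one through [a b] and
    one through [c d]. Both turn at that crossing, so these two edges give their only proper
    crossing. *)
Lemma no_crossed_C4 a b c d : adj a b -> adj b c -> adj c d -> adj d a ->
  uniq [:: a; b; c; d] -> ~~ (cross2 a b c d && cross2 b c d a).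
Proof.
move=> ab bc cd da u; apply/negP => /andP[h1 h2].
apply: (@no_pattern a [:: a; b; c; d] [:: (0, 1); (1, 2); (2, 3); (3, 0)]%N
  [:: (0, 2); (1, 3)]%N
  [:: ([:: (0, 0, 1); (1, 0, 5); (3, 3, 1)], [:: (2, 0, 1); (3, 0, 3); (1, 5, 1)])]%N u).
- by vm_compute.
- by vm_compute.
- by rewrite /= ab bc cd da.
- by rewrite /= h1 h2.
Qed.

Lemma no_crossed_bowtie v a b c d : adj v a -> adj v b -> adj a b ->
  adj v c -> adj v d -> adj c d -> uniq [:: v; a; b; c; d] ->
  ~~ [&& cross2 v a c d, cross2 v b c d, cross2 a b v c & cross2 a b v d].
Proof.
move=> va vb ab vc vd cd u; apply/negP => /and4P[h1 h2 h3 h4].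
(* The two edges opposite to [v] may cross or not. There are 36 orders in the first case, since each
   of these edges carries three crossings, and 4 in the second. *)
have [h5|/negbTE h5] := boolP (cross2 a b c d).
  apply: (@no_pattern a [:: v; a; b; c; d]
    [:: (0, 1); (0, 2); (1, 2); (0, 3); (0, 4); (3, 4)]%N
    [:: (0, 5); (1, 5); (2, 3); (2, 4); (2, 5)]%N
    [:: ([:: (0, 0, 1); (2, 0, 5); (3, 4, 0)], [:: (5, 0, 4); (2, 7, 5); (3, 4, 1)]);
   ([:: (0, 0, 1); (2, 0, 6); (4, 4, 0)], [:: (5, 1, 4); (2, 7, 6); (4, 4, 1)]);
   ([:: (1, 0, 7); (5, 3, 1); (4, 1, 0)], [:: (1, 1, 7); (5, 3, 4); (2, 7, 1)]);
   ([:: (1, 0, 7); (5, 3, 0); (3, 1, 0)], [:: (1, 1, 7); (5, 3, 4); (2, 7, 1)]);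
   ([:: (1, 0, 7); (5, 3, 0); (3, 1, 0)], [:: (0, 1, 7); (5, 2, 4); (2, 7, 0)]);
   ([:: (1, 0, 1); (2, 1, 5); (3, 4, 0)], [:: (5, 1, 4); (2, 7, 6); (4, 4, 1)])]%N u).
  - by vm_compute.
  - by vm_compute.
  - by rewrite /= va vb ab vc vd cd.
  - by rewrite /= h1 h2 h3 h4 h5.
apply: (@no_pattern a [:: v; a; b; c; d]
  [:: (0, 1); (0, 2); (1, 2); (0, 3); (0, 4); (3, 4)]%N
  [:: (0, 5); (1, 5); (2, 3); (2, 4)]%N
  [:: ([:: (1, 0, 7); (5, 3, 1); (4, 1, 0)],
       [:: (1, 1, 7); (5, 3, 0); (3, 1, 4); (2, 5, 1)]);
   ([:: (0, 0, 1); (2, 0, 6); (4, 4, 0)],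
    [:: (5, 0, 1); (4, 1, 4); (2, 6, 5); (3, 4, 1)])]%N u).
- by vm_compute.
- by vm_compute.
- by rewrite /= va vb ab vc vd cd.
- by rewrite /= h1 h2 h3 h4 h5.
Qed.

(** The pattern fixes all six pairs of disjoint edges. Three edges carry two crossings each, which
    leaves 8 orders. *)
Lemma no_crossed_house a b d e c : adj a b -> adj b d -> adj d e -> adj e a ->
  adj a c -> adj b c -> uniq [:: a; b; d; e; c] ->
  ~~ cross2 a b d e -> ~~ cross2 b d e a ->
  ~~ [&& cross2 a c b d, cross2 a c d e, cross2 b c d e & cross2 b c e a].
Proof.
move=> ab bd de ea ac bc u /negbTE n1 /negbTE n2; apply/negP => /and4P[h1 h2 h3 h4].
rewrite /cross2 crossesC in h1; rewrite /cross2 crossesC in h2.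
rewrite /cross2 crossesC in h3; rewrite /cross2 crossesC in h4.
apply: (@no_pattern a [:: a; b; d; e; c]
  [:: (0, 1); (1, 2); (2, 3); (3, 0); (0, 4); (1, 4)]%N
  [:: (1, 4); (2, 4); (2, 5); (3, 5)]%N
  [:: ([:: (4, 0, 3); (1, 6, 1); (2, 0, 1); (3, 0, 1)],
       [:: (1, 0, 6); (4, 3, 1); (5, 1, 0)]);
   ([:: (1, 0, 1); (2, 0, 7); (5, 4, 0)], [:: (4, 1, 4); (2, 6, 7); (5, 4, 1)]);
   ([:: (0, 0, 1); (1, 0, 1); (2, 0, 6); (4, 4, 0)],
    [:: (4, 1, 4); (2, 6, 7); (5, 4, 1)])]%N u).
- by vm_compute.
- by vm_compute.
- by rewrite /= ab bd de ea ac bc.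
- by rewrite /= n1 n2 /cross2 h1 h2 h3 h4.
Qed.

(** All eight pairs of disjoint edges are fixed. Four edges carry two crossings each, which leaves
    16 orders. *)
Lemma no_crossed_path a b c d e f : adj a b -> adj a c -> adj b c -> adj a d ->
  adj d e -> adj e f -> uniq [:: a; b; c; d; e; f] ->
  ~~ cross2 a b d e -> ~~ cross2 a d e f -> ~~ cross2 b c e f ->
  ~~ [&& cross2 a b e f, cross2 a c d e, cross2 a c e f, cross2 b c a d &
        cross2 b c d e].
Proof.
move=> ab ac bc ad de ef u /negbTE n1 /negbTE n2 /negbTE n3.
apply/negP => /and5P[h1 h2 h3 h4 h5].
apply: (@no_pattern a [:: a; b; c; d; e; f]
  [:: (0, 1); (0, 2); (1, 2); (0, 3); (3, 4); (4, 5)]%N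
  [:: (0, 5); (1, 4); (1, 5); (2, 3); (2, 4)]%N
  [:: ([:: (0, 0, 1); (2, 0, 5); (3, 4, 0)], [:: (5, 0, 3); (1, 7, 6); (4, 3, 1)]);
   ([:: (1, 0, 1); (2, 1, 5); (3, 4, 0)],
    [:: (0, 1, 7); (5, 2, 0); (4, 1, 0); (3, 1, 4); (2, 5, 0)]);
   ([:: (1, 0, 6); (4, 3, 0); (3, 1, 0)], [:: (1, 1, 6); (4, 3, 4); (2, 6, 1)]);
   ([:: (0, 0, 1); (2, 0, 6); (4, 4, 0); (3, 1, 0)],
    [:: (1, 1, 6); (4, 3, 4); (2, 6, 1)])]%N u).
- by vm_compute.
- by vm_compute.
- by rewrite /= ab ac bc ad de ef.
- by rewrite /= n1 n2 n3 h1 h2 h3 h4 h5.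
Qed.

End Forbidden.

(** * Counting deficits *)

Local Notation S := (@ordS 3).

Section Deficits.
Local Open Scope nat_scope.

Lemma ordS3 (i : 'I_3) : S (S (S i)) = i.
Proof. by apply: val_inj; case: i => [[|[|[|]]]]. Qed.

Lemma sum3 (i : 'I_3) (f : 'I_3 -> nat) : \sum_(k < 3) f k = f i + f (S i) + f (S (S i)).
Proof.
have e : \sum_(k < 3) f k = f (inord 0) + f (inord 1) + f (inord 2).
  rewrite !big_ord_recl big_ord0 addn0 addnA.
  by congr (f _ + f _ + f _); apply: val_inj; rewrite /= inordK.
have E (k l : 'I_3) : k = l :> nat -> f k = f l by move=> /val_inj ->.
case: i => -[|[|[|//]]] hi; rewrite e;
  rewrite (E (inord 0) (Ordinal (isT : 0 < 3))) ?inordK //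
    (E (inord 1) (Ordinal (isT : 1 < 3))) ?inordK //
    (E (inord 2) (Ordinal (isT : 2 < 3))) ?inordK //.
- by congr (_ + _ + _); apply: E.
- rewrite (E (S _) (Ordinal (isT : 2 < 3))) // (E (S (S _)) (Ordinal (isT : 0 < 3))) //.
  rewrite (E (Ordinal hi) (Ordinal (isT : 1 < 3))) //; lia.
- rewrite (E (S _) (Ordinal (isT : 0 < 3))) // (E (S (S _)) (Ordinal (isT : 1 < 3))) //.
  rewrite (E (Ordinal hi) (Ordinal (isT : 2 < 3))) //; lia.
Qed.

Lemma oddP n : odd n -> exists k, n = k.*2.+1.
Proof. by move=> h; exists n./2; rewrite -[LHS]odd_double_half h. Qed.

Lemma evenP n : ~~ odd n -> exists k, n = k.*2.
Proof. by move=> h; exists n./2; rewrite -[LHS]odd_double_half (negbTE h). Qed.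

Notation block := ('I_3 -> 'I_3 -> 'I_3 -> nat).
Notation mixed_block := ('I_3 -> 'I_3 -> 'I_3 -> 'I_3 -> nat).

(* The deficits of two parallel triangles that do not lie in a 4-cycle. *)
Definition offdiag (F : block) t j :=
  F t j (S j) + F t j (S (S j)) + F t (S j) j + F t (S j) (S (S j)) +
  F t (S (S j)) j + F t (S (S j)) (S j).

Lemma block_sum (F : block) t j : \sum_(c < 3) \sum_(d < 3) F t c d =
  F t j j + F t (S j) (S j) + F t (S (S j)) (S (S j)) + offdiag F t j.
Proof. by rewrite (sum3 j) !(sum3 j) /offdiag; lia. Qed.

Lemma offdiag_eq0 (F : block) t j : offdiag F t j = 0 ->
  [/\ F t j (S j) = 0 /\ F t j (S (S j)) = 0, F t (S j) j = 0 /\ F t (S j) (S (S j)) = 0 &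
      F t (S (S j)) j = 0 /\ F t (S (S j)) (S j) = 0].
Proof. by rewrite /offdiag => h; do !split; lia. Qed.

Definition mix (M : mixed_block) (r a : 'I_3) : nat :=
  M r (S a) r a + M r (S (S a)) r a + M r a (S r) a + M r a (S (S r)) a + M r a r a.

(* [A i c d] is the deficit of the edges outside columns [c] and [d] of the two
   rows other than [i]; [B] is the same with rows and columns exchanged.
   [M r c s d] is the deficit of the edge of row [r] outside column [c] and the
   edge of column [d] outside row [s], which are disjoint if [r = s] or [c = d].
   [mix M r a] collects the deficits of the edges of row [r] and column [a]. *)
Definition deficits (A B : block) (M : mixed_block) : nat :=
  \sum_(i < 3) \sum_(c < 3) \sum_(d < 3) A i c d +
  \sum_(i < 3) \sum_(c < 3) \sum_(d < 3) B i c d +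
  \sum_(r < 3) \sum_(a < 3) mix M r a.

(** All that the arithmetic needs to know about a drawing to be refuted. Two disjoint triangles have
    9 pairs of edges, hence an odd number of deficits; a triangle and a disjoint 4-cycle have 12
    pairs, hence an even number. *)
Record few_deficits (A B : block) (M : mixed_block) : Prop := FewDeficits {
  square_deficit_ge1 : forall i j, 1 <= A i j j + B j i i;
  bowtie_deficit_ge1 : forall r a, 1 <= M r (S a) r a + M r (S (S a)) r a +
     M r a (S r) a + M r a (S (S r)) a;
  odd_A : forall t, odd (\sum_(c < 3) \sum_(d < 3) A t c d);
  odd_B : forall t, odd (\sum_(c < 3) \sum_(d < 3) B t c d);
  even_row : forall r c, ~~ odd (\sum_(g < 3)
     (A (S (S r)) g c + A (S r) c g + M r g r (S c) + M r g r (S (S c))));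
  even_col : forall r c, ~~ odd (\sum_(g < 3)
     (B (S (S c)) g r + B (S c) r g + M (S r) c g c + M (S (S r)) c g c));
  deficits_le20 : deficits A B M <= 20 }.

Lemma few_deficits_transpose A B M : few_deficits A B M ->
  few_deficits B A (fun r c s d => M d s c r).
Proof.
case=> sq bow oA oB eR eC small.
split=> [i j|r a|||r c|r c|] //; [by rewrite addnC|by have := bow a r; lia|].
move: small; rewrite /deficits (addnC (\sum_(i < 3) \sum_(c < 3) \sum_(d < 3) B i c d)).
suff -> : \sum_(r < 3) \sum_(a < 3) mix (fun r c s d => M d s c r) r a =
  \sum_(r < 3) \sum_(a < 3) mix M r a by [].
rewrite exchange_big; apply: eq_bigr => r _; apply: eq_bigr => a _; rewrite /mix; lia.
Qed.

Section FewDeficits.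
Variables (A B : block) (M : mixed_block).
Hypothesis few : few_deficits A B M.

(* The deficits of the 4-cycle that avoids row [i] and column [j]. *)
Definition cell i j := A i j j + B j i i.

Lemma cell1 i j : 1 <= cell i j. Proof. exact: (square_deficit_ge1 few). Qed.

Lemma mix1 r a : 1 <= mix M r a.
Proof. by rewrite /mix; have := bowtie_deficit_ge1 few r a; lia. Qed.

(* The first sum is even, being the sum of six odd numbers, and at least 9. *)
Lemma excess i j :
  cell i j + cell i (S j) + cell i (S (S j)) +
  (cell (S i) j + cell (S i) (S j) + cell (S i) (S (S j))) +
  (cell (S (S i)) j + cell (S (S i)) (S j) + cell (S (S i)) (S (S j))) +
  (offdiag A i j + offdiag A (S i) j + offdiag A (S (S i)) j) +
  (offdiag B j i + offdiag B (S j) i + offdiag B (S (S j)) i) = 10 /\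
  mix M i j + mix M i (S j) + mix M i (S (S j)) +
  (mix M (S i) j + mix M (S i) (S j) + mix M (S i) (S (S j))) +
  (mix M (S (S i)) j + mix M (S (S i)) (S j) + mix M (S (S i)) (S (S j))) <= 10.
Proof.
have := deficits_le20 few; rewrite /deficits.
rewrite (sum3 i (fun i => \sum_(c < 3) \sum_(d < 3) A i c d)).
rewrite (sum3 j (fun i => \sum_(c < 3) \sum_(d < 3) B i c d)).
rewrite (sum3 i (fun r => \sum_(a < 3) mix M r a)) !(sum3 j (mix M _)).
have [k1 e1] := oddP (odd_A few i); have [k2 e2] := oddP (odd_A few (S i)).
have [k3 e3] := oddP (odd_A few (S (S i))); have [l1 f1] := oddP (odd_B few j).
have [l2 f2] := oddP (odd_B few (S j)); have [l3 f3] := oddP (odd_B few (S (S j))).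
move: e1 e2 e3 f1 f2 f3; rewrite !(block_sum A _ j) !(block_sum B _ i) /cell.
have := mix1 i j; have := mix1 i (S j); have := mix1 i (S (S j)).
have := mix1 (S i) j; have := mix1 (S i) (S j); have := mix1 (S i) (S (S j)).
have := mix1 (S (S i)) j; have := mix1 (S (S i)) (S j); have := mix1 (S (S i)) (S (S j)).
have := cell1 i j; have := cell1 i (S j); have := cell1 i (S (S j)).
have := cell1 (S i) j; have := cell1 (S i) (S j); have := cell1 (S i) (S (S j)).
have := cell1 (S (S i)) j; have := cell1 (S (S i)) (S j); have := cell1 (S (S i)) (S (S j)).
rewrite /cell; lia.
Qed.

Definition rowsum r c := \sum_(g < 3) (A (S (S r)) g c + A (S r) c g).
Definition colsum r c := \sum_(g < 3) (B (S (S c)) g r + B (S c) r g).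

(* The mixed parts of the four parity conditions add up, at each of the four
   vertices of the 4-cycle, to [mix M] plus the deficit counted twice there. *)
Lemma minor r c :
  odd (rowsum r (S (S c)) + rowsum (S r) (S (S c)) +
       colsum (S (S r)) c + colsum (S (S r)) (S c)) ->
  5 <= mix M r c + mix M r (S c) + mix M (S r) c + mix M (S r) (S c).
Proof.
have [k1 e1] := evenP (even_row few r (S (S c))).
have [k2 e2] := evenP (even_row few (S r) (S (S c))).
have [k3 e3] := evenP (even_col few (S (S r)) c).
have [k4 e4] := evenP (even_col few (S (S r)) (S c)).
move=> /oddP[k e]; move: e e1 e2 e3 e4; rewrite /rowsum /colsum.
rewrite !big_split /= !ordS3 !(sum3 c (fun g => M _ g _ _)) !(sum3 r (fun g => M _ _ g _)).
have := bowtie_deficit_ge1 few r c; have := bowtie_deficit_ge1 few r (S c).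
have := bowtie_deficit_ge1 few (S r) c; have := bowtie_deficit_ge1 few (S r) (S c).
rewrite /mix ?ordS3; lia.
Qed.

(** In [excess] the nine 4-cycles already take 9 of the 10 units, so one such deficit exhausts the
    rest. *)
Lemma offdiag_A1 t j : 1 <= offdiag A t j ->
  [/\ offdiag A t j = 1, offdiag A (S t) j = 0 /\ offdiag A (S (S t)) j = 0,
      [/\ offdiag B j t = 0, offdiag B (S j) t = 0 & offdiag B (S (S j)) t = 0] &
      [/\ cell t j = 1 /\ cell t (S j) = 1 /\ cell t (S (S j)) = 1,
          cell (S t) j = 1 /\ cell (S t) (S j) = 1 /\ cell (S t) (S (S j)) = 1 &
          cell (S (S t)) j = 1 /\ cell (S (S t)) (S j) = 1 /\ cell (S (S t)) (S (S j)) = 1]].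
Proof.
have [] := excess t j.
have := cell1 t j; have := cell1 t (S j); have := cell1 t (S (S j)).
have := cell1 (S t) j; have := cell1 (S t) (S j); have := cell1 (S t) (S (S j)).
have := cell1 (S (S t)) j; have := cell1 (S (S t)) (S j); have := cell1 (S (S t)) (S (S j)).
by move=> h1 h2 h3 h4 h5 h6 h7 h8 h9 h _ h0; do !split; lia.
Qed.

(** If one of the entries were 1, the other deficits between parallel edges would be known well
    enough to apply [minor] to three 4-cycles without a common vertex. Each would contain a vertex
    with [mix] above 1, but by [excess] there is at most one such vertex. *)
Lemma offdiag_A0 t j : A t j (S j) = 0 /\ A t j (S (S j)) = 0.
Proof.
suff : ~~ (1 <= A t j (S j) + A t j (S (S j))) by lia.
apply/negP => h; have [|o [n1 n2] [b1 b2 b3]] := @offdiag_A1 t j.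
  by rewrite /offdiag; lia.
rewrite /cell => -[[c1 [c2 c3]] [c4 [c5 c6]] [c7 [c8 c9]]].
have [[p1 p2] [p3 p4] [p5 p6]] := offdiag_eq0 n1.
have [[q1 q2] [q3 q4] [q5 q6]] := offdiag_eq0 n2.
have [[r1 r2] [r3 r4] [r5 r6]] := offdiag_eq0 b1.
have [[s1 s2] [s3 s4] [s5 s6]] := offdiag_eq0 b2.
have [[t1 t2] [t3 t4] [t5 t6]] := offdiag_eq0 b3.
have [[z1 z2] [z3 z4]] : (A t (S j) j = 0 /\ A t (S j) (S (S j)) = 0) /\
    (A t (S (S j)) j = 0 /\ A t (S (S j)) (S j) = 0).
  by move: o h; rewrite /offdiag; clear; lia.
have {}h : A t j (S j) = 1 /\ A t j (S (S j)) = 0 \/ A t j (S j) = 0 /\ A t j (S (S j)) = 1.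
  by move: o h; rewrite /offdiag; clear; lia.
have := odd_A few t; have := odd_A few (S t); have := odd_A few (S (S t)).
have := odd_B few j; have := odd_B few (S j); have := odd_B few (S (S j)).
rewrite !(block_sum A _ j) !(block_sum B _ t) o n1 n2 b1 b2 b3 !addn0.
move=> f3 f2 f1 e3 e2 e1.
have := @minor (S t) (S j); have := @minor (S t) (S (S j)); have := @minor (S (S t)) j.
have := @minor (S t) j; have := @minor (S (S t)) (S (S j)).
rewrite /rowsum /colsum !ordS3 !(sum3 j (fun g => A _ g _ + _)) !(sum3 t (fun g => B _ g _ + _)).
rewrite ?ordS3 p1 p2 p3 p4 p5 p6 q1 q2 q3 q4 q5 q6 r1 r2 r3 r4 r5 r6 s1 s2 s3 s4 s5 s6.
rewrite t1 t2 t3 t4 t5 t6 z1 z2 z3 z4 ?addn0 ?add0n.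
have [_] := excess t j.
have := mix1 t j; have := mix1 t (S j); have := mix1 t (S (S j)).
have := mix1 (S t) j; have := mix1 (S t) (S j); have := mix1 (S t) (S (S j)).
have := mix1 (S (S t)) j; have := mix1 (S (S t)) (S j); have := mix1 (S (S t)) (S (S j)).
move=> m9 m8 m7 m6 m5 m4 m3 m2 m1 mixed i5 i4 i3 i2 i1.
case: h => [[h1 h2]|[h1 h2]]; rewrite h1 h2 in i1 i2 i3 i4 i5.
  have {}i1 := i1 ltac:(clear - e1 e2 e3 f1 f2 f3 c1 c2 c3 c4 c5 c6 c7 c8 c9; lia).
  have {}i2 := i2 ltac:(clear - e1 e2 e3 f1 f2 f3 c1 c2 c3 c4 c5 c6 c7 c8 c9; lia).
  have {}i3 := i3 ltac:(clear - e1 e2 e3 f1 f2 f3 c1 c2 c3 c4 c5 c6 c7 c8 c9; lia).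
  clear - i1 i2 i3 m1 m2 m3 m4 m5 m6 m7 m8 m9 mixed; lia.
have {}i1 := i1 ltac:(clear - e1 e2 e3 f1 f2 f3 c1 c2 c3 c4 c5 c6 c7 c8 c9; lia).
have {}i4 := i4 ltac:(clear - e1 e2 e3 f1 f2 f3 c1 c2 c3 c4 c5 c6 c7 c8 c9; lia).
have {}i5 := i5 ltac:(clear - e1 e2 e3 f1 f2 f3 c1 c2 c3 c4 c5 c6 c7 c8 c9; lia).
clear - i1 i4 i5 m1 m2 m3 m4 m5 m6 m7 m8 m9 mixed; lia.
Qed.

End FewDeficits.

Lemma offdiag_A_eq0 A B M : few_deficits A B M -> forall t j, offdiag A t j = 0.
Proof.
move=> few t j; have [h1 h2] := offdiag_A0 few t j; have [h3 h4] := offdiag_A0 few t (S j).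
by have [h5 h6] := offdiag_A0 few t (S (S j)); rewrite !ordS3 in h4 h5 h6; rewrite /offdiag; lia.
Qed.

Lemma offdiag_B_eq0 A B M : few_deficits A B M -> forall t j, offdiag B t j = 0.
Proof. by move=> /few_deficits_transpose/offdiag_A_eq0. Qed.

(** * A 4-cycle with two deficits *)

Section DoubleCell.
Variables (A B : block) (M : mixed_block).
Hypothesis few : few_deficits A B M.
(** The four house conditions belong to the four sides of a 4-cycle with two deficits, each side
    carrying a triangle. *)
Hypotheses
  (entry_le1 : forall i c d, A i c d <= 1 /\ B i c d <= 1)
  (house1 : forall i j, A i j j + B j i i = 2 ->
     1 <= M (S i) (S j) i (S j) + M (S i) (S (S j)) i (S (S j)) +
          A i (S j) j + A i (S (S j)) j)
  (house2 : forall i j, A i j j + B j i i = 2 ->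
     1 <= M (S (S i)) (S j) i (S j) + M (S (S i)) (S (S j)) i (S (S j)) +
          A i j (S j) + A i j (S (S j)))
  (house3 : forall i j, A i j j + B j i i = 2 ->
     1 <= M (S i) j (S i) (S j) + M (S (S i)) j (S (S i)) (S j) +
          B j (S i) i + B j (S (S i)) i)
  (house4 : forall i j, A i j j + B j i i = 2 ->
     1 <= M (S i) j (S i) (S (S j)) + M (S (S i)) j (S (S i)) (S (S j)) +
          B j i (S i) + B j i (S (S i)))
  (path1 : forall i j x y, (x == S j) && (y == S (S j)) || (x == S (S j)) && (y == S j) ->
     A i j j = 1 -> A i x x = 1 -> M (S (S i)) x i x = 1 ->
     1 <= A i j x + A i y j + A i y x + M (S i) x i x + A i x j)
  (path2 : forall i j x y, (x == S j) && (y == S (S j)) || (x == S (S j)) && (y == S j) ->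
     A i j j = 1 -> A i x x = 1 -> M (S i) x i x = 1 ->
     1 <= A i x j + A i j y + A i x y + M (S (S i)) x i x + A i j x).

Notation cell := (cell A B).

(** [minor] applies to two 4-cycles whose only common vertex is [(i, j)], so this vertex takes the
    whole excess of [mix]. The 4-cycle with two deficits avoids row [i] and column [j]. *)
Lemma mix_double i j : cell i j = 2 ->
  [/\ mix M (S i) (S j) = 1, mix M (S i) (S (S j)) = 1,
      mix M (S (S i)) (S j) = 1 & mix M (S (S i)) (S (S j)) = 1].
Proof.
move=> two; have [pure mixed] := excess few i j.
have nA := offdiag_A_eq0 few; have nB := offdiag_B_eq0 few.
have := odd_A few i; have := odd_A few (S i); have := odd_A few (S (S i)).
have := odd_B few j; have := odd_B few (S j); have := odd_B few (S (S j)).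
rewrite !(block_sum A _ j) !(block_sum B _ i) !nA !nB !addn0 => f3 f2 f1 e3 e2 e1.
have [[p1 p2] [p3 p4] [p5 p6]] := offdiag_eq0 (nA i j).
have [[q1 q2] [q3 q4] [q5 q6]] := offdiag_eq0 (nA (S i) j).
have [[r1 r2] [r3 r4] [r5 r6]] := offdiag_eq0 (nA (S (S i)) j).
have [[s1 s2] [s3 s4] [s5 s6]] := offdiag_eq0 (nB j i).
have [[t1 t2] [t3 t4] [t5 t6]] := offdiag_eq0 (nB (S j) i).
have [[z1 z2] [z3 z4] [z5 z6]] := offdiag_eq0 (nB (S (S j)) i).
have := @minor _ _ _ few i j; have := @minor _ _ _ few (S (S i)) (S (S j)).
rewrite /rowsum /colsum !ordS3 !(sum3 j (fun g => A _ g _ + _)) !(sum3 i (fun g => B _ g _ + _)).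
rewrite ?ordS3 ?p1 ?p2 ?p3 ?p4 ?p5 ?p6 ?q1 ?q2 ?q3 ?q4 ?q5 ?q6 ?r1 ?r2 ?r3 ?r4 ?r5 ?r6.
rewrite ?s1 ?s2 ?s3 ?s4 ?s5 ?s6 ?t1 ?t2 ?t3 ?t4 ?t5 ?t6 ?z1 ?z2 ?z3 ?z4 ?z5 ?z6 ?addn0 ?add0n.
move: pure; rewrite !nA !nB !addn0.
have := cell1 few i j; have := cell1 few i (S j); have := cell1 few i (S (S j)).
have := cell1 few (S i) j; have := cell1 few (S i) (S j); have := cell1 few (S i) (S (S j)).
have := cell1 few (S (S i)) j; have := cell1 few (S (S i)) (S j).
have := cell1 few (S (S i)) (S (S j)).
move=> g9 g8 g7 g6 g5 g4 g3 g2 g1 pure i2 i1.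
have [[c1 c2 c3] [c4 c5 c6] [c7 c8]] :
    [/\ [/\ cell i (S j) = 1, cell i (S (S j)) = 1 & cell (S i) j = 1],
    [/\ cell (S i) (S j) = 1, cell (S i) (S (S j)) = 1 & cell (S (S i)) j = 1] &
    cell (S (S i)) (S j) = 1 /\ cell (S (S i)) (S (S j)) = 1].
  by clear - two pure g1 g2 g3 g4 g5 g6 g7 g8 g9; do !split; lia.
rewrite /cell in two c1 c2 c3 c4 c5 c6 c7 c8.
have {}i1 := i1 ltac:(clear - e1 e2 e3 f1 f2 f3 two c1 c2 c3 c4 c5 c6 c7 c8; lia).
have {}i2 := i2 ltac:(clear - e1 e2 e3 f1 f2 f3 two c1 c2 c3 c4 c5 c6 c7 c8; lia).
have := mix1 few i j; have := mix1 few i (S j); have := mix1 few i (S (S j)).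
have := mix1 few (S i) j; have := mix1 few (S i) (S j); have := mix1 few (S i) (S (S j)).
have := mix1 few (S (S i)) j; have := mix1 few (S (S i)) (S j).
have := mix1 few (S (S i)) (S (S j)).
by clear - i1 i2 mixed => m9 m8 m7 m6 m5 m4 m3 m2 m1; do !split; lia.
Qed.

Lemma no_double_cell i j : cell i j <> 2.
Proof.
move=> two; have [m1 m2 m3 m4] := mix_double two.
have nA := offdiag_A_eq0 few; have nB := offdiag_B_eq0 few.
have [[p1 p2] [p3 p4] [p5 p6]] := offdiag_eq0 (nA i j).
have [[s1 s2] [s3 s4] [s5 s6]] := offdiag_eq0 (nB j i).
have [[z1 z2] [z3 z4] [z5 z6]] := offdiag_eq0 (nB (S (S j)) i).
have h1 := house1 two; have h2 := house2 two; have h3 := house3 two; have h4 := house4 two.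
have pa := @path1 i j (S j) (S (S j)); have pb := @path1 i j (S (S j)) (S j).
have qa := @path2 i j (S j) (S (S j)); have qb := @path2 i j (S (S j)) (S j).
rewrite !eqxx ?orbT /= in pa pb qa qb.
rewrite ?p1 ?p2 ?p3 ?p4 ?p5 ?p6 ?s1 ?s2 ?s3 ?s4 ?s5 ?s6 ?addn0 ?add0n in h1 h2 h3 h4 pa pb qa qb.
have [le1 le2] : A i j j <= 1 /\ B j i i <= 1.
  by split; [case: (entry_le1 i j j)|case: (entry_le1 j i i)].
have [Aj Bj] : A i j j = 1 /\ B j i i = 1 by move: two; rewrite /cell; lia.
have la := (entry_le1 i (S j) (S j)).1; have lb := (entry_le1 i (S (S j)) (S (S j))).1.
have b1 := bowtie_deficit_ge1 few (S i) (S j); have b3 := bowtie_deficit_ge1 few (S (S i)) (S j).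
rewrite /mix ?ordS3 in m1 m2 m3 m4 b1 b3.
(* The four vertices choose, cyclically, one side of the 4-cycle each. *)
have turn : (M (S i) (S j) i (S j) = 1 /\ M (S (S i)) (S j) i (S j) = 0 /\
      M (S i) (S (S j)) i (S (S j)) = 0 /\ M (S (S i)) (S (S j)) i (S (S j)) = 1 /\
      M (S (S i)) j (S (S i)) (S j) = 1) \/
    (M (S i) (S j) i (S j) = 0 /\ M (S (S i)) (S j) i (S j) = 1 /\
      M (S i) (S (S j)) i (S (S j)) = 1 /\ M (S (S i)) (S (S j)) i (S (S j)) = 0 /\
      M (S i) j (S i) (S j) = 1).
  by clear - h1 h2 h3 h4 m1 m2 m3 m4; lia.
(* With either turn, each of these entries being 1 would complete a forbidden path pattern. *)
have [Aa Ab] : A i (S j) (S j) = 0 /\ A i (S (S j)) (S (S j)) = 0.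
  have {}pa := pa isT Aj; have {}pb := pb isT Aj; have {}qa := qa isT Aj; have {}qb := qb isT Aj.
  by clear - turn pa pb qa qb la lb; case: turn => [[e1 [e2 [e3 [e4 _]]]]|[e1 [e2 [e3 [e4 _]]]]];
    rewrite e1 e2 e3 e4 in pa pb qa qb; lia.
have Ba : B (S (S j)) i i = 1.
  have := square_deficit_ge1 few i (S (S j)); have := (entry_le1 (S (S j)) i i).2.
  by rewrite Ab; lia.
(* The triangle in column [S j] and the 4-cycle avoiding it and row [i]: the two column entries are
   1, and the turn makes the mixed part odd. *)
have := even_col few i (S j); rewrite !(sum3 i) ?ordS3.
rewrite Bj Ba ?s1 ?s2 ?s3 ?s4 ?s5 ?s6 ?z1 ?z2 ?z3 ?z4 ?z5 ?z6 ?addn0 ?add0n.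
by clear - turn m1 m3 b1 b3; case: turn => [[e1 [e2 [_ [_ e3]]]]|[e1 [e2 [_ [_ e3]]]]];
  rewrite e1 e2 e3 in m1 m3 b1 b3 *; lia.
Qed.

(** Now every 4-cycle has exactly one deficit and parallel triangles have no others, which makes 9,
    whereas [excess] demands 10. *)
Lemma deficits_gt20 : False.
Proof.
pose o : 'I_3 := ord0.
have cell_le r a : cell r a = 1.
  have := @no_double_cell r a; have := cell1 few r a.
  by have := (entry_le1 r a a).1; have := (entry_le1 a r r).2; rewrite /cell; lia.
by have [] := excess few o o; rewrite !(offdiag_A_eq0 few) !(offdiag_B_eq0 few) !cell_le.
Qed.

End DoubleCell.
End Deficits.

(** * Crossings counted over ordered pairs of edges *)

Section DoubleCount.
Local Open Scope nat_scope.
Variables (R : realType) (G : sgraph) (D : drawing R G).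
Hypothesis gD : good_drawing D.

Lemma crossing_count (e f : {set G}) : e \in edges G -> f \in edges G -> e != f ->
  #|` fset_set (\bigcap_(g in [set` [set e; f]%SET]) inner (darc D g)) | = crosses D e f.
Proof.
move=> eE fE ne; have -> : \bigcap_(g in [set` [set e; f]%SET]) inner (darc D g) =
    (inner (darc D e) `&` inner (darc D f))%classic.
  apply/seteqP; split=> [p h|p [h1 h2] g /=].
    by split; apply: h; rewrite /= !inE eqxx ?orbT.
  by rewrite !inE => /orP[]/eqP->.
rewrite /crosses; case: asboolP => [[p hp]|/nonemptyPn ->]; last by rewrite fset_set0.
suff -> : (inner (darc D e) `&` inner (darc D f))%classic = [set p]%classic.
  by rewrite fset_set1 cardfs1.
apply/seteqP; split=> [q hq|q ->//]; exact: (good_once gD eE fE ne).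
Qed.

(** Ordered pairs replace the two-element sets, so that the sum can be split by rows and columns. *)
Lemma double_crossings : (crossings D).*2 =
  \sum_(e in edges G) \sum_(f in edges G) (e != f) && crosses D e f.
Proof.
pose c e f : nat := (e != f) && crosses D e f.
have -> : (crossings D).*2 = \sum_(P : {set {set G}} | (P \subset edges G) && (#|P| == 2))
    \sum_(e in P) \sum_(f in P) c e f.
  rewrite /crossings -mul2n big_distrr /=; apply: eq_bigr => P /andP[PE /cards2P[e [f]]].
  move=> [ne PE']; rewrite PE' in PE *.
  have [eE fE] : e \in edges G /\ f \in edges G.
    by split; apply: (fintype.subsetP PE); rewrite !inE eqxx ?orbT.
  rewrite crossing_count // !big_setU1 ?inE //= !big_set1 !big_setU1 ?inE //= !big_set1.
  by rewrite /c !eqxx /= (eq_sym f) ne crossesC /=; lia.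
rewrite (exchange_big_dep (mem (edges G))) /=; last first.
  by move=> P e /andP[/fintype.subsetP PE _]; exact: PE.
apply: eq_bigr => e eE; rewrite (exchange_big_dep (mem (edges G))) /=; last first.
  by move=> P f /andP[/andP[/fintype.subsetP PE _] _]; exact: PE.
apply: eq_bigr => f fE; rewrite -/(c e f).
have [ef|ne] := eqVneq e f; first by rewrite /c ef eqxx big1.
rewrite (big_pred1 [set e; f]%SET) // => P /=.
apply/idP/eqP => [/andP[/andP[/andP[_ /eqP cP] eP] fP]|->].
  apply/eqP; rewrite eq_sym eqEcard finset.subUset !finset.sub1set eP fP cP cards2 ne //.
by rewrite finset.subUset !finset.sub1set eE fE cards2 ne !inE !eqxx orbT.
Qed.

Definition cycle_edges (x0 : G) (xs : seq G) : seq {set G} :=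
  [seq edge_of (nth x0 xs i) (nth x0 xs (i.+1 %% size xs)) | i <- iota 0 (size xs)].

Lemma odd_deficits (T : eqType) (s : seq T) (c : T -> nat) (b : T -> bool) :
  (forall x, odd (c x) = b x) -> odd (\sum_(x <- s) c x) = \big[addb/false]_(x <- s) b x.
Proof. by move=> h; elim: s => [|x s IH]; rewrite ?big_nil // !big_cons oddD IH h. Qed.

Lemma deficit_parity (x0 : G) (xs ys : seq G) : cyclic xs x0 -> cyclic ys x0 ->
  ~~ has (mem ys) xs ->
  odd (\sum_(e <- cycle_edges x0 xs) \sum_(f <- cycle_edges x0 ys) ~~ crosses D e f) =
  odd (size xs * size ys).
Proof.
move=> cx cy dis; have h := cycles_parity gD cx cy dis.
have {}h : odd (\sum_(e <- cycle_edges x0 xs) \sum_(f <- cycle_edges x0 ys) crosses D e f) = false.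
  rewrite (@odd_deficits _ _ _ (fun e => \big[addb/false]_(f <- cycle_edges x0 ys) crosses D e f)).
    rewrite -[RHS]h big_map; apply: eq_bigr => i _; exact: big_map.
  by move=> e; apply: odd_deficits => f; rewrite oddb.
have : \sum_(e <- cycle_edges x0 xs) \sum_(f <- cycle_edges x0 ys) ~~ crosses D e f +
  \sum_(e <- cycle_edges x0 xs) \sum_(f <- cycle_edges x0 ys) crosses D e f = size xs * size ys.
  rewrite -big_split /= (eq_bigr (fun=> size ys)); last first.
    move=> e _; rewrite -big_split /= (eq_bigr (fun=> 1)); last by move=> f _; case: crosses.
    by rewrite sum1_size size_map size_iota.
  by rewrite big_const_seq count_predT size_map size_iota iter_addn_0 mulnC.
by move=> <-; rewrite oddD h addbF.
Qed.

End DoubleCount.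

(** * Good drawings of the product of two triangles *)

Definition torus : sgraph := cart_prod (cycle_graph 3) (cycle_graph 3).

Definition pt (r c : 'I_3) : torus := (r, c).

(* Edges are indexed by the vertex missing from their triangle. *)
Definition row_edge (r c : 'I_3) : {set torus} := edge_of (pt r (S c)) (pt r (S (S c))).
Definition col_edge (r c : 'I_3) : {set torus} := edge_of (pt (S r) c) (pt (S (S r)) c).

Lemma ordS_neq (i : 'I_3) : ((i == S i) = false) * ((i == S (S i)) = false) *
  ((S i == i) = false) * ((S (S i) == i) = false) * ((S i == S (S i)) = false) *
  ((S (S i) == S i) = false).
Proof. by case: i => -[|[|[|//]]] hi. Qed.

Lemma ordS_cases (i k : 'I_3) : [\/ k = i, k = S i | k = S (S i)].
Proof.
case: i => -[|[|[|//]]] hi; case: k => -[|[|[|//]]] hk;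
 by [apply: Or31; apply: val_inj | apply: Or32; apply: val_inj | apply: Or33; apply: val_inj].
Qed.

Lemma adj_pt r c s d : adj (pt r c) (pt s d) =
  ((r == s) && (c != d)) || ((c == d) && (r != s)).
Proof.
rewrite /adj /= /cart_adj /= /adj /= /cycle_adj.
suff h (i j : 'I_3) : (i != j) && ((j == S i) || (i == S j)) = (i != j) by rewrite !h.
by case: i => -[|[|[|//]]] hi; case: j => -[|[|[|//]]] hj.
Qed.

Lemma row_edge_edges r c : row_edge r c \in edges torus.
Proof. by apply: edge_of_edges; rewrite adj_pt eqxx ordS_neq. Qed.

Lemma col_edge_edges r c : col_edge r c \in edges torus.
Proof. by apply: edge_of_edges; rewrite adj_pt eqxx ordS_neq. Qed.

Lemma row_edgeE r c : (edge_of (pt r c) (pt r (S c)) = row_edge r (S (S c))) *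
  (edge_of (pt r (S c)) (pt r c) = row_edge r (S (S c))) *
  (edge_of (pt r c) (pt r (S (S c))) = row_edge r (S c)) *
  (edge_of (pt r (S (S c))) (pt r c) = row_edge r (S c)) *
  (edge_of (pt r (S (S c))) (pt r (S c)) = row_edge r c) *
  (edge_of (pt r (S c)) (pt r (S (S c))) = row_edge r c).
Proof.
rewrite /row_edge !ordS3 ![edge_of (pt r (S c)) (pt r c)]edge_ofC.
by rewrite ![edge_of (pt r (S (S c))) _]edge_ofC.
Qed.

Lemma col_edgeE r c : (edge_of (pt r c) (pt (S r) c) = col_edge (S (S r)) c) *
  (edge_of (pt (S r) c) (pt r c) = col_edge (S (S r)) c) *
  (edge_of (pt r c) (pt (S (S r)) c) = col_edge (S r) c) *
  (edge_of (pt (S (S r)) c) (pt r c) = col_edge (S r) c) *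
  (edge_of (pt (S (S r)) c) (pt (S r) c) = col_edge r c) *
  (edge_of (pt (S r) c) (pt (S (S r)) c) = col_edge r c).
Proof.
rewrite /col_edge !ordS3 ![edge_of (pt (S r) c) (pt r c)]edge_ofC.
by rewrite ![edge_of (pt (S (S r)) c) _]edge_ofC.
Qed.

Lemma row_edge_inj r c s d : row_edge r c = row_edge s d -> r = s /\ c = d.
Proof.
move=> /edge_of_eq; rewrite /pt !xpair_eqE.
by case: r => -[|[|[|//]]] hr; case: s => -[|[|[|//]]] hs; case: c => -[|[|[|//]]] hc;
  case: d => -[|[|[|//]]] hd //= _; split; apply: val_inj.
Qed.

Lemma col_edge_inj r c s d : col_edge r c = col_edge s d -> r = s /\ c = d.
Proof.
move=> /edge_of_eq; rewrite /pt !xpair_eqE.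
by case: r => -[|[|[|//]]] hr; case: s => -[|[|[|//]]] hs; case: c => -[|[|[|//]]] hc;
  case: d => -[|[|[|//]]] hd //= _; split; apply: val_inj.
Qed.

Lemma row_col_edge r c s d : row_edge r c != col_edge s d.
Proof.
apply/eqP => /edge_of_eq; rewrite /pt !xpair_eqE.
by case: r => -[|[|[|//]]] hr; case: s => -[|[|[|//]]] hs; case: c => -[|[|[|//]]] hc;
  case: d => -[|[|[|//]]] hd.
Qed.

Definition torus_edge (x : bool * ('I_3 * 'I_3)) : {set torus} :=
  if x.1 then row_edge x.2.1 x.2.2 else col_edge x.2.1 x.2.2.

Lemma torus_edge_inj : injective torus_edge.
Proof.
move=> [[] [r c]] [[] [s d]]; rewrite /torus_edge /=.
- by move=> /row_edge_inj[-> ->].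
- by move=> /eqP; rewrite (negbTE (row_col_edge _ _ _ _)).
- by move=> /eqP; rewrite eq_sym (negbTE (row_col_edge _ _ _ _)).
- by move=> /col_edge_inj[-> ->].
Qed.

Lemma torus_edges : edges torus = [set torus_edge x | x : bool * ('I_3 * 'I_3)]%SET.
Proof.
apply/setP => e; apply/idP/imsetP => [|[[[] [r c]] _ ->]]; last 2 first.
- exact: row_edge_edges.
- exact: col_edge_edges.
rewrite inE => /existsP[[r c]]/existsP[[s d]]/andP[]; rewrite (adj_pt r c s d).
move=> /orP[]/andP[/eqP<- ne] /eqP->; rewrite -/(edge_of (pt _ _) (pt _ _)).
  have [E|E|E] := ordS_cases c d; rewrite E ?eqxx // in ne *; rewrite row_edgeE.
    by exists (true, (r, S (S c))).
  by exists (true, (r, S c)).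
have [E|E|E] := ordS_cases r s; rewrite E ?eqxx // in ne *; rewrite col_edgeE.
  by exists (false, (S (S r), c)).
by exists (false, (S r, c)).
Qed.

Lemma edges_sum (g : {set torus} -> nat) : (\sum_(e in edges torus) g e =
  \sum_(r < 3) \sum_(c < 3) (g (row_edge r c) + g (col_edge r c)))%N.
Proof.
rewrite torus_edges big_imset /=; last by move=> x y _ _ /torus_edge_inj.
have pairs (I J : finType) (h : I * J -> nat) :
    (\sum_x h x = \sum_(i : I) \sum_(j : J) h (i, j))%N.
  by rewrite pair_big; apply: eq_bigr => -[].
rewrite pairs big_bool !pairs -big_split /=.
by apply: eq_bigr => r _; rewrite -big_split.
Qed.

Section TorusDrawing.
Local Open Scope nat_scope.
Variables (R : realType) (D : drawing R torus).
Hypothesis gD : good_drawing D.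

Definition rowdef (t c d : 'I_3) : nat := ~~ crosses D (row_edge (S t) c) (row_edge (S (S t)) d).
Definition coldef (t c d : 'I_3) : nat := ~~ crosses D (col_edge c (S t)) (col_edge d (S (S t))).
Definition mixdef (r c s d : 'I_3) : nat := ~~ crosses D (row_edge r c) (col_edge s d).

Let X (e f : {set torus}) : nat := (e != f) && crosses D e f.

Lemma X_rows r c s d : r != s -> X (row_edge r c) (row_edge s d) = crosses D (row_edge r c)
  (row_edge s d).
Proof.
by move=> rs; rewrite /X; case: eqP => [/row_edge_inj[e]|//]; rewrite e eqxx in rs.
Qed.

Lemma X_cols r c s d : c != d -> X (col_edge r c) (col_edge s d) = crosses D (col_edge r c)
  (col_edge s d).
Proof.
by move=> cd; rewrite /X; case: eqP => [/col_edge_inj[_ e]|//]; rewrite e eqxx in cd.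
Qed.

Lemma X_mix r c s d : X (row_edge r c) (col_edge s d) = crosses D (row_edge r c) (col_edge s d).
Proof. by rewrite /X row_col_edge. Qed.

Lemma XC e f : X e f = X f e.
Proof. by rewrite /X eq_sym crossesC. Qed.

Lemma X_row r c d : X (row_edge r c) (row_edge r d) = 0.
Proof.
rewrite /X; case: eqP => //= /eqP ne; rewrite -/(cross2 D _ _ _ _) cross2_incident //.
- by rewrite adj_pt eqxx ordS_neq.
- by rewrite adj_pt eqxx ordS_neq.
- by rewrite /pt !xpair_eqE eqxx /=; case: (ordS_cases c d) => ->; rewrite ?ordS3 !eqxx ?orbT.
Qed.

Lemma X_col r s c : X (col_edge r c) (col_edge s c) = 0.
Proof.
rewrite /X; case: eqP => //= /eqP ne; rewrite -/(cross2 D _ _ _ _) cross2_incident //.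
- by rewrite adj_pt eqxx ordS_neq.
- by rewrite adj_pt eqxx ordS_neq.
- by rewrite /pt !xpair_eqE eqxx /= !andbT; case: (ordS_cases r s) => ->; rewrite ?ordS3 !eqxx
  ?orbT.
Qed.

Lemma X_mixE r c s d : X (row_edge r c) (col_edge s d) =
  (((r == s) || (c == d)) && crosses D (row_edge r c) (col_edge s d)).
Proof.
rewrite X_mix; have [//|rs /=] := eqVneq r s; have [//|cd /=] := eqVneq c d.
rewrite -/(cross2 D _ _ _ _) cross2_incident //.
- by rewrite adj_pt eqxx ordS_neq.
- by rewrite adj_pt eqxx ordS_neq.
- exact: row_col_edge.
- move: rs cd; rewrite /pt !xpair_eqE; case: (ordS_cases r s) => ->; case: (ordS_cases c d) => ->;
  by rewrite ?ordS3 ?eqxx ?ordS_neq ?orbT.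
Qed.

Lemma sumS (f : 'I_3 -> nat) : \sum_(i < 3) f (S i) = \sum_(i < 3) f i.
Proof. by rewrite !(sum3 ord0) ordS3 addnC addnA. Qed.

Lemma sum_twos (f : 'I_3 -> nat) : (forall i, f i = 2) -> \sum_(i < 3) f i = 6.
Proof. by move=> h; rewrite (sum3 ord0) !h. Qed.

(** A row edge is disjoint from the 6 edges of the other two rows and from 5 column edges: the three
    in the column it misses, and one in each of its own columns. Halving the pairs of equal kind
    gives 27 + 27 + 45 = 99. *)
Lemma crossings_total : crossings D + deficits rowdef coldef mixdef = 99.
Proof.
have rowX r c : \sum_(s < 3) \sum_(d < 3) X (row_edge r c) (row_edge s d) +
    (\sum_(d < 3) rowdef (S (S r)) c d + \sum_(d < 3) rowdef (S r) d c) = 6.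
  rewrite (sum3 r) (eq_bigr (fun=> 0)) => [|d _]; last exact: X_row.
  rewrite big1 // add0n addnACA -!big_split /=.
  rewrite sum_twos // => d; rewrite !X_rows ?ordS_neq // /rowdef !ordS3.
  by rewrite (crossesC D (row_edge (S (S r)) d)); do 2 case: crosses.
have colX r c : \sum_(s < 3) \sum_(d < 3) X (col_edge r c) (col_edge s d) +
    (\sum_(d < 3) coldef (S (S c)) r d + \sum_(d < 3) coldef (S c) d r) = 6.
  rewrite exchange_big (sum3 c (fun d => \sum_(s < 3) X (col_edge r c) (col_edge s d))).
  rewrite (eq_bigr (fun=> 0)) => [|d _]; last exact: X_col.
  rewrite big1 // add0n addnACA -!big_split /=.
  rewrite sum_twos // => d; rewrite !X_cols ?ordS_neq // /coldef !ordS3.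
  by rewrite (crossesC D (col_edge d (S (S c)))); do 2 case: crosses.
have mixX r c : \sum_(s < 3) \sum_(d < 3) X (row_edge r c) (col_edge s d) +
    (\sum_(d < 3) mixdef r c r d + mixdef r c (S r) c + mixdef r c (S (S r)) c) = 5.
  rewrite (sum3 r) !(sum3 c) !X_mixE !eqxx !ordS_neq /= /mixdef.
  by do 5 case: crosses.
have := double_crossings gD; rewrite edges_sum.
have -> : \sum_(r < 3) \sum_(c < 3)
   (\sum_(f in edges torus) ((row_edge r c != f) && crosses D (row_edge r c) f) +
    \sum_(f in edges torus) ((col_edge r c != f) && crosses D (col_edge r c) f)) =
  \sum_(r < 3) \sum_(c < 3) \sum_(s < 3) \sum_(d < 3) X (row_edge r c) (row_edge s d) +
  (\sum_(r < 3) \sum_(c < 3) \sum_(s < 3) \sum_(d < 3) X (row_edge r c) (col_edge s d)).*2 +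
  \sum_(r < 3) \sum_(c < 3) \sum_(s < 3) \sum_(d < 3) X (col_edge r c) (col_edge s d).
  have split4 (f g : 'I_3 -> 'I_3 -> 'I_3 -> 'I_3 -> nat) :
      \sum_(r < 3) \sum_(c < 3) \sum_(s < 3) \sum_(d < 3) (f r c s d + g r c s d) =
      \sum_(r < 3) \sum_(c < 3) \sum_(s < 3) \sum_(d < 3) f r c s d +
      \sum_(r < 3) \sum_(c < 3) \sum_(s < 3) \sum_(d < 3) g r c s d.
    by do 3 (rewrite -big_split /=; apply: eq_bigr => ? _); rewrite big_split.
  have swap4 (f : 'I_3 -> 'I_3 -> 'I_3 -> 'I_3 -> nat) :
      \sum_(r < 3) \sum_(c < 3) \sum_(s < 3) \sum_(d < 3) f s d r c =
      \sum_(r < 3) \sum_(c < 3) \sum_(s < 3) \sum_(d < 3) f r c s d.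
    under eq_bigr => r _ do rewrite exchange_big /=.
    rewrite exchange_big /=; apply: eq_bigr => s _.
    under eq_bigr => r _ do rewrite exchange_big /=.
    by rewrite exchange_big.
  transitivity (\sum_(r < 3) \sum_(c < 3) \sum_(s < 3) \sum_(d < 3)
    ((X (row_edge r c) (row_edge s d) + X (row_edge r c) (col_edge s d)) +
     (X (col_edge r c) (row_edge s d) + X (col_edge r c) (col_edge s d)))).
    apply: eq_bigr => r _; apply: eq_bigr => c _; rewrite !edges_sum -big_split /=.
    by apply: eq_bigr => s _; rewrite -big_split.
  rewrite !split4 -[X in _ + (X + _)]swap4 -addnn.
  have -> : \sum_(r < 3) \sum_(c < 3) \sum_(s < 3) \sum_(d < 3) X (col_edge s d) (row_edge r c) =
      \sum_(r < 3) \sum_(c < 3) \sum_(s < 3) \sum_(d < 3) X (row_edge r c) (col_edge s d).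
    by do 4 (apply: eq_bigr => ? _); rewrite XC.
  lia.
set rr := \sum_(r < 3) _; set rc := \sum_(r < 3) _; set cc := \sum_(r < 3) _.
rewrite /deficits.
set dA := \sum_(i < 3) _; set dB := \sum_(i < 3) _; set dM := \sum_(r < 3) _.
have nines (f : 'I_3 -> 'I_3 -> nat) n : (forall r c, f r c = n) ->
    \sum_(r < 3) \sum_(c < 3) f r c = 9 * n.
  by move=> h; rewrite (sum3 ord0) !(sum3 ord0 (f _)) !h; lia.
have split2 (f g : 'I_3 -> 'I_3 -> nat) : \sum_(r < 3) \sum_(c < 3) (f r c + g r c) =
    \sum_(r < 3) \sum_(c < 3) f r c + \sum_(r < 3) \sum_(c < 3) g r c.
  by rewrite -big_split; apply: eq_bigr => r _; rewrite big_split.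
have hA : rr + (dA + dA) = 54.
  rewrite -[RHS]/(9 * 6) -(nines _ _ rowX) !split2; congr (_ + (_ + _)).
    rewrite (sumS (fun r => \sum_(c < 3) \sum_(d < 3) rowdef (S r) c d)).
    by rewrite (sumS (fun r => \sum_(c < 3) \sum_(d < 3) rowdef r c d)).
  rewrite (sumS (fun r => \sum_(c < 3) \sum_(d < 3) rowdef r d c)).
  by apply: eq_bigr => r _; rewrite exchange_big.
have hB : cc + (dB + dB) = 54.
  rewrite -[RHS]/(9 * 6) -(nines _ _ colX) !split2; congr (_ + (_ + _)).
    rewrite exchange_big (sumS (fun c => \sum_(r < 3) \sum_(d < 3) coldef (S c) r d)).
    by rewrite (sumS (fun c => \sum_(r < 3) \sum_(d < 3) coldef c r d)).
  rewrite exchange_big (sumS (fun c => \sum_(r < 3) \sum_(d < 3) coldef c d r)).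
  by apply: eq_bigr => c _; rewrite exchange_big.
have hM : rc + dM = 45.
  rewrite -[RHS]/(9 * 5) -(nines _ _ mixX) !split2; congr (_ + _).
  rewrite /dM /mix -!split2; apply: eq_bigr => r _; by rewrite !(sum3 r) ?ordS3; lia.
lia.
Qed.

End TorusDrawing.

(** * The upper bound *)

Section TorusBound.
Local Open Scope nat_scope.
Variables (R : realType) (D : drawing R torus).
Hypothesis gD : good_drawing D.

Notation A := (rowdef D). Notation B := (coldef D). Notation M := (mixdef D).

Let x0 : torus := pt ord0 ord0.

Definition row_cycle (r c : 'I_3) : seq torus := [:: pt r c; pt r (S c); pt r (S (S c))].
Definition col_cycle (r c : 'I_3) : seq torus := [:: pt r c; pt (S r) c; pt (S (S r)) c].
Definition square (r c : 'I_3) : seq torus :=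
  [:: pt (S r) (S c); pt (S r) (S (S c)); pt (S (S r)) (S (S c)); pt (S (S r)) (S c)].

Lemma row_cyclic r c : cyclic (row_cycle r c) x0.
Proof.
by case=> [|[|[|//]]] _; apply: etrans (adj_pt _ _ _ _) _; rewrite ?ordS3 !eqxx ordS_neq.
Qed.

Lemma col_cyclic r c : cyclic (col_cycle r c) x0.
Proof.
by case=> [|[|[|//]]] _; apply: etrans (adj_pt _ _ _ _) _; rewrite ?ordS3 !eqxx ordS_neq ?orbT.
Qed.

Lemma square_cyclic r c : cyclic (square r c) x0.
Proof.
by case=> [|[|[|[|//]]]] _; apply: etrans (adj_pt _ _ _ _) _; rewrite !eqxx ordS_neq ?orbT.
Qed.

Lemma row_cycle_edges r c : cycle_edges x0 (row_cycle r c) =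
  [:: row_edge r (S (S c)); row_edge r c; row_edge r (S c)].
Proof. by rewrite /cycle_edges /= !row_edgeE ?ordS3. Qed.

Lemma col_cycle_edges r c : cycle_edges x0 (col_cycle r c) =
  [:: col_edge (S (S r)) c; col_edge r c; col_edge (S r) c].
Proof. by rewrite /cycle_edges /= !col_edgeE ?ordS3. Qed.

Lemma square_edges r c : cycle_edges x0 (square r c) =
  [:: row_edge (S r) c; col_edge r (S (S c)); row_edge (S (S r)) c; col_edge r (S c)].
Proof. by rewrite /cycle_edges /= !row_edgeE !col_edgeE ?ordS3. Qed.

Lemma odd_rowdef t : odd (\sum_(c < 3) \sum_(d < 3) A t c d).
Proof.
have := @deficit_parity _ _ _ gD x0 (row_cycle (S t) t) (row_cycle (S (S t)) t)
  (@row_cyclic _ _) (@row_cyclic _ _).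
rewrite !row_cycle_edges !(big_cons, big_nil) !(sum3 t) /rowdef.
rewrite /= !inE /pt !xpair_eqE !ordS_neq ?andbF => /(_ isT) /= h.
by rewrite /is_true -[RHS]h; congr odd; ring.
Qed.

Lemma odd_coldef t : odd (\sum_(c < 3) \sum_(d < 3) B t c d).
Proof.
have := @deficit_parity _ _ _ gD x0 (col_cycle t (S t)) (col_cycle t (S (S t)))
  (@col_cyclic _ _) (@col_cyclic _ _).
rewrite !col_cycle_edges !(big_cons, big_nil) !(sum3 t) /coldef.
rewrite /= !inE /pt !xpair_eqE !ordS_neq ?andbF => /(_ isT) /= h.
by rewrite /is_true -[RHS]h; congr odd; ring.
Qed.

Lemma even_rowC4 r c : ~~ odd (\sum_(g < 3)
  (A (S (S r)) g c + A (S r) c g + M r g r (S c) + M r g r (S (S c)))).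
Proof.
have := @deficit_parity _ _ _ gD x0 (row_cycle r c) (square r c)
  (@row_cyclic _ _) (@square_cyclic _ _).
rewrite row_cycle_edges square_edges !(big_cons, big_nil) !(sum3 c) /rowdef /mixdef ?ordS3.
rewrite !(crossesC D (row_edge (S (S r)) c)).
rewrite /= !inE /pt !xpair_eqE !ordS_neq ?andbF => /(_ isT) /= h.
by apply/negbT; rewrite -[RHS]h; congr odd; ring.
Qed.

Lemma even_colC4 r c : ~~ odd (\sum_(g < 3)
  (B (S (S c)) g r + B (S c) r g + M (S r) c g c + M (S (S r)) c g c)).
Proof.
have := @deficit_parity _ _ _ gD x0 (col_cycle r c) (square r c)
  (@col_cyclic _ _) (@square_cyclic _ _).
rewrite col_cycle_edges square_edges !(big_cons, big_nil) !(sum3 r) /coldef /mixdef ?ordS3.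
rewrite !(crossesC D (col_edge r (S (S c)))) !(crossesC D _ (row_edge _ _)).
rewrite /= !inE /pt !xpair_eqE !ordS_neq ?andbF => /(_ isT) /= h.
by apply/negbT; rewrite -[RHS]h; congr odd; ring.
Qed.

Ltac torus_adj := apply: etrans (adj_pt _ _ _ _) _; rewrite ?eqxx !ordS_neq ?orbT //.
Ltac torus_uniq := rewrite /= !inE /pt !xpair_eqE ?eqxx !ordS_neq ?andbF ?andFb //.

Lemma square_deficit i j : 1 <= A i j j + B j i i.
Proof.
have : ~~ (cross2 D (pt (S i) (S j)) (pt (S i) (S (S j))) (pt (S (S i)) (S (S j)))
   (pt (S (S i)) (S j)) &&
  cross2 D (pt (S i) (S (S j))) (pt (S (S i)) (S (S j))) (pt (S (S i)) (S j)) (pt (S i) (S j))).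
  by apply: no_crossed_C4 => //; [torus_adj..|torus_uniq].
rewrite /cross2 !row_edgeE !col_edgeE ?ordS3 /rowdef /coldef.
rewrite (crossesC D (col_edge _ _)).
by do 2 case: crosses.
Qed.

Lemma bowtie_deficit r a : 1 <= M r (S a) r a + M r (S (S a)) r a +
     M r a (S r) a + M r a (S (S r)) a.
Proof.
have : ~~ [&& cross2 D (pt r a) (pt r (S a)) (pt (S r) a) (pt (S (S r)) a),
   cross2 D (pt r a) (pt r (S (S a))) (pt (S r) a) (pt (S (S r)) a),
   cross2 D (pt r (S a)) (pt r (S (S a))) (pt r a) (pt (S r) a) &
   cross2 D (pt r (S a)) (pt r (S (S a))) (pt r a) (pt (S (S r)) a)].
  by apply: no_crossed_bowtie => //; [torus_adj..|torus_uniq].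
rewrite /cross2 !row_edgeE !col_edgeE ?ordS3 /mixdef.
by do 4 case: crosses.
Qed.

(** The triangle of the house is row [S i]. In the next three lemmas it is row [S (S i)], column
    [S j] and column [S (S j)]. *)
Lemma house_top i j : A i j j + B j i i = 2 ->
  1 <= M (S i) (S j) i (S j) + M (S i) (S (S j)) i (S (S j)) +
       A i (S j) j + A i (S (S j)) j.
Proof.
have := @no_crossed_house _ _ _ gD (pt (S i) (S j)) (pt (S i) (S (S j)))
   (pt (S (S i)) (S (S j))) (pt (S (S i)) (S j)) (pt (S i) j).
move=> /(_ ltac:(torus_adj) ltac:(torus_adj) ltac:(torus_adj) ltac:(torus_adj)
  ltac:(torus_adj) ltac:(torus_adj) ltac:(torus_uniq)).
rewrite /cross2 !row_edgeE !col_edgeE ?ordS3 /rowdef /coldef /mixdef.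
rewrite ?(crossesC D (col_edge _ _) (row_edge _ _)).
rewrite ?(crossesC D (row_edge (S (S i)) _) (row_edge (S i) _)).
rewrite ?(crossesC D (col_edge _ (S (S j))) (col_edge _ (S j))) => h two.
have [nA nB] : crosses D (row_edge (S i) j) (row_edge (S (S i)) j) = false /\
    crosses D (col_edge i (S j)) (col_edge i (S (S j))) = false.
  by move: two; do 2 case: crosses.
rewrite nA nB in h; move: (h isT isT).
by do 4 case: crosses.
Qed.

Lemma house_bottom i j : A i j j + B j i i = 2 ->
  1 <= M (S (S i)) (S j) i (S j) + M (S (S i)) (S (S j)) i (S (S j)) +
       A i j (S j) + A i j (S (S j)).
Proof.
have := @no_crossed_house _ _ _ gD (pt (S (S i)) (S j)) (pt (S (S i)) (S (S j)))
   (pt (S i) (S (S j))) (pt (S i) (S j)) (pt (S (S i)) j).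
move=> /(_ ltac:(torus_adj) ltac:(torus_adj) ltac:(torus_adj) ltac:(torus_adj)
  ltac:(torus_adj) ltac:(torus_adj) ltac:(torus_uniq)).
rewrite /cross2 !row_edgeE !col_edgeE ?ordS3 /rowdef /coldef /mixdef.
rewrite ?(crossesC D (col_edge _ _) (row_edge _ _)).
rewrite ?(crossesC D (row_edge (S (S i)) _) (row_edge (S i) _)).
rewrite ?(crossesC D (col_edge _ (S (S j))) (col_edge _ (S j))) => h two.
have [nA nB] : crosses D (row_edge (S i) j) (row_edge (S (S i)) j) = false /\
    crosses D (col_edge i (S j)) (col_edge i (S (S j))) = false.
  by move: two; do 2 case: crosses.
rewrite nA nB in h; move: (h isT isT).
by do 4 case: crosses.
Qed.

Lemma house_left i j : A i j j + B j i i = 2 ->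
  1 <= M (S i) j (S i) (S j) + M (S (S i)) j (S (S i)) (S j) +
       B j (S i) i + B j (S (S i)) i.
Proof.
have := @no_crossed_house _ _ _ gD (pt (S i) (S j)) (pt (S (S i)) (S j))
   (pt (S (S i)) (S (S j))) (pt (S i) (S (S j))) (pt i (S j)).
move=> /(_ ltac:(torus_adj) ltac:(torus_adj) ltac:(torus_adj) ltac:(torus_adj)
  ltac:(torus_adj) ltac:(torus_adj) ltac:(torus_uniq)).
rewrite /cross2 !row_edgeE !col_edgeE ?ordS3 /rowdef /coldef /mixdef.
rewrite ?(crossesC D (col_edge _ _) (row_edge _ _)).
rewrite ?(crossesC D (row_edge (S (S i)) _) (row_edge (S i) _)).
rewrite ?(crossesC D (col_edge _ (S (S j))) (col_edge _ (S j))) => h two.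
have [nA nB] : crosses D (row_edge (S i) j) (row_edge (S (S i)) j) = false /\
    crosses D (col_edge i (S j)) (col_edge i (S (S j))) = false.
  by move: two; do 2 case: crosses.
rewrite nA nB in h; move: (h isT isT).
by do 4 case: crosses.
Qed.

Lemma house_right i j : A i j j + B j i i = 2 ->
  1 <= M (S i) j (S i) (S (S j)) + M (S (S i)) j (S (S i)) (S (S j)) +
       B j i (S i) + B j i (S (S i)).
Proof.
have := @no_crossed_house _ _ _ gD (pt (S i) (S (S j))) (pt (S (S i)) (S (S j)))
   (pt (S (S i)) (S j)) (pt (S i) (S j)) (pt i (S (S j))).
move=> /(_ ltac:(torus_adj) ltac:(torus_adj) ltac:(torus_adj) ltac:(torus_adj)
  ltac:(torus_adj) ltac:(torus_adj) ltac:(torus_uniq)).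
rewrite /cross2 !row_edgeE !col_edgeE ?ordS3 /rowdef /coldef /mixdef.
rewrite ?(crossesC D (col_edge _ _) (row_edge _ _)).
rewrite ?(crossesC D (row_edge (S (S i)) _) (row_edge (S i) _)).
rewrite ?(crossesC D (col_edge _ (S (S j))) (col_edge _ (S j))) => h two.
have [nA nB] : crosses D (row_edge (S i) j) (row_edge (S (S i)) j) = false /\
    crosses D (col_edge i (S j)) (col_edge i (S (S j))) = false.
  by move: two; do 2 case: crosses.
rewrite nA nB in h; move: (h isT isT).
by do 4 case: crosses.
Qed.

(** The triangle is row [S i]. The path leaves it along column [x] and continues in row [S (S i)] to
    column [y] and then to column [j]. *)
Lemma row_path1 i j x y :
  (x == S j) && (y == S (S j)) || (x == S (S j)) && (y == S j) ->
  A i j j = 1 -> A i x x = 1 -> M (S (S i)) x i x = 1 ->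
  1 <= A i j x + A i y j + A i y x + M (S i) x i x + A i x j.
Proof.
move=> xy; have := @no_crossed_path _ _ _ gD (pt (S i) x) (pt (S i) y) (pt (S i) j)
   (pt (S (S i)) x) (pt (S (S i)) y) (pt (S (S i)) j).
case/orP: xy => /andP[/eqP-> /eqP->];
(move=> /(_ ltac:(torus_adj) ltac:(torus_adj) ltac:(torus_adj) ltac:(torus_adj)
  ltac:(torus_adj) ltac:(torus_adj) ltac:(torus_uniq));
rewrite /cross2 !row_edgeE !col_edgeE ?ordS3 /rowdef /mixdef;
rewrite ?(crossesC D (col_edge _ _) (row_edge _ _));
rewrite ?(crossesC D (row_edge (S (S i)) _) (row_edge (S i) _));
do 3 (case: (crosses _ _ _) => //); move=> /(_ isT isT isT) + _ _ _;
by do 5 case: crosses).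
Qed.

Lemma row_path2 i j x y :
  (x == S j) && (y == S (S j)) || (x == S (S j)) && (y == S j) ->
  A i j j = 1 -> A i x x = 1 -> M (S i) x i x = 1 ->
  1 <= A i x j + A i j y + A i x y + M (S (S i)) x i x + A i j x.
Proof.
move=> xy; have := @no_crossed_path _ _ _ gD (pt (S (S i)) x) (pt (S (S i)) y)
   (pt (S (S i)) j) (pt (S i) x) (pt (S i) y) (pt (S i) j).
case/orP: xy => /andP[/eqP-> /eqP->];
(move=> /(_ ltac:(torus_adj) ltac:(torus_adj) ltac:(torus_adj) ltac:(torus_adj)
  ltac:(torus_adj) ltac:(torus_adj) ltac:(torus_uniq));
rewrite /cross2 !row_edgeE !col_edgeE ?ordS3 /rowdef /mixdef;
rewrite ?(crossesC D (col_edge _ _) (row_edge _ _));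
rewrite ?(crossesC D (row_edge (S (S i)) _) (row_edge (S i) _));
do 3 (case: (crosses _ _ _) => //); move=> /(_ isT isT isT) + _ _ _;
by do 5 case: crosses).
Qed.

Lemma crossings_le : crossings D <= 78.
Proof.
have := crossings_total gD; have [small|] := leqP (deficits A B M) 20; last lia.
have few : few_deficits A B M by split => //; [exact: square_deficit|exact: bowtie_deficit|
  exact: odd_rowdef|exact: odd_coldef|exact: even_rowC4|exact: even_colC4].
exfalso; apply: (deficits_gt20 few _ house_top house_bottom house_left house_right
  row_path1 row_path2).
by move=> *; split; exact: leq_b1.
Qed.

End TorusBound.

(** * A drawing with 78 crossings *)

Section Segments.
Variable R : realType.
Notation P := (R * R)%type.
Implicit Types p q r s x : P.

Definition orient p q r : R := (q.1 - p.1) * (r.2 - p.2) - (q.2 - p.2) * (r.1 - p.1).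

Definition segpt p q (t : R) : P := (p.1 + t * (q.1 - p.1), p.2 + t * (q.2 - p.2)).

(* The segment [p, q] without the endpoint p. *)
Definition hseg p q : set P := segpt p q @` [set t | 0 < t <= 1].

(** The path with straight legs from [p] to the bend [q] and from [q] to [r]; each clamp lets its
    leg advance during one half of the unit interval only. *)
Definition arc2 p q r (u : R) : P :=
  (p.1 + clamp 0 1 (2 * u) * (q.1 - p.1) + clamp 0 1 (2 * u - 1) * (r.1 - q.1),
   p.2 + clamp 0 1 (2 * u) * (q.2 - p.2) + clamp 0 1 (2 * u - 1) * (r.2 - q.2)).

Lemma clamp01_lt0 (x : R) : x <= 0 -> clamp 0 1 x = 0.
Proof. by move=> x0; rewrite /clamp; apply/max_idPl; rewrite ge_min x0 orbT. Qed.

Lemma clamp01_gt1 (x : R) : 1 <= x -> clamp 0 1 x = 1.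
Proof. by move=> x1; rewrite /clamp (min_idPl x1) (max_idPr ler01). Qed.

Lemma arc2_l p q r u : 0 <= u <= 1 / 2 -> arc2 p q r u = segpt p q (2 * u).
Proof.
move=> h; rewrite /arc2 (@clamp_id _ _ _ (2 * u)); last lra.
rewrite clamp01_lt0; last lra.
by rewrite /segpt !mul0r !addr0.
Qed.

Lemma arc2_r p q r u : 1 / 2 <= u <= 1 -> arc2 p q r u = segpt r q (2 - 2 * u).
Proof.
move=> h; rewrite /arc2 clamp01_gt1; last lra.
rewrite clamp_id; last lra.
by rewrite /segpt; congr pair; ring.
Qed.

Lemma arc2_cont p q r : continuous (arc2 p q r).
Proof.
have c k : continuous (fun u : R => clamp 0 1 (2 * u - k)).
  apply: cont_comp (@cont_clamp _ _ _); apply: contB; last exact: cont_cst.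
  by apply: contM; [exact: cont_cst|exact: cont_id].
have c0 : continuous (fun u : R => clamp 0 1 (2 * u)).
  by apply: cont_comp (@cont_clamp _ _ _); apply: contM; [exact: cont_cst|exact: cont_id].
by apply: cont_pair; (apply: contD; last by apply: contM; [exact: c|exact: cont_cst]);
  (apply: contD; first exact: cont_cst); apply: contM; [|exact: cont_cst| |exact: cont_cst].
Qed.

Lemma arc2_0 p q r : arc2 p q r 0 = p.
Proof. by rewrite arc2_l ?lexx ?divr_ge0 // /segpt mulr0 !mul0r !addr0 -surjective_pairing. Qed.

Lemma arc2_1 p q r : arc2 p q r 1 = r.
Proof.
rewrite arc2_r; last lra.
by rewrite /segpt mulr1 subrr !mul0r !addr0 -surjective_pairing.
Qed.

Lemma inner_arc2 p q r : inner (arc2 p q r) = hseg p q `|` hseg r q.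
Proof.
apply/seteqP; split=> [x [u /= hu <-]|x [[t /= ht <-]|[t /= ht <-]]].
- have [h|h] := leP u (1 / 2).
    by left; exists (2 * u); [rewrite /=; lra|rewrite arc2_l //; lra].
  by right; exists (2 - 2 * u); [rewrite /=; lra|rewrite arc2_r //; lra].
- exists (t / 2); first by rewrite /=; lra.
  by rewrite arc2_l; [congr segpt; lra|lra].
- exists (1 - t / 2); first by rewrite /=; lra.
  by rewrite arc2_r; [congr segpt; lra|lra].
Qed.

Lemma orient_seg p q r s t : orient r s (segpt p q t) = (1 - t) * orient r s p + t * orient r s q.
Proof. rewrite /orient /segpt /=; ring. Qed.

Lemma orientC p q r : orient q p r = - orient p q r.
Proof. rewrite /orient; ring. Qed.

Lemma orient_rot p q r : orient q r p = orient p q r.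
Proof. rewrite /orient; ring. Qed.

Lemma orient_l p q : orient p q p = 0.
Proof. rewrite /orient; ring. Qed.

Lemma orient_r p q : orient p q q = 0.
Proof. rewrite /orient; ring. Qed.

Lemma hseg_orient p q x : hseg p q x -> orient p q x = 0.
Proof. by move=> [t _ <-]; rewrite orient_seg orient_l orient_r; lra. Qed.

Lemma seg_inj p q (u v : R) : p != q -> segpt p q u = segpt p q v -> u = v.
Proof.
case: p q => [a b] [c d]; rewrite /segpt /= => ne [e1 e2].
have {}e1 : (u - v) * (c - a) = 0 by lra.
have {}e2 : (u - v) * (d - b) = 0 by lra.
apply/eqP; rewrite -subr_eq0; apply: contraNT ne => uv.
move/eqP: e1; rewrite mulf_eq0 (negbTE uv) /= subr_eq0 => /eqP->.
by move/eqP: e2; rewrite mulf_eq0 (negbTE uv) /= subr_eq0 => /eqP->.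
Qed.

Lemma orient_neq p q r : orient p q r != 0 -> [/\ p != q, q != r & p != r].
Proof.
by move=> h; split; apply: contraNneq h => ->; rewrite /orient; apply/eqP; ring.
Qed.

Lemma arc2_inj p q r : orient p q r != 0 -> {in `[0, 1] &, injective (arc2 p q r)}.
Proof.
move=> O; have [pq qr _] := orient_neq O.
have mixed u v : 0 <= u <= 1 / 2 -> 1 / 2 <= v <= 1 -> arc2 p q r u = arc2 p q r v -> u = v.
  move=> hu hv; rewrite arc2_l // arc2_r // => e.
  have := congr1 (orient p q) e; rewrite !orient_seg orient_l orient_r !mulr0 addr0 => /esym/eqP.
  rewrite addr0 mulf_eq0 (negbTE O) orbF => /eqP v1.
  have {}v1 : v = 1 / 2 by lra.
  have := congr1 (orient q r) e; rewrite !orient_seg orient_l orient_r orient_rot => /eqP.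
  rewrite !mulr0 !addr0 mulf_eq0 (negbTE O) orbF => /eqP; lra.
move=> u v; rewrite !in_itv /= => hu hv e.
have [u1|u1] := leP u (1 / 2); have [v1|v1] := leP v (1 / 2).
- move: e; rewrite !arc2_l; [move=> /(seg_inj pq)|lra|lra]; lra.
- by apply: mixed => //; lra.
- by apply/esym; apply: mixed => //; lra.
- move: e; rewrite !arc2_r; [rewrite eq_sym in qr; move=> /(seg_inj qr)|lra|lra]; lra.
Qed.

(** One of the segments lies strictly on one side of the line through the other. This suffices for
    disjointness. *)
Definition apart p q r s := 0 < orient p q r * orient p q s \/ 0 < orient r s p * orient r s q.

Definition transverse p q r s :=
  orient p q r * orient p q s < 0 /\ orient r s p * orient r s q < 0.

Lemma hseg_apart p q r s x : apart p q r s -> hseg p q x -> hseg r s x -> False.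
Proof.
have convex (a b t : R) : 0 < t <= 1 -> 0 < a * b -> (1 - t) * a + t * b = 0 -> False.
  move=> ht ab e.
  have a0 : a != 0 by apply: contraTneq ab => ->; rewrite mul0r ltxx.
  have : (1 - t) * (a ^+ 2) + t * (a * b) = 0.
    by rewrite -[RHS](mulr0 a) -e; ring.
  have := sqr_ge0 a; nra.
move=> [h|h] h1 h2.
- have := hseg_orient h1; case: h2 => t /= ht <-; rewrite orient_seg; exact: convex.
- have := hseg_orient h2; case: h1 => t /= ht <-; rewrite orient_seg; exact: convex.
Qed.

Lemma hseg_hinge p q r x : orient p q r != 0 -> hseg p q x -> hseg p r x -> False.
Proof.
move=> O /hseg_orient h [t /= ht e]; move: h; rewrite -e orient_seg orient_l mulr0 add0r.
by move/eqP; rewrite mulf_eq0 (negbTE O) orbF => /eqP t0; lra.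
Qed.

Lemma transverse_det p q r s : transverse p q r s ->
  (q.1 - p.1) * (s.2 - r.2) - (q.2 - p.2) * (s.1 - r.1) != 0.
Proof.
move=> [h _]; apply: contraTneq h => e; rewrite -leNgt.
have -> : orient p q s = orient p q r.
  by apply/eqP; rewrite -subr_eq0 -e /orient; apply/eqP; ring.
exact: sqr_ge0.
Qed.

Lemma transverse_inner p q r s x : transverse p q r s -> hseg p q x -> hseg r s x ->
  exists2 t, 0 < t < 1 & x = segpt p q t.
Proof.
move=> [_ h] [t /= ht <-] h2; exists t => //; have := hseg_orient h2.
rewrite orient_seg; have [->|ne] := eqVneq t 1; last by move=> _; lra.
rewrite subrr mul0r add0r mul1r => e; rewrite e mulr0 ltxx in h => //.
Qed.

(** Cramer's rule for the equations of the two lines. *)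
Lemma transverse_uniq p q r s x y : transverse p q r s ->
  orient p q x = 0 -> orient r s x = 0 -> orient p q y = 0 -> orient r s y = 0 -> x = y.
Proof.
move=> /transverse_det; set Dl := (X in X != 0) => D0 e1 e2 e3 e4.
have hx : Dl * (x.1 - y.1) = (s.1 - r.1) * (orient p q x - orient p q y) -
    (q.1 - p.1) * (orient r s x - orient r s y) by rewrite /Dl /orient; ring.
have hy : Dl * (x.2 - y.2) = (s.2 - r.2) * (orient p q x - orient p q y) -
    (q.2 - p.2) * (orient r s x - orient r s y) by rewrite /Dl /orient; ring.
rewrite e1 e2 e3 e4 subrr !mulr0 subrr in hx hy.
move/eqP: hx; move/eqP: hy; rewrite !mulf_eq0 (negbTE D0) /= !subr_eq0.
by case: x y {e1 e2 e3 e4} => [? ?] [? ?] /= /eqP-> /eqP->.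
Qed.

Lemma transverse_meet p q r s : transverse p q r s -> exists x, hseg p q x /\ hseg r s x.
Proof.
have mean (a b : R) : a * b < 0 -> exists2 t, 0 < t < 1 & (1 - t) * a + t * b = 0.
  move=> ab; have ne : a - b != 0.
    by apply: contraTneq ab => /eqP; rewrite subr_eq0 => /eqP->; rewrite -leNgt sqr_ge0.
  exists (a / (a - b)); last by field.
  have [a0|a0|a0] := ltgtP a 0; last by rewrite a0 mul0r ltxx in ab.
    have b0 : 0 < b by nra.
    rewrite -[a / _]mulrNN -invrN; apply/andP; split; first by apply: divr_gt0; lra.
    by rewrite ltr_pdivrMr; lra.
  have b0 : b < 0 by nra.
  apply/andP; split; first by apply: divr_gt0; lra.
  by rewrite ltr_pdivrMr; lra.
move=> tr; have [h1 h2] := tr; have D0 := transverse_det tr.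
have [t ht et] := mean _ _ h2; have [u hu eu] := mean _ _ h1.
exists (segpt p q t); split; first by exists t => //=; lra.
exists u; first by rewrite /=; lra.
apply: (transverse_uniq tr); rewrite ?orient_seg ?orient_l ?orient_r //; lra.
Qed.

Lemma cont_orient p q : continuous (orient p q).
Proof.
apply: contB; apply: contM; try exact: cont_cst.
  by apply: contB; [apply: cont_snd; exact: cont_id|exact: cont_cst].
by apply: contB; [apply: cont_fst; exact: cont_id|exact: cont_cst].
Qed.

Lemma open_gt0 (T : topologicalType) (f : T -> R) : continuous f -> open [set x | 0 < f x].
Proof. by move=> cf; apply: (@open_comp _ _ f [set y | 0 < y]) => [x _|]; [exact: cf|exact:
  open_gt]. Qed.

(* The region where the barycentric coordinates of p and q with respect to the
   triangle p q r are positive. *)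
Definition wedge p q r : set P :=
  [set x | 0 < orient q r x * orient p q r] `&` [set x | 0 < orient r p x * orient p q r].

Lemma open_wedge p q r : open (wedge p q r).
Proof.
by apply: openI; apply: open_gt0; apply: contM;
  [exact: cont_orient|exact: cont_cst|exact: cont_orient|exact: cont_cst].
Qed.

(** The leg from [r] to [q] has barycentric coordinate 0 at [p], so it misses the wedge; the first
    leg is where the coordinate at [r] vanishes. *)
Lemma wedgeP p q r x : orient p q r != 0 -> wedge p q r x ->
  (hseg p q `|` hseg r q) x <-> orient p q x = 0.
Proof.
move=> O [/= h1 h2]; split=> [[/hseg_orient //|h]|e].
  by move: h1; rewrite orientC (hseg_orient h) oppr0 mul0r ltxx.
left; have sum : orient q r x + orient r p x = orient p q r.
  by rewrite -[LHS]addr0 -e /orient; ring.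
have O2 : 0 < orient p q r ^+ 2 by rewrite exprn_even_gt0.
have tE : orient r p x / orient p q r = orient r p x * orient p q r / orient p q r ^+ 2.
  by field.
exists (orient r p x / orient p q r).
  rewrite /= tE divr_gt0 // ler_pdivrMr // mul1r.
  have -> : orient p q r ^+ 2 = orient q r x * orient p q r + orient r p x * orient p q r.
    by rewrite -mulrDl sum expr2.
  by rewrite lerDr ltW.
have [b1 b2] : orient p q r * x.1 =
      p.1 * orient q r x + q.1 * orient r p x + r.1 * orient p q x /\
    orient p q r * x.2 = p.2 * orient q r x + q.2 * orient r p x + r.2 * orient p q x.
  by split; rewrite /orient; ring.
rewrite e !mulr0 !addr0 (_ : orient q r x = orient p q r - orient r p x) in b1 b2; last by
  rewrite -sum; ring.
rewrite [RHS]surjective_pairing /segpt; congr pair; apply: (mulfI O); rewrite ?b1 ?b2; field;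
  exact: O.
Qed.

(** The chart is affine: its coordinates are the two orientation forms, which turn the lines of the
    segments into the axes, and Cramer's rule inverts it. The two wedges keep the other legs out of
    its domain. *)
Lemma transverse_cross p q r p' q' r' x :
  orient p q r != 0 -> orient p' q' r' != 0 -> transverse p q p' q' ->
  hseg p q x -> hseg p' q' x -> cross_at (hseg p q `|` hseg r q) (hseg p' q' `|` hseg r' q') x.
Proof.
move=> O O' tr h h'.
have in_wedge a b c y : orient a b c != 0 -> (exists2 t, 0 < t < 1 & y = segpt a b t) ->
    wedge a b c y.
  move=> Oc [t ht ->]; split=> /=; rewrite orient_seg.
    by rewrite orient_l mulr0 addr0 orient_rot -mulrA -expr2 mulr_gt0 ?exprn_even_gt0 //; lra.
  by rewrite orient_r mulr0 add0r -orient_rot -mulrA -expr2 mulr_gt0 ?exprn_even_gt0 //; lra.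
have tr' : transverse p' q' p q by case: tr.
have D0 := transverse_det tr; set Dl := (X in X != 0) in D0.
pose k (z : P) : P := (x.1 + (z.2 * (q'.1 - p'.1) - z.1 * (q.1 - p.1)) / Dl,
                       x.2 + (z.2 * (q'.2 - p'.2) - z.1 * (q.2 - p.2)) / Dl).
pose f (y : P) : P := (orient p' q' y, orient p q y).
pose U := wedge p q r `&` wedge p' q' r'.
have x0 : orient p q x = 0 := hseg_orient h.
have x0' : orient p' q' x = 0 := hseg_orient h'.
have cf : continuous f by apply: cont_pair; exact: cont_orient.
have ck : continuous k.
  have c1 : continuous (fun z : P => z.1) by apply: cont_fst; exact: cont_id.
  have c2 : continuous (fun z : P => z.2) by apply: cont_snd; exact: cont_id.
  by apply: cont_pair; (apply: contD; first exact: cont_cst);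
    (apply: contM; last exact: cont_cst); apply: contB;
    (apply: contM; last exact: cont_cst).
have fk y : k (f y) = y.
  have E1 : orient p q y = orient p q y - orient p q x by rewrite x0 subr0.
  have E2 : orient p' q' y = orient p' q' y - orient p' q' x by rewrite x0' subr0.
  rewrite /k /f /= E1 E2 [RHS]surjective_pairing; move: D0; rewrite /Dl /orient => D0.
  by congr pair; field.
have kf z : f (k z) = z.
  have E1 : orient p q (k z) = orient p q (k z) - orient p q x by rewrite x0 subr0.
  have E2 : orient p' q' (k z) = orient p' q' (k z) - orient p' q' x by rewrite x0' subr0.
  rewrite /f E1 E2 [RHS]surjective_pairing /k; move: D0; rewrite /Dl /orient /= => D0.
  by congr pair; field.
have oU : open U by apply: openI; exact: open_wedge.
split; first by left.
  by left.
exists U, (k @^-1` U), f; split=> //.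
- by apply: open_comp => // z _; exact: ck.
- split; apply: in_wedge => //; [exact: transverse_inner tr h h'|exact: transverse_inner tr' h'
  h].
- exists k; split.
  + exact: continuous_subspaceT.
  + exact: continuous_subspaceT.
  + by move=> y Uy; rewrite /= fk.
  + by move=> z Uz; rewrite /= kf.
- by move=> y [w w']; rewrite !wedgeP.
Qed.

End Segments.

(** * Verification of the drawing in integer coordinates *)

Section NaturalDrawing.
Local Open Scope nat_scope.

Definition npoint := (BinNums.N * BinNums.N)%type.

(* The orientation determinant with its negative terms moved to the left. *)
Definition ccw (p q r : npoint) : bool :=
  BinNat.N.ltb (p.2 * q.1 + q.2 * r.1 + r.2 * p.1)%num (p.1 * q.2 + q.1 * r.2 + r.1 * p.2)%num.

Definition bent (p q r : npoint) : bool := ccw p q r || ccw q p r.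

Definition apartb (p q r s : npoint) : bool :=
  [|| ccw p q r && ccw p q s, ccw q p r && ccw q p s,
      ccw r s p && ccw r s q | ccw s r p && ccw s r q].

Definition transb (p q r s : npoint) : bool :=
  (ccw p q r && ccw q p s || ccw q p r && ccw p q s) &&
  (ccw r s p && ccw s r q || ccw s r p && ccw r s q).

Definition hinge (p q r s : npoint) : bool := (p == r) && bent p q s.

Definition nedge := (npoint * npoint * npoint)%type.

Definition nmeet (e f : nedge) : bool :=
  let: (p, q, r) := e in let: (p', q', r') := f in
  [|| transb p q p' q', transb p q r' q', transb r q p' q' | transb r q r' q'].

(** Any two legs must cross transversally, be apart, or leave a common vertex in non-collinear
    directions, so degenerate contacts are rejected. Counting the transverse pairs bounds the number
    of crossings of the two edges by 1. *)
Definition pair_ok (e f : nedge) : bool :=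
  let: (p, q, r) := e in let: (p', q', r') := f in
  let ok a b c d := [|| transb a b c d, apartb a b c d | hinge a b c d] in
  [&& ok p q p' q', ok p q r' q', ok r q p' q' & ok r q r' q'] &&
  (transb p q p' q' + transb p q r' q' + transb r q p' q' + transb r q r' q' <= 1).

Section Checker.
Local Open Scope ring_scope.
Variable R : realType.
Notation P := (R * R)%type.

Definition npt (p : npoint) : P := ((nat_of_bin p.1)%:R, (nat_of_bin p.2)%:R).

Lemma ccwE p q r : ccw p q r = (0 < orient (npt p) (npt q) (npt r)).
Proof.
have addE m n : nat_of_bin (m + n)%num = (nat_of_bin m + nat_of_bin n)%N by lia.
have mulE m n : nat_of_bin (m * n)%num = (nat_of_bin m * nat_of_bin n)%N by lia.
have ltE m n : BinNat.N.ltb m n = (nat_of_bin m < nat_of_bin n)%N by lia.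
rewrite /ccw ltE !addE !mulE -(ltr_nat R) !natrD !natrM -subr_gt0 /orient /=.
by congr (0 < _); ring.
Qed.

Lemma ccwNE p q r : ccw q p r = (orient (npt p) (npt q) (npt r) < 0).
Proof. by rewrite ccwE orientC oppr_gt0. Qed.

Lemma bentE p q r : bent p q r = (orient (npt p) (npt q) (npt r) != 0).
Proof. by rewrite /bent ccwE ccwNE neq_lt orbC. Qed.

Lemma apartbP p q r s : apartb p q r s -> apart (npt p) (npt q) (npt r) (npt s).
Proof.
rewrite /apartb (ccwNE p q) (ccwNE p q) (ccwNE r s) (ccwNE r s) !ccwE.
by case/or4P => /andP[h1 h2]; [left|left|right|right]; nra.
Qed.

Lemma transbP p q r s : transb p q r s -> transverse (npt p) (npt q) (npt r) (npt s).
Proof.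
rewrite /transb (ccwNE p q) (ccwNE p q) (ccwNE r s) (ccwNE r s) !ccwE.
by move=> /andP[/orP h1 /orP h2]; split; [case: h1|case: h2] => /andP[? ?]; nra.
Qed.

Definition narc (e : nedge) : R -> P := arc2 (npt e.1.1) (npt e.1.2) (npt e.2).

Definition bent_edge (e : nedge) := bent e.1.1 e.1.2 e.2.

Lemma pair_ok_trans e f x : pair_ok e f -> inner (narc e) x -> inner (narc f) x ->
  exists2 a : npoint * npoint, a = (e.1.1, e.2) \/ a = (e.2, e.1.1) &
  exists2 b : npoint * npoint, b = (f.1.1, f.2) \/ b = (f.2, f.1.1) &
    [/\ transb a.1 e.1.2 b.1 f.1.2, hseg (npt a.1) (npt e.1.2) x &
       hseg (npt b.1) (npt f.1.2) x].
Proof.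
case: e f => [[p q] r] [[p' q'] r'] /andP[/and4P[h1 h2 h3 h4] _].
rewrite !inner_arc2 /=.
have key a b c d : [|| transb a b c d, apartb a b c d | hinge a b c d] ->
    hseg (npt a) (npt b) x -> hseg (npt c) (npt d) x -> transb a b c d.
  move=> /or3P[//|/apartbP h|/andP[/eqP<- bd]] ha hc.
    by case: (hseg_apart h ha hc).
  by rewrite bentE in bd; case: (hseg_hinge bd ha hc).
move=> [he|he] [hf|hf].
- by exists (p, r); [left|exists (p', r'); [left|split => //; exact: key hf]].
- by exists (p, r); [left|exists (r', p'); [right|split => //; exact: key hf]].
- by exists (r, p); [right|exists (p', r'); [left|split => //; exact: key hf]].
- by exists (r, p); [right|exists (r', p'); [right|split => //; exact: key hf]].
Qed.

Lemma pair_ok_once e f : pair_ok e f -> is_subset1 (inner (narc e) `&` inner (narc f)).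
Proof.
move=> ef x y [xe xf] [ye yf].
have [a aE [b bE [tx xa xb]]] := pair_ok_trans ef xe xf.
have [c cE [d dE [ty yc yd]]] := pair_ok_trans ef ye yf.
have [ac bd] : a.1 = c.1 /\ b.1 = d.1.
  case: e f ef aE bE cE dE tx ty {xe xf ye yf xa xb yc yd} =>
    [[p q] r] [[p' q'] r'] /andP[_] /=.
  move=> cnt [->|->] [->|->] [->|->] [->|->] /= tx ty; split=> //; move: cnt;
  by rewrite tx ty; do 2 case: transb.
rewrite -ac in yc; rewrite -bd in yd.
exact: (transverse_uniq (transbP tx) (hseg_orient xa) (hseg_orient xb)
  (hseg_orient yc) (hseg_orient yd)).
Qed.

Lemma pair_ok_cross e f x : bent_edge e -> bent_edge f -> pair_ok e f ->
  (inner (narc e) `&` inner (narc f)) x -> cross_at (inner (narc e)) (inner (narc f)) x.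
Proof.
move=> be bf ef [xe xf].
have [a aE [b bE [tx xa xb]]] := pair_ok_trans ef xe xf.
have arcE (g : nedge) (c : npoint * npoint) : bent_edge g ->
    c = (g.1.1, g.2) \/ c = (g.2, g.1.1) ->
    inner (narc g) = hseg (npt c.1) (npt g.1.2) `|` hseg (npt c.2) (npt g.1.2) /\
    orient (npt c.1) (npt g.1.2) (npt c.2) != 0.
  rewrite /bent_edge bentE => bg [->|->] /=; first by rewrite inner_arc2.
  by rewrite inner_arc2 setUC; split => //; rewrite orientC oppr_eq0 orient_rot in bg *.
have [-> O] := arcE _ _ be aE; have [-> O'] := arcE _ _ bf bE.
exact: transverse_cross (transbP tx) xa xb.
Qed.

Lemma nmeetP e f : pair_ok e f ->
  nmeet e f <-> inner (narc e) `&` inner (narc f) !=set0.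
Proof.
move=> ef; split.
  case: e f {ef} => [[p q] r] [[p' q'] r'] /or4P[] /transbP/transverse_meet[x [h1 h2]];
  by exists x; rewrite !inner_arc2 /=; split; by [left|right].
move=> [x [xe xf]]; have [a aE [b bE [tx _ _]]] := pair_ok_trans ef xe xf.
move: aE bE tx; case: e f {ef xe xf} => [[p q] r] [[p' q'] r'] /=.
by move=> [->|->] [->|->] /= ->; rewrite ?orbT.
Qed.

End Checker.
Definition table (t : seq (seq npoint)) (r c : 'I_3) : npoint :=
  nth (BinNums.N0, BinNums.N0) (nth [::] t r) c.

(* Coordinates found by a computer search. *)
Definition vpoint := table
  [:: [:: (20, 23); (14, 17); (19, 9)];
      [:: (16, 14); (19, 21); (3, 18)];
      [:: (20, 12); (15, 11); (15, 20)]]%num.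

Definition row_bend := table
  [:: [:: (16, 13); (5, 17); (17, 21)];
      [:: (11, 20); (18, 5); (21, 5)];
      [:: (18, 9); (22, 23); (18, 8)]]%num.

Definition col_bend := table
  [:: [:: (13, 18); (0, 19); (21, 2)];
      [:: (6, 17); (1, 19); (21, 22)];
      [:: (12, 18); (22, 0); (22, 24)]]%num.

Definition edge_id := (bool * ('I_3 * 'I_3))%type.

Definition route (x : edge_id) : nedge :=
  let: (b, (r, c)) := x in
  if b then (vpoint r (S c), row_bend r c, vpoint r (S (S c)))
  else (vpoint (S r) c, col_bend r c, vpoint (S (S r)) c).

Definition endpoints (x : edge_id) : seq ('I_3 * 'I_3) :=
  let: (b, (r, c)) := x in
  if b then [:: (r, S c); (r, S (S c))] else [:: (S r, c); (S (S r), c)].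

Definition all3 (p : pred 'I_3) : bool :=
  [&& p (Ordinal (isT : 0 < 3)), p (Ordinal (isT : 1 < 3)) & p (Ordinal (isT : 2 < 3))].

Lemma all3P (p : pred 'I_3) : all3 p -> forall i, p i.
Proof.
by move=> /and3P[h0 h1 h2] [[|[|[|//]]] hi]; [move: h0|move: h1|move: h2];
  congr (is_true (p _)); apply: val_inj.
Qed.

Definition all_edges (p : pred edge_id) : bool :=
  all3 (fun r => all3 (fun c => p (true, (r, c)) && p (false, (r, c)))).

Lemma all_edgesP (p : pred edge_id) : all_edges p -> forall x, p x.
Proof. by move=> h [[] [r c]]; have /andP[] := all3P (all3P h r) c. Qed.

Lemma routes_bent : all_edges (fun x => bent_edge (route x)).
Proof. by vm_compute. Qed.

Lemma vpoint_distinct : all3 (fun r => all3 (fun c => all3 (fun s => all3 (fun d =>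
  ((r, c) == (s, d)) || (vpoint r c != vpoint s d))))).
Proof. by vm_compute. Qed.

Definition misses (v p q : npoint) : bool := (v == p) || bent p q v.

Lemma routes_miss : all_edges (fun x => all3 (fun r => all3 (fun c =>
  misses (vpoint r c) (route x).1.1 (route x).1.2 &&
  misses (vpoint r c) (route x).2 (route x).1.2))).
Proof. by vm_compute. Qed.

Lemma routes_ok : all_edges (fun x => all_edges (fun y => (x == y) ||
  pair_ok (route x) (route y) &&
  ~~ (has (mem (endpoints x)) (endpoints y) && nmeet (route x) (route y)))).
Proof. by vm_compute. Qed.

Definition sum3c (f : 'I_3 -> nat) : nat :=
  f (Ordinal (isT : 0 < 3)) + f (Ordinal (isT : 1 < 3)) + f (Ordinal (isT : 2 < 3)).

Lemma sum3cE (f g : 'I_3 -> nat) : f =1 g -> \sum_(i < 3) f i = sum3c g.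
Proof.
move=> fg; rewrite (eq_bigr g) => [|i _]; last exact: fg.
rewrite (sum3 (Ordinal (isT : 0 < 3))) /sum3c.
by congr (_ + g _ + g _); apply: val_inj.
Qed.

End NaturalDrawing.

Section TheDrawing.
Variable R : realType.
Notation P := (R * R)%type.

Definition vdraw (v : torus) : P := npt R (vpoint v.1 v.2).

Definition edraw (e : {set torus}) : R -> P :=
  @narc R (if [pick x | torus_edge x == e] is Some x then route x else route (true, (ord0,
    ord0))).

Lemma edrawE x : edraw (torus_edge x) = @narc R (route x).
Proof.
rewrite /edraw; case: pickP => [y /eqP/torus_edge_inj-> //|/(_ x)]; by rewrite eqxx.
Qed.

Lemma edgeP e : e \in edges torus -> exists x, e = torus_edge x.
Proof. by rewrite torus_edges => /imsetP[x _ ->]; exists x. Qed.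

Lemma npt_inj : injective (npt R).
Proof.
move=> [a b] [c d] [] /eqP; rewrite eqr_nat => /eqP ac /eqP; rewrite eqr_nat => /eqP bd.
by congr pair; lia.
Qed.

Lemma vdraw_inj : injective vdraw.
Proof.
move=> [r c] [s d] /npt_inj /= e.
by have := all3P (all3P (all3P (all3P vpoint_distinct r) c) s) d; rewrite e eqxx orbF => /eqP.
Qed.

Lemma endsE x : torus_edge x = [set y in endpoints x]%SET.
Proof. by case: x => [[] [r c]]; apply/setP => y; rewrite !inE. Qed.

Lemma route_ends x : exists p q : torus,
  [/\ endpoints x = [:: p; q], npt R (route x).1.1 = vdraw p & npt R (route x).2 = vdraw q].
Proof.
case: x => [[] [r c]]; first by exists (r, S c), (r, S (S c)).
by exists (S r, c), (S (S r), c).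
Qed.

Lemma route_orient x : orient (npt R (route x).1.1) (npt R (route x).1.2) (npt R (route x).2)
  != 0.
Proof. by rewrite -bentE; exact: (all_edgesP routes_bent). Qed.

Lemma edraw_cont e : e \in edges torus -> {within `[0, 1], continuous (edraw e)}.
Proof. by move=> /edgeP[x ->]; rewrite edrawE; apply: continuous_subspaceT; exact: arc2_cont. Qed.

Lemma edraw_ends e : e \in edges torus ->
  [set edraw e 0; edraw e 1] = vdraw @` [set` e].
Proof.
move=> /edgeP[x ->]; rewrite edrawE /narc arc2_0 arc2_1 endsE.
have [p [q [-> -> ->]]] := route_ends x; apply/seteqP; split=> [y|y [v]] /=.
  by case=> ->; [exists p|exists q]; rewrite //= !inE eqxx ?orbT.
by rewrite !inE => /orP[]/eqP-> <-; [left|right].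
Qed.

Lemma hseg_miss v p q : npt R p != npt R q -> misses v p q ->
  ~ hseg (npt R p) (npt R q) (npt R v).
Proof.
move=> pq /orP[/eqP-> [t /= ht e]|]; last by rewrite (bentE R) => /eqP h /hseg_orient.
have : segpt (npt R p) (npt R q) t = segpt (npt R p) (npt R q) 0.
  by rewrite e /segpt !mul0r !addr0 -surjective_pairing.
by move/(seg_inj pq); lra.
Qed.

Lemma edraw_vertex e v : e \in edges torus -> ~ inner (edraw e) (vdraw v).
Proof.
move=> /edgeP[x ->]; rewrite edrawE /narc inner_arc2.
have [pq qr _] := orient_neq (route_orient x).
have /andP[h1 h2] := all3P (all3P (all_edgesP routes_miss x) v.1) v.2.
by move=> [|]; apply: hseg_miss => //; rewrite eq_sym.
Qed.

Lemma edraw_inj e : e \in edges torus -> {in `[0, 1] &, injective (edraw e)}.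
Proof. by move=> /edgeP[x ->]; rewrite edrawE; apply: arc2_inj; exact: route_orient. Qed.

Lemma edraw_self_finite e : e \in edges torus ->
  finite_set [set st : R * R |
    [/\ 0 < st.1, st.1 < st.2, st.2 < 1 & edraw e st.1 = edraw e st.2]].
Proof.
move=> eE; rewrite (_ : [set st | _] = set0) //; apply/seteqP; split=> // -[s t] /= [s0 st t1 h].
have := edraw_inj eE _ _ h; rewrite !in_itv /= => /(_ ltac:(lra) ltac:(lra)); lra.
Qed.

Lemma routes_pair x y : x != y -> pair_ok (route x) (route y) /\
  ~~ (has (mem (endpoints x)) (endpoints y) && nmeet (route x) (route y)).
Proof.
by move=> xy; have := all_edgesP (all_edgesP routes_ok x) y; rewrite (negbTE xy) => /andP[].
Qed.

Lemma edraw_once e f : e \in edges torus -> f \in edges torus -> e != f ->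
  is_subset1 (inner (edraw e) `&` inner (edraw f)).
Proof.
move=> /edgeP[x ->] /edgeP[y ->] ne; rewrite !edrawE; apply: pair_ok_once.
by have [] := @routes_pair x y; first by apply: contraNneq ne => ->.
Qed.

Lemma edraw_finite e f : e \in edges torus -> f \in edges torus -> e != f ->
  finite_set (inner (edraw e) `&` inner (edraw f)).
Proof.
move=> eE fE ne; have once := edraw_once eE fE ne.
have [->|/set0P[p hp]] := eqVneq (inner (edraw e) `&` inner (edraw f)) set0; first exact:
  finite_set0.
by apply: (sub_finite_set _ (finite_set1 p)) => q hq; exact: once.
Qed.

Definition torus_drawing : drawing R torus :=
  @Drawing R torus vdraw edraw vdraw_inj edraw_cont edraw_ends edraw_vertex
    edraw_self_finite edraw_finite.

Lemma torus_darc x : darc torus_drawing (torus_edge x) = @narc R (route x).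
Proof. exact: edrawE. Qed.

Lemma torus_drawing_good : good_drawing torus_drawing.
Proof.
split=> [e eE|e f /edgeP[x ->] /edgeP[y ->] ne|e f eE fE ne|e f p /edgeP[x ->] /edgeP[y ->] ne].
- exact: edraw_inj.
- move=> /set0Pn[v h]; rewrite !endsE !inE in h; have /andP[vx vy] := h.
  have [ok] := @routes_pair x y ltac:(by apply: contraNneq ne => ->).
  have -> : has (mem (endpoints x)) (endpoints y) by apply/hasP; exists v.
  rewrite andTb => {}h; rewrite !torus_darc; apply/seteqP; split=> // p hp.
  by move/negP: h; apply; apply/(nmeetP R ok); exists p.
- exact: edraw_once.
- rewrite !torus_darc; have [ok _] := @routes_pair x y ltac:(by apply: contraNneq ne => ->).
  by apply: pair_ok_cross => //; exact: (all_edgesP routes_bent).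
Qed.

Lemma torus_crosses x y : x != y ->
  crosses torus_drawing (torus_edge x) (torus_edge y) = nmeet (route x) (route y).
Proof.
move=> xy; have [ok _] := routes_pair xy; apply/asboolP/idP; rewrite !torus_darc => h.
  by apply/(nmeetP R ok).
by apply/(nmeetP R ok).
Qed.

Let row_miss t c d : nat := ~~ nmeet (route (true, (S t, c))) (route (true, (S (S t), d))).
Let col_miss t c d : nat := ~~ nmeet (route (false, (c, S t))) (route (false, (d, S (S t)))).
Let mix_miss r c s d : nat := ~~ nmeet (route (true, (r, c))) (route (false, (s, d))).

Lemma torus_crossings : crossings torus_drawing = 78%N.
Proof.
have rowE t c d : rowdef torus_drawing t c d = row_miss t c d.
  have := @torus_crosses (true, (S t, c)) (true, (S (S t), d)).
  by rewrite /torus_edge /= /rowdef /row_miss => -> //; rewrite !xpair_eqE ordS_neq.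
have colE t c d : coldef torus_drawing t c d = col_miss t c d.
  have := @torus_crosses (false, (c, S t)) (false, (d, S (S t))).
  by rewrite /torus_edge /= /coldef /col_miss => -> //; rewrite !xpair_eqE ordS_neq andbF.
have mixE r c s d : mixdef torus_drawing r c s d = mix_miss r c s d.
  have := @torus_crosses (true, (r, c)) (false, (s, d)).
  by rewrite /torus_edge /= /mixdef /mix_miss => -> //.
have := crossings_total torus_drawing_good.
suff -> : deficits (rowdef torus_drawing) (coldef torus_drawing) (mixdef torus_drawing) = 21%N.
  by lia.
(* Explicit three-term sums replace the indexed ones, so that the 21 deficits can be obtained by
   evaluation. *)
have triple f g : (forall t c d, f t c d = g t c d) ->
    (\sum_(t < 3) \sum_(c < 3) \sum_(d < 3) f t c d)%N =
    sum3c (fun t => sum3c (fun c => sum3c (g t c))).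
  by move=> fg; do 3 (apply: sum3cE => ?); exact: fg.
rewrite /deficits (triple _ row_miss) // (triple _ col_miss) //.
rewrite (sum3cE (g := fun r => sum3c (mix mix_miss r))) => [|r]; last first.
  by apply: sum3cE => a; rewrite /mix !mixE.
by vm_compute.
Qed.

End TheDrawing.

Theorem theorem1 (R : realType) :
  is_max_cr R (cart_prod (cycle_graph 3) (cycle_graph 3)) 78.
Proof.
split=> [D gD|]; first exact: crossings_le.
by exists (torus_drawing R); split; [exact: torus_drawing_good|exact: torus_crossings].
Qed.
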